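(* Let $C$ be a constant $d\times d$ matrix whose eigenvalues satisfy $c_i+c_j\ne 0$ for all $i,j$, and consider the system $$CF'+F'C=[C,F^2+B],\qquad B'=[B,F]\qquad(1)$$ for $d\times d$ matrix functions $F(x),B(x)$. This system admits the real reduction $$F=-F^\top,\qquad C=C^\top,\qquad B=B^\top$$ (that is, for real symmetric $C$, system (1) restricts to pairs of a real skew-symmetric $F$ and a real symmetric $B$), and the reduced system describes the rotation of a $d$-dimensional rigid body about its centre of mass in the external field with an arbitrary quadratic potential: under the identification $x=t$, $F=\Omega$, $C=J$, $B=P$, $M=CF+FC$ it coincides with $$\dot M=[M,\Omega]-[P,J],\qquad \dot P=[P,\Omega],\qquad M=J\Omega+\Omega J .$$ Moreover, the motion of the body frame on $SO(d)$ can be expressed explicitly in terms of the eigenfunctions of the corresponding finite-gap Schrödinger operator $L=-D_x^2+U$, $U=-F'+F^2+B$, by the formulas $$F=-\phi'\phi^{-1},\qquad B=\phi\Lambda\phi^{-1},\qquad L\phi=\phi\Lambda,$$ with $\Lambda$ a constant matrix.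
   Context: $D_x=d/dx$, $[X,Y]=XY-YX$, ${}^\top$ is transposition. System (1) is the case $\alpha=0$ of the period-one closure of the matrix Darboux dressing chain. The equations of rotation of a $d$-dimensional rigid body about its centre of mass in a Newtonian field with general quadratic potential (Bogoyavlenskij, Reyman) are $\dot M=[M,\Omega]-[P,J]$, $\dot P=[P,\Omega]$, where $\Omega\in so(d)$ is the angular velocity, $J$ is the fixed real symmetric inertia matrix, $M=J\Omega+\Omega J\in so(d)$ is the angular momentum, and $P$ is the real symmetric matrix describing the quadratic potential in the moving frame. The body frame is a curve $Q(t)\in SO(d)$ with $Q^{-1}\dot Q=\Omega$ and $P=Q^{-1}\Lambda Q$, $\Lambda$ constant symmetric; the matrix $\phi$ in the formulas is $\phi=Q^{-1}$. When $\Lambda=\mathrm{diag}(\beta^{(1)},\dots,\beta^{(d)})$, the columns $\phi^{(i)}$ of $\phi$ are solutions of $L\phi^{(i)}=\beta^{(i)}\phi^{(i)}$. ''Finite-gap'' (in the sense of Dubrovin) means that the vector eigenfunction of $L$ is meromorphic on a Riemann surface of finite genus. *)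

(* Defs.v *)
#[export] Set Warnings "-notation-overridden,-notation-incompatible-prefix".
From HB Require Import structures.
From mathcomp Require Export all_boot all_order all_algebra.
From mathcomp Require Export all_classical all_reals all_analysis.
From mathcomp Require Export complex.

Set Implicit Arguments.
Unset Strict Implicit.
Unset Printing Implicit Defensive.

Export Order.TTheory GRing.Theory Num.Theory.
Export numFieldNormedType.Exports.

Local Open Scope classical_set_scope.
Local Open Scope ring_scope.

Definition lie (K : pzRingType) (d : nat) (X Y : 'M[K]_d) : 'M[K]_d :=
  X *m Y - Y *m X.

Definition skew_mx (K : pzRingType) (d : nat) (X : 'M[K]_d) : Prop := X^T = - X.

Definition sym_mx (K : pzRingType) (d : nat) (X : 'M[K]_d) : Prop := X^T = X.

Definition complexify (R : realType) (m n : nat) (A : 'M[R]_(m, n)) :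
  'M[R[i]]_(m, n) := map_mx (real_complex R) A.

(* R[i] is a normed space over itself only, so the derivative of a complex
   matrix function of a real variable is taken on real and imaginary parts. *)
Definition is_cderive (R : realType) (m n : nat) (x : R)
    (G : R -> 'M[R[i]]_(m, n)) (G' : 'M[R[i]]_(m, n)) : Prop :=
  is_derive x 1 (fun t => map_mx (@complex.Re R) (G t))
    (map_mx (@complex.Re R) G') /\
  is_derive x 1 (fun t => map_mx (@complex.Im R) (G t))
    (map_mx (@complex.Im R) G').

(* (X, Y) is an admissible value of (F', B') at a point where (F, B) = (F0, B0). *)
Definition dressing_velocity (K : pzRingType) (d : nat)
    (C F0 B0 X Y : 'M[K]_d) : Prop :=
  C *m X + X *m C = lie C (F0 *m F0 + B0) /\ Y = lie B0 F0.

Definition dressing_system (R : realType) (d : nat) (I : set R)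
    (C : 'M[R[i]]_d) (F B : R -> 'M[R[i]]_d) : Prop :=
  forall x, I x -> exists F' B' : 'M[R[i]]_d,
    [/\ is_cderive x F F', is_cderive x B B'
      & dressing_velocity C (F x) (B x) F' B'].

Definition reduced_dressing_system (R : realType) (d : nat) (I : set R)
    (C : 'M[R[i]]_d) (F B : R -> 'M[R]_d) : Prop :=
  dressing_system I C (fun x => complexify (F x)) (fun x => complexify (B x)) /\
  (forall x, I x -> skew_mx (F x) /\ sym_mx (B x)).

Definition rigid_body (R : realType) (d : nat) (I : set R)
    (J : 'M[R]_d) (Omega P M : R -> 'M[R]_d) : Prop :=
  forall t, I t ->
    [/\ skew_mx (Omega t), sym_mx (P t),
        M t = J *m Omega t + Omega t *m J,
        is_derive t 1 M (lie (M t) (Omega t) - lie (P t) J)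
      & is_derive t 1 P (lie (P t) (Omega t))].

Definition body_frame (R : realType) (d : nat) (I : set R)
    (Omega Q : R -> 'M[R]_d) : Prop :=
  forall t, I t ->
    [/\ (Q t)^T *m Q t = 1%:M, \det (Q t) = 1,
        derivable Q t 1 & invmx (Q t) *m derive1 Q t = Omega t].

(* L Y = Z on I, for L = - D_x^2 + U acting on the columns of Y. *)
Definition schrodinger (R : realType) (d n : nat) (I : set R)
    (U : R -> 'M[R]_d) (Y Z : R -> 'M[R[i]]_(d, n)) : Prop :=
  exists Y1 Y2 : R -> 'M[R[i]]_(d, n), forall x, I x ->
    [/\ is_cderive x Y (Y1 x), is_cderive x Y1 (Y2 x)
      & Z x = - Y2 x + complexify (U x) *m Y x].

(* The algebraic curve p(z, w) = 0, where p is a polynomial in w with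
   coefficients in R[i][z].  For p monic in w, z exhibits the normalization of
   the curve as a finite branched cover of the z-plane, that is, as a compact
   Riemann surface (of finite genus; disconnected if p is reducible) punctured
   at the points over z = oo. *)
Definition on_curve (R : realType) (p : {poly {poly R[i]}}) (z w : R[i]) : Prop :=
  (p.[w%:P]).[z] = 0.

Definition holomorphic_at0 (R : realType) (h : R[i] -> R[i]) : Prop :=
  \forall t \near (0 : (R[i] : numFieldType)^o),
    derivable (h : (R[i] : numFieldType)^o -> (R[i] : numFieldType)^o) t 1.

(* Meromorphy on the normalization of the curve: along every holomorphic germ
   t |-> (z t, w t) into the curve (in particular along a uniformizer at each
   point of the normalization, including the branches at a singular point),
   f is h t / t ^+ m off t = 0 for a holomorphic h.  The value of f at
   isolated points, such as poles, is irrelevant. *)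
Definition meromorphic_on_curve (R : realType) (p : {poly {poly R[i]}})
    (f : R[i] -> R[i] -> R[i]) : Prop :=
  forall z w : R[i] -> R[i],
    holomorphic_at0 z -> holomorphic_at0 w ->
    (\forall t \near (0 : (R[i] : numFieldType)^o), on_curve p (z t) (w t)) ->
    exists (m : nat) (h : R[i] -> R[i]), holomorphic_at0 h /\
      \forall t \near (0 : (R[i] : numFieldType)^o)^',
        t ^+ m * f (z t) (w t) = h t.

(* Exponential singularity of the eigenfunction at the points over z = oo:
   psi x / exp (k (x - x0)) with k ^+ 2 = - z has at most a pole there, and its
   size is comparable to that of psi x0, locally uniformly in x.
   |exp (k (x - x0))| is written expR (Re k * (x - x0)). *)
Definition exponential_at_infinity (R : realType) (d : nat) (I : set R)
    (p : {poly {poly R[i]}}) (psi : R -> R[i] -> R[i] -> 'cV[R[i]]_d) : Prop :=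
  exists2 x0, I x0 & forall a b, I a -> I b -> exists (K : R) (N : nat),
    forall z w, on_curve p z w -> (K%:C)%C <= `|z| ->
      `|psi x0 z w| <= `|z| ^+ N /\
      exists2 k : R[i], k ^+ 2 = - z & forall x, a <= x <= b ->
        let e := ((expR (complex.Re k * (x - x0)))%:C)%C in
        `|psi x z w| <= (K%:C)%C * e * `|psi x0 z w| /\
        e * `|psi x0 z w| <= (K%:C)%C * `|psi x z w|.

(* L = - D_x^2 + U is finite-gap: it has a (Baker-Akhiezer) vector eigenfunction
   psi x P, L psi = z(P) psi, meromorphic in P on a Riemann surface of finite
   genus punctured over z = oo, where it has exponential singularities; for
   all but finitely many z, its values at the points over z span all the
   solutions of L y = z y.  Several psi_j on the same surface are allowed,
   because a multiple component of the spectral curve carries an eigenspace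
   of dimension > 1. *)
Definition finite_gap (R : realType) (d : nat) (I : set R)
    (U : R -> 'M[R]_d) : Prop :=
  exists (p : {poly {poly R[i]}}) (r : nat)
         (psi : 'I_r -> R -> R[i] -> R[i] -> 'cV[R[i]]_d),
    [/\ p \is monic,
        forall j x i, I x ->
          meromorphic_on_curve p (fun z w => psi j x z w i ord0),
        forall j z w, on_curve p z w ->
          schrodinger I U (fun x => psi j x z w) (fun x => z *: psi j x z w),
        forall j, exponential_at_infinity I p (psi j)
      & exists bad : seq R[i], forall z, z \notin bad ->
          forall y : R -> 'cV[R[i]]_d,
          schrodinger I U y (fun x => z *: y x) ->
          exists (s : seq R[i]) (a : R[i] -> 'I_r -> R[i]),
            (forall w, w \in s -> on_curve p z w) /\
            forall x, I x ->
              y x = \sum_(w <- s) \sum_(j < r) a w j *: psi j x z w].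

Definition dressing_potential (R : realType) (d : nat)
    (F B : R -> 'M[R]_d) (x : R) : 'M[R]_d :=
  - derive1 F x + F x *m F x + B x.

(* Main.v *)
Require Import Defs.
From mathcomp Require Import perm separable ring lra.

Set Implicit Arguments.
Unset Strict Implicit.
Unset Printing Implicit Defensive.

Local Open Scope classical_set_scope.
Local Open Scope ring_scope.

(* Put [M = C F + F C] and [N(w) = B + w M - w^2 C^2].  System (1) is equivalent
   to the Lax equation [N(w)' = [w C - F, N(w)]], and a solution of
   [y' = (w C - F) y] with [N(w) y = z y] at one point satisfies it everywhere
   and then [L y = z y].  So the curve is [det (N(w) - z) = 0], taken as the
   characteristic polynomial in [w] of the companion linearization [T(z)] of the
   pencil, and the eigenfunctions are [Phi(x, w)] applied to eigenvectors of
   [T(z)], where [Phi] is the fundamental solution.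
   - [Phi] is entire in [w], by Gronwall estimates.
   - For real [z >> 0], [T(z)] is skew-adjoint for a positive definite form, so
     the minimal annihilator [q(z, w)] of [T] is separable; then
     [(q(z, T) - q(z, w)) / (T - w)] gives eigenvectors polynomial in [(z, w)],
     and Lagrange interpolation shows that they span for generic [z].
   - As [z -> oo], [(w C - k)(w C + k) y = (B + w M) y] with [k^2 = - z]; since
     [c_i + c_j <> 0], one of the two factors is uniformly invertible, and
     [y' = k y + O(1) y] for the right sign of [k].
   The body frame is the solution of [Q' = Q F], and [Q B Q^-1] is constant. *)

(** Spanning needs only that [T(z)] be diagonalizable for all but finitely many [z], and reality
    provides this: [T(z)] is the phase-space matrix of a gyroscopic system with mass [C^2],
    stiffness [z - B] and skew gyroscopic term [M], and it preserves the energy, which is definite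
    for large real [z]. That a given polynomial kills [T(z)] is polynomial in [z], so it extends
    from a half-line to all complex [z]. The space of dimension [2 d] on which [T(z)] acts is also
    the space of Cauchy data of [L y = z y]: as [y' + F y = w C y] for the functions constructed,
    the eigenvector [(y, w y)] is the pair [(y, C^-1 (y' + F y))]. The condition on the eigenvalues
    acts in three places. With [i = j] it makes [C] invertible, so that the pencil has an invertible
    leading coefficient. It makes the equation for [F'] uniquely solvable. At infinity it prevents
    [C] from having eigenvalues near both [k / w] and [- k / w], so that all components of [y] share
    one exponent. *)

(** * Derivatives of complex matrix functions of a real variable *)

Section Calculus.
Context {R : realType}.
Implicit Types (x t : R) (f g : R -> R[i]).

Local Notation Re := (@complex.Re R).
Local Notation Im := (@complex.Im R).

Lemma ReM (a b : R[i]) : Re (a * b) = Re a * Re b - Im a * Im b.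
Proof. by case: a; case: b. Qed.

Lemma ImM (a b : R[i]) : Im (a * b) = Re a * Im b + Im a * Re b.
Proof. by case: a; case: b. Qed.

Lemma ReD (a b : R[i]) : Re (a + b) = Re a + Re b.
Proof. by case: a; case: b. Qed.

Lemma ImD (a b : R[i]) : Im (a + b) = Im a + Im b.
Proof. by case: a; case: b. Qed.

Lemma ReN (a : R[i]) : Re (- a) = - Re a. Proof. by case: a. Qed.

Lemma ImN (a : R[i]) : Im (- a) = - Im a. Proof. by case: a. Qed.

Lemma complexP (a b : R[i]) : Re a = Re b -> Im a = Im b -> a = b.
Proof. by case: a; case: b => ? ? ? ? /= -> ->. Qed.

(** Scalar counterpart of [is_cderive]: the matrix rules below are reduced to it entry by entry. *)
Definition cder x f (df : R[i]) : Prop :=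
  is_derive x 1 (Re \o f) (Re df) /\ is_derive x 1 (Im \o f) (Im df).

Lemma cder_cst x (a : R[i]) : cder x (fun=> a) 0.
Proof. by split; apply: is_derive_cst. Qed.

Lemma cderD x f g df dg : cder x f df -> cder x g dg ->
  cder x (fun t => f t + g t) (df + dg).
Proof.
move=> [fr fi] [gr gi]; split; rewrite ?ReD ?ImD.
  rewrite (_ : _ \o _ = (Re \o f) + (Re \o g)); first exact: is_deriveD.
  by apply/funext => t; rewrite /= ?ReD ?ImD.
rewrite (_ : _ \o _ = (Im \o f) + (Im \o g)); first exact: is_deriveD.
by apply/funext => t; rewrite /= ?ReD ?ImD.
Qed.

Lemma cderN x f df : cder x f df -> cder x (fun t => - f t) (- df).
Proof.
move=> [fr fi]; split; rewrite ?ReN ?ImN.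
  rewrite (_ : _ \o _ = - (Re \o f)); first exact: is_deriveN.
  by apply/funext => t; rewrite /= ?ReN ?ImN.
rewrite (_ : _ \o _ = - (Im \o f)); first exact: is_deriveN.
by apply/funext => t; rewrite /= ?ReN ?ImN.
Qed.

Lemma cderM x f g df dg : cder x f df -> cder x g dg ->
  cder x (fun t => f t * g t) (df * g x + f x * dg).
Proof.
move=> [fr fi] [gr gi]; split.
  rewrite (_ : _ \o _ = (Re \o f) * (Re \o g) - (Im \o f) * (Im \o g)).
    by apply: is_derive_eq; rewrite ReD !ReM /GRing.scale /=; ring.
  by apply/funext => t; rewrite /= ReM.
rewrite (_ : _ \o _ = (Re \o f) * (Im \o g) + (Im \o f) * (Re \o g)).
  apply: (is_derive_eq (is_deriveD (is_deriveM fr gi) (is_deriveM fi gr))).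
  by rewrite ImD !ImM /GRing.scale /=; ring.
by apply/funext => t; rewrite /= ImM.
Qed.

Lemma cder_sum x (T : Type) (s : seq T) (f : T -> R -> R[i]) df :
  (forall k, cder x (f k) (df k)) ->
  cder x (fun t => \sum_(k <- s) f k t) (\sum_(k <- s) df k).
Proof.
move=> fd; elim: s => [|k s IH].
  rewrite big_nil (_ : (fun _ => _) = fun=> 0); first exact: cder_cst.
  by apply/funext => t; rewrite big_nil.
rewrite big_cons (_ : (fun _ => _) = fun t => f k t + \sum_(k <- s) f k t).
  exact: cderD.
by apply/funext => t; rewrite big_cons.
Qed.

Lemma is_derive_mxP m n x (M : R -> 'M[R]_(m, n)) D :
  is_derive x 1 M D <-> forall i j, is_derive x 1 (fun t => M t i j) (D i j).
Proof.
split=> [MD i j | MD].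
  have dM : derivable M x 1 by case: MD.
  have [/(_ dM) dMij _] := derivable_mxP M x 1.
  have <- : 'D_1 (fun t => M t i j) x = D i j.
    by have := @derive_val _ _ _ _ _ _ _ MD; rewrite derive_mx// => <-; rewrite mxE.
  exact/derivableP.
have dM : derivable M x 1 by apply/derivable_mxP => i j; case: (MD i j).
apply: DeriveDef => //; rewrite derive_mx//; apply/matrixP => i j.
by rewrite mxE; apply: derive_val.
Qed.

Lemma is_cderiveP m n x (G : R -> 'M[R[i]]_(m, n)) D :
  is_cderive x G D <-> forall i j, cder x (fun t => G t i j) (D i j).
Proof.
have E (h : R[i] -> R) i j :
    (fun t => map_mx h (G t) i j) = h \o (fun t => G t i j).
  by apply/funext => t; rewrite mxE.
split=> [[Gr Gi] i j | GD].
  split; rewrite -E.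
    by have /is_derive_mxP/(_ i j) := Gr; rewrite mxE.
  by have /is_derive_mxP/(_ i j) := Gi; rewrite mxE.
by split; apply/is_derive_mxP => i j; rewrite E mxE; case: (GD i j).
Qed.

Lemma is_cderive_cst m n x (A : 'M[R[i]]_(m, n)) : is_cderive x (fun=> A) 0.
Proof. by apply/is_cderiveP => i j; rewrite mxE; apply: cder_cst. Qed.

Lemma is_cderiveD m n x (G H : R -> 'M[R[i]]_(m, n)) dG dH :
  is_cderive x G dG -> is_cderive x H dH ->
  is_cderive x (fun t => G t + H t) (dG + dH).
Proof.
move=> /is_cderiveP Gd /is_cderiveP Hd; apply/is_cderiveP => i j; rewrite mxE.
rewrite (_ : (fun t => _) = fun t => G t i j + H t i j); first exact: cderD.
by apply/funext => t; rewrite mxE.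
Qed.

Lemma is_cderiveN m n x (G : R -> 'M[R[i]]_(m, n)) dG :
  is_cderive x G dG -> is_cderive x (fun t => - G t) (- dG).
Proof.
move=> /is_cderiveP Gd; apply/is_cderiveP => i j; rewrite mxE.
rewrite (_ : (fun t => _) = fun t => - G t i j); first exact: cderN.
by apply/funext => t; rewrite mxE.
Qed.

Lemma is_cderiveB m n x (G H : R -> 'M[R[i]]_(m, n)) dG dH :
  is_cderive x G dG -> is_cderive x H dH ->
  is_cderive x (fun t => G t - H t) (dG - dH).
Proof. by move=> Gd Hd; apply: is_cderiveD => //; apply: is_cderiveN. Qed.

Lemma is_cderiveM m n p x (G : R -> 'M[R[i]]_(m, n)) (H : R -> 'M[R[i]]_(n, p))
    dG dH :
  is_cderive x G dG -> is_cderive x H dH ->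
  is_cderive x (fun t => G t *m H t) (dG *m H x + G x *m dH).
Proof.
move=> /is_cderiveP Gd /is_cderiveP Hd; apply/is_cderiveP => i j.
rewrite !mxE -big_split /=.
rewrite (_ : (fun t => _) = fun t => \sum_k G t i k * H t k j).
  by apply: cder_sum => k; apply: cderM.
by apply/funext => t; rewrite mxE.
Qed.

Lemma is_cderiveMl m n p x (A : 'M[R[i]]_(m, n)) (H : R -> 'M[R[i]]_(n, p)) dH :
  is_cderive x H dH -> is_cderive x (fun t => A *m H t) (A *m dH).
Proof.
by move=> Hd; have := is_cderiveM (is_cderive_cst x A) Hd; rewrite mul0mx add0r.
Qed.

Lemma is_cderiveMr m n p x (A : 'M[R[i]]_(n, p)) (H : R -> 'M[R[i]]_(m, n)) dH :
  is_cderive x H dH -> is_cderive x (fun t => H t *m A) (dH *m A).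
Proof.
by move=> Hd; have := is_cderiveM Hd (is_cderive_cst x A); rewrite mulmx0 addr0.
Qed.

Lemma is_cderiveZ m n x (a : R[i]) (H : R -> 'M[R[i]]_(m, n)) dH :
  is_cderive x H dH -> is_cderive x (fun t => a *: H t) (a *: dH).
Proof.
move=> Hd; rewrite -mul_scalar_mx (_ : (fun t => _) = fun t => a%:M *m H t).
  exact: is_cderiveMl.
by apply/funext => t; rewrite mul_scalar_mx.
Qed.

Lemma is_cderive_sum m n x (T : Type) (s : seq T) (f : T -> R -> 'M[R[i]]_(m, n))
    df : (forall k, is_cderive x (f k) (df k)) ->
  is_cderive x (fun t => \sum_(k <- s) f k t) (\sum_(k <- s) df k).
Proof.
move=> fd; elim: s => [|k s IH].
  rewrite big_nil (_ : (fun _ => _) = fun=> 0); first exact: is_cderive_cst.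
  by apply/funext => t; rewrite big_nil.
rewrite big_cons (_ : (fun _ => _) = fun t => f k t + \sum_(k <- s) f k t).
  exact: is_cderiveD.
by apply/funext => t; rewrite big_cons.
Qed.

(* Covers transposes, submatrices, blocks and reshapings. *)
Lemma is_cderive_reindex m n p q x (G : R -> 'M[R[i]]_(m, n)) dG
    (H : 'M[R[i]]_(m, n) -> 'M[R[i]]_(p, q)) (u : 'I_p -> 'I_q -> 'I_m * 'I_n) :
  (forall A i j, H A i j = A (u i j).1 (u i j).2) ->
  is_cderive x G dG -> is_cderive x (fun t => H (G t)) (H dG).
Proof.
move=> HE /is_cderiveP Gd; apply/is_cderiveP => i j; rewrite HE.
rewrite (_ : (fun t => _) = fun t => G t (u i j).1 (u i j).2); first exact: Gd.
by apply/funext => t; rewrite HE.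
Qed.

Lemma is_cderive_trmx m n x (G : R -> 'M[R[i]]_(m, n)) dG :
  is_cderive x G dG -> is_cderive x (fun t => (G t)^T) dG^T.
Proof. by apply: (is_cderive_reindex (u := fun i j => (j, i))) => A i j; rewrite mxE. Qed.

Lemma cder_conj x f df : cder x f df -> cder x (fun t => conjc (f t)) (conjc df).
Proof.
have ReJ a : Re (conjc a) = Re a by case: a.
have ImJ a : Im (conjc a) = - Im a by case: a.
move=> [fr fi]; split.
  by rewrite ReJ (_ : _ \o _ = Re \o f)//; apply/funext => t; rewrite /= ReJ.
rewrite ImJ (_ : _ \o _ = - (Im \o f)); first exact: is_deriveN.
by apply/funext => t; rewrite /= ImJ.
Qed.

Lemma is_cderive_conj m n x (G : R -> 'M[R[i]]_(m, n)) dG :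
  is_cderive x G dG ->
  is_cderive x (fun t => map_mx (@conjc R) (G t)) (map_mx (@conjc R) dG).
Proof.
move=> /is_cderiveP Gd; apply/is_cderiveP => i j; rewrite mxE.
rewrite (_ : (fun t => _) = fun t => conjc (G t i j)); first exact: cder_conj.
by apply/funext => t; rewrite mxE.
Qed.

Lemma is_cderive_complexify m n x (G : R -> 'M[R]_(m, n)) dG :
  is_cderive x (fun t => complexify (G t)) (complexify dG) <-> is_derive x 1 G dG.
Proof.
have ReE (A : 'M[R]_(m, n)) : map_mx Re (complexify A) = A.
  by apply/matrixP => i j; rewrite !mxE.
have ImE (A : 'M[R]_(m, n)) : map_mx Im (complexify A) = 0.
  by apply/matrixP => i j; rewrite !mxE.
split=> [[+ _]|Gd].
  by rewrite ReE; under [X in is_derive _ _ X]eq_fun do rewrite ReE.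
split; first by rewrite ReE; under [X in is_derive _ _ X]eq_fun do rewrite ReE.
rewrite ImE; under [X in is_derive _ _ X]eq_fun do rewrite ImE.
exact: is_derive_cst.
Qed.

Lemma is_cderive_unique m n x (G : R -> 'M[R[i]]_(m, n)) D1 D2 :
  is_cderive x G D1 -> is_cderive x G D2 -> D1 = D2.
Proof.
move=> [r1 i1] [r2 i2]; apply/matrixP => i j; apply: complexP.
  have /matrixP/(_ i j) : map_mx Re D1 = map_mx Re D2.
    by rewrite -(@derive_val _ _ _ _ _ _ _ r1) -(@derive_val _ _ _ _ _ _ _ r2).
  by rewrite !mxE.
have /matrixP/(_ i j) : map_mx Im D1 = map_mx Im D2.
  by rewrite -(@derive_val _ _ _ _ _ _ _ i1) -(@derive_val _ _ _ _ _ _ _ i2).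
by rewrite !mxE.
Qed.

Lemma is_derive_near (V : normedModType R) x (f g : R -> V) df :
  (\forall t \near x, f t = g t) -> is_derive x 1 f df -> is_derive x 1 g df.
Proof. by move=> fg fd; apply: near_eq_is_derive fd => //; rewrite oner_eq0. Qed.

Lemma is_cderive_near m n x (G H : R -> 'M[R[i]]_(m, n)) D :
  (\forall t \near x, G t = H t) -> is_cderive x G D -> is_cderive x H D.
Proof.
move=> GH [r i]; split.
  by apply: is_derive_near r; apply: filterS GH => t ->.
by apply: is_derive_near i; apply: filterS GH => t ->.
Qed.

Lemma is_cderive_on (I : set R) m n x (G H : R -> 'M[R[i]]_(m, n)) D :
  open I -> I x -> (forall t, I t -> G t = H t) ->
  is_cderive x G D -> is_cderive x H D.
Proof.
by move=> oI Ix GH; apply: is_cderive_near; near=> t; apply: GH; near: t;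
  apply: open_nbhs_nbhs.
Unshelve. all: by end_near. Qed.

Lemma is_derive_on (I : set R) (V : normedModType R) x (G H : R -> V) D :
  open I -> I x -> (forall t, I t -> G t = H t) ->
  is_derive x 1 G D -> is_derive x 1 H D.
Proof.
by move=> oI Ix GH; apply: is_derive_near; near=> t; apply: GH; near: t;
  apply: open_nbhs_nbhs.
Unshelve. all: by end_near. Qed.

End Calculus.

(** * The squared Frobenius norm, with values in the real field *)

Section Frobenius.
Context {R : realType}.

Local Notation Re := (@complex.Re R).
Local Notation Im := (@complex.Im R).

(** Squared modulus taken in [R] rather than [R[i]]: it is differentiable everywhere, and the
    estimates stay within the reach of real arithmetic. *)
Definition sqc (a : R[i]) : R := Re a ^+ 2 + Im a ^+ 2.

Lemma sqc_ge0 a : 0 <= sqc a. Proof. by rewrite addr_ge0 ?sqr_ge0. Qed.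

Lemma sqcM a b : sqc (a * b) = sqc a * sqc b.
Proof. by rewrite /sqc ReM ImM; ring. Qed.

Lemma sqcX a k : sqc (a ^+ k) = sqc a ^+ k.
Proof.
elim: k => [|k IH]; last by rewrite !exprS sqcM IH.
by rewrite !expr0 /sqc /=; ring.
Qed.

Lemma sqc_normE a : `|a| = (Num.sqrt (sqc a))%:C%C.
Proof. by rewrite normc_def. Qed.

Lemma sqc_eq0 a : (sqc a == 0) = (a == 0).
Proof.
rewrite -[a == 0]normr_eq0 sqc_normE -(inj_eq (@complexI R)) /=.
by rewrite -[in LHS](sqr_sqrtr (sqc_ge0 a)) rmorphXn /= expf_eq0.
Qed.

Lemma sqcD a b : sqc (a + b) <= 2 * (sqc a + sqc b).
Proof.
rewrite /sqc ReD ImD; have := sqr_ge0 (Re a - Re b); have := sqr_ge0 (Im a - Im b).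
by nra.
Qed.

Lemma sqcN a : sqc (- a) = sqc a.
Proof. by rewrite /sqc ReN ImN !sqrrN. Qed.

Lemma ler_double_of_sqr (x u v : R) : 0 <= u -> 0 <= v -> x ^+ 2 <= u * v ->
  2 * x <= u + v.
Proof.
move=> u0 v0 xuv; rewrite leNgt; apply/negP => xgt.
have : (u + v) * (u + v) < (2 * x) * (2 * x) by apply: ltr_pM; nra.
by have := sqr_ge0 (u - v); nra.
Qed.

(** Cauchy-Schwarz, by induction on the list; the cross term is controlled by the
    arithmetic-geometric mean inequality [ler_double_of_sqr]. *)
Lemma sqc_sum (T : Type) (s : seq T) (a b : T -> R[i]) :
  sqc (\sum_(k <- s) a k * b k) <=
  (\sum_(k <- s) sqc (a k)) * (\sum_(k <- s) sqc (b k)).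
Proof.
elim: s => [|k s IH]; first by rewrite !big_nil /sqc /=; lra.
rewrite !big_cons.
set S := \sum_(j <- s) a j * b j in IH *.
have /= A0 : 0 <= \sum_(j <- s) sqc (a j) by apply: sumr_ge0 => *; apply: sqc_ge0.
have /= B0 : 0 <= \sum_(j <- s) sqc (b j) by apply: sumr_ge0 => *; apply: sqc_ge0.
move: (\sum_(j <- s) sqc (a j)) (\sum_(j <- s) sqc (b j)) A0 B0 IH => A B A0 B0 IH.
have a0 := sqc_ge0 (a k); have b0 := sqc_ge0 (b k).
pose c := a k * b k; have cE : sqc c = sqc (a k) * sqc (b k) by rewrite sqcM.
(* Half the cross term of [|c + S|^2]. Its square is at most [|c|^2 |S|^2], the difference being the
   square of [Re c * Im S - Im c * Re S]. *)
pose x := Re c * Re S + Im c * Im S.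
have xle : x ^+ 2 <= sqc c * sqc S.
  by rewrite /x /sqc; have := sqr_ge0 (Re c * Im S - Im c * Re S); nra.
have : 2 * x <= sqc (a k) * B + A * sqc (b k).
  apply: ler_double_of_sqr; [exact: mulr_ge0|exact: mulr_ge0|].
  apply: le_trans xle _; rewrite cE.
  have := ler_wpM2l (mulr_ge0 a0 b0) IH; nra.
have -> : sqc (a k * b k + S) = sqc c + 2 * x + sqc S.
  by rewrite /sqc /x ReD ImD -/c; ring.
by rewrite cE mulrDl !mulrDr; lra.
Qed.

Section Nsq.
Context {m n : nat}.
Implicit Types A B : 'M[R[i]]_(m, n).

Definition nsq A : R := \sum_i \sum_j sqc (A i j).

Lemma nsq_ge0 A : 0 <= nsq A.
Proof. by do 2 apply: sumr_ge0 => ? _; apply: sqc_ge0. Qed.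

Lemma nsq_entry A i j : sqc (A i j) <= nsq A.
Proof.
rewrite /nsq (bigD1 i)//= (bigD1 j)//= -addrA lerDl addr_ge0//.
  by apply: sumr_ge0 => ? _; apply: sqc_ge0.
by do 2 apply: sumr_ge0 => ? _; apply: sqc_ge0.
Qed.

Lemma nsq_eq0 A : nsq A = 0 -> A = 0.
Proof.
move=> A0; apply/matrixP => i j; rewrite mxE; apply/eqP; rewrite -sqc_eq0.
by rewrite eq_le sqc_ge0 -A0 nsq_entry.
Qed.

Lemma nsq0 : nsq 0 = 0.
Proof.
rewrite /nsq big1// => i _; rewrite big1// => j _.
by rewrite mxE; apply/eqP; rewrite sqc_eq0.
Qed.

Lemma nsqD A B : nsq (A + B) <= 2 * (nsq A + nsq B).
Proof.
rewrite /nsq -big_split mulr_sumr; apply: ler_sum => i _ /=.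
rewrite -big_split mulr_sumr; apply: ler_sum => j _ /=.
by rewrite mxE sqcD.
Qed.

Lemma nsqN A : nsq (- A) = nsq A.
Proof. by apply: eq_bigr => i _; apply: eq_bigr => j _; rewrite mxE sqcN. Qed.

Lemma nsqB A B : nsq (A - B) <= 2 * (nsq A + nsq B).
Proof. by rewrite -(nsqN B) nsqD. Qed.

Lemma nsqZ a A : nsq (a *: A) = sqc a * nsq A.
Proof.
rewrite /nsq mulr_sumr; apply: eq_bigr => i _; rewrite mulr_sumr.
by apply: eq_bigr => j _; rewrite mxE sqcM.
Qed.

(** Real part of the Hermitian inner product, which is half the derivative of [nsq] at [A] in the
    direction [B]. *)
Definition ipr A B : R :=
  \sum_i \sum_j (Re (A i j) * Re (B i j) + Im (A i j) * Im (B i j)).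

Lemma ipr_le A B : `|2 * ipr A B| <= nsq A + nsq B.
Proof.
rewrite ler_norml /ipr /nsq -big_split; apply/andP; split.
  rewrite -[leLHS]mulN1r !mulr_sumr; apply: ler_sum => i _ /=.
  rewrite -big_split !mulr_sumr; apply: ler_sum => j _ /=; rewrite /sqc.
  have := sqr_ge0 (Re (A i j) + Re (B i j)).
  by have := sqr_ge0 (Im (A i j) + Im (B i j)); nra.
rewrite !mulr_sumr; apply: ler_sum => i _ /=.
rewrite -big_split !mulr_sumr; apply: ler_sum => j _ /=; rewrite /sqc.
have := sqr_ge0 (Re (A i j) - Re (B i j)).
by have := sqr_ge0 (Im (A i j) - Im (B i j)); nra.
Qed.

Lemma iprDr A B B' : ipr A (B + B') = ipr A B + ipr A B'.
Proof.
rewrite /ipr -big_split; apply: eq_bigr => i _ /=; rewrite -big_split.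
by apply: eq_bigr => j _ /=; rewrite mxE ReD ImD; ring.
Qed.

Lemma iprZ A a : ipr A (a *: A) = Re a * nsq A.
Proof.
rewrite /ipr /nsq mulr_sumr; apply: eq_bigr => i _ /=; rewrite mulr_sumr.
by apply: eq_bigr => j _ /=; rewrite mxE ReM ImM /sqc; ring.
Qed.

Lemma is_derive_nsq (x : R) (Y : R -> 'M[R[i]]_(m, n)) dY :
  is_cderive x Y dY -> is_derive x 1 (nsq \o Y) (2 * ipr (Y x) dY).
Proof.
move=> /is_cderiveP Yd.
rewrite (_ : nsq \o Y = \sum_i \sum_j
    ((Re \o (fun t => Y t i j)) ^+ 2 + (Im \o (fun t => Y t i j)) ^+ 2)); last first.
  apply/funext => t; rewrite /nsq fct_sumE /=; apply: eq_bigr => i _.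
  by rewrite fct_sumE.
have Yij i j : is_derive x 1
    ((Re \o (fun t => Y t i j)) ^+ 2 + (Im \o (fun t => Y t i j)) ^+ 2)
    (2 * (Re (Y x i j) * Re (dY i j) + Im (Y x i j) * Im (dY i j))).
  have [Yr Yi] := Yd i j.
  apply: (is_derive_eq (is_deriveD (is_deriveX 2 Yr) (is_deriveX 2 Yi))).
  by rewrite !expr1 /GRing.scale /=; ring.
apply: (is_derive_eq (is_derive_sum (fun i => is_derive_sum (Yij i)))).
by rewrite /ipr mulr_sumr; apply: eq_bigr => i _; rewrite mulr_sumr.
Qed.

End Nsq.

Lemma nsqM m n p (A : 'M[R[i]]_(m, n)) (B : 'M[R[i]]_(n, p)) :
  nsq (A *m B) <= nsq A * nsq B.
Proof.
rewrite /nsq mulr_suml; apply: ler_sum => i _.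
rewrite (exchange_big_dep predT)//= mulr_sumr; apply: ler_sum => j _.
by rewrite mxE; apply: sqc_sum.
Qed.

Lemma nsq_mxvec m n (A : 'M[R[i]]_(m, n)) : nsq (mxvec A) = nsq A.
Proof.
rewrite /nsq big_ord1 (reindex _ (curry_mxvec_bij m n)) /= pair_bigA /=.
by apply: eq_bigr => -[i j] _ /=; rewrite mxvecE.
Qed.

End Frobenius.

(** * Gronwall estimates and uniqueness for differential equations *)

Section Gronwall.
Context {R : realType}.

(** The integrating factor [expR (- (K * x))] makes [E] nonincreasing. [E] may have any sign, so the
    lower bound follows by passing to [- E]. *)
Lemma gronwall (E dE : R -> R) (K a b : R) : a <= b ->
  (forall x, a <= x <= b -> is_derive x 1 E (dE x)) ->
  (forall x, a <= x <= b -> dE x <= K * E x) ->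
  E b <= expR (K * (b - a)) * E a.
Proof.
move=> ab Ed EK; pose h x := expR (- (K * x)) * E x.
have hd x : a <= x <= b -> is_derive x 1 h (expR (- (K * x)) * (dE x - K * E x)).
  move=> /Ed xd; have -> : h = (expR \o (fun x => - K * x)) * E.
    by apply/funext => t; rewrite /h -mulNr.
  by apply: is_derive_eq; rewrite /GRing.scale /= mulNr; ring.
have : h b <= h a.
  apply: (@ler0_derive1_nincr _ h a b) => //.
  - move=> x; rewrite in_itv /= => /andP[ax xb].
    by have /hd[] : a <= x <= b by rewrite !ltW.
  - move=> x; rewrite in_itv /= => /andP[ax xb].
    have xab : a <= x <= b by rewrite !ltW.
    rewrite derive1E; have -> := @derive_val _ _ _ _ _ _ _ (hd _ xab).
    by rewrite pmulr_rle0 ?expR_gt0// subr_le0 EK.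
  - apply: derivable_within_continuous => x; rewrite in_itv /= => xab.
    by case: (hd _ xab).
rewrite /h -(ler_pM2l (expR_gt0 (K * b))) mulrA -expRD subrr expR0 mul1r.
by rewrite mulrA -expRD (_ : _ + _ = K * (b - a)); [|ring].
Qed.

Lemma gronwall_below (E dE : R -> R) (K a b : R) : a <= b ->
  (forall x, a <= x <= b -> is_derive x 1 E (dE x)) ->
  (forall x, a <= x <= b -> K * E x <= dE x) ->
  expR (K * (b - a)) * E a <= E b.
Proof.
move=> ab Ed EK; rewrite -lerN2 -mulrN.
apply: (@gronwall (fun x => - E x) (fun x => - dE x)) => // x xab.
  by have := Ed _ xab => Ex; exact: is_deriveN.
by rewrite mulrN lerN2 EK.
Qed.

Lemma gronwall_abs (E dE : R -> R) (K a b x y : R) : 0 <= K ->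
  (forall x, a <= x <= b -> is_derive x 1 E (dE x)) ->
  (forall x, a <= x <= b -> `|dE x| <= K * E x) ->
  a <= x <= b -> a <= y <= b -> E x <= expR (K * `|x - y|) * E y.
Proof.
move=> K0 Ed EK /andP[ax xb] /andP[ay yb].
have [yx|/ltW xy] := leP y x.
  rewrite ger0_norm ?subr_ge0//; apply: gronwall => // t /andP[yt tx].
    by apply: Ed; rewrite (le_trans ay)// (le_trans tx).
  apply: le_trans (ler_norm _) _; apply: EK.
  by rewrite (le_trans ay)// (le_trans tx).
rewrite ler0_norm ?subr_le0// opprB.
rewrite -(ler_pM2l (expR_gt0 (- (K * (y - x))))) mulrA -expRD addNr expR0 mul1r.
rewrite -mulNr; apply: (@gronwall_below _ dE) => // t /andP[xt ty].
  by apply: Ed; rewrite (le_trans ax)// (le_trans ty).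
rewrite mulNr lerNl; apply: le_trans (EK t _).
  by rewrite -normrN ler_norm.
by rewrite (le_trans ax)// (le_trans ty).
Qed.

(** Adding the constant [G] to the energy absorbs the inhomogeneous term; the [+ 1] in the exponent
    is the [nsq (Y x)] produced by [ipr_le]. *)
Lemma nsq_gronwall m n (Y dY : R -> 'M[R[i]]_(m, n)) (K G a b x y : R) :
  0 <= K -> 0 <= G ->
  (forall x, a <= x <= b -> is_cderive x Y (dY x)) ->
  (forall x, a <= x <= b -> nsq (dY x) <= K * nsq (Y x) + G) ->
  a <= x <= b -> a <= y <= b ->
  nsq (Y x) + G <= expR ((K + 1) * `|x - y|) * (nsq (Y y) + G).
Proof.
move=> K0 G0 Yd YK.
apply: (@gronwall_abs (fun x => nsq (Y x) + G) (fun x => 2 * ipr (Y x) (dY x))).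
- by lra.
- move=> t /Yd/is_derive_nsq td.
  have -> : (fun x => nsq (Y x) + G) = (nsq \o Y) + cst G by [].
  by apply: is_derive_eq; rewrite addr0.
- move=> t tab; apply: le_trans (ipr_le _ _) _; have := YK _ tab.
  have := nsq_ge0 (Y t); nra.
Qed.

Definition locb (I : set R) (h : R -> R) :=
  forall a b, I a -> I b -> exists2 K : R, 0 <= K & forall x, a <= x <= b -> h x <= K.

Lemma locb_nsq (I : set R) m n (Y : R -> 'M[R[i]]_(m, n)) : is_interval I ->
  (forall x, I x -> exists D, is_cderive x Y D) -> locb I (nsq \o Y).
Proof.
move=> Ii Yd a b Ia Ib; have [ab|ba] := leP a b; last first.
  by exists 0 => // x /andP[ax xb]; have := le_trans ax xb; rewrite leNgt ba.
have Ix x : a <= x <= b -> I x by exact: Ii.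
have [|c _ cm] := @EVT_max R (nsq \o Y) a b ab.
  apply: derivable_within_continuous => x; rewrite in_itv /= => /Ix/Yd[D].
  by move=> /is_derive_nsq[].
by exists (nsq (Y c)) => [|x xab]; [exact: nsq_ge0|apply: cm; rewrite in_itv].
Qed.

(** Only the size of the derivative is constrained, so the lemma also applies to the difference of
    two solutions of a nonlinear system. *)
Lemma ode_zero (I : set R) m n (Y dY : R -> 'M[R[i]]_(m, n)) (h : R -> R) x0 :
  is_interval I -> locb I h ->
  (forall x, I x -> is_cderive x Y (dY x)) ->
  (forall x, I x -> nsq (dY x) <= h x * nsq (Y x)) ->
  I x0 -> Y x0 = 0 -> forall x, I x -> Y x = 0.
Proof.
move=> Ii hb Yd Yh Ix0 Y0 x Ix; apply: nsq_eq0; apply/eqP.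
rewrite eq_le nsq_ge0 andbT.
pose a := Num.min x x0; pose b := Num.max x x0.
have Ia : I a by rewrite /a; case: ltP.
have Ib : I b by rewrite /b; case: ltP.
have [K K0 hK] := hb a b Ia Ib.
have It t : a <= t <= b -> I t by exact: Ii.
have := @nsq_gronwall m n Y dY K 0 a b x x0 K0 (lexx _).
rewrite Y0 nsq0 !addr0 mulr0; apply.
- by move=> t /It/Yd.
- move=> t tab; rewrite addr0; apply: le_trans (Yh _ (It _ tab)) _.
  by rewrite ler_wpM2r ?nsq_ge0 ?hK.
- by rewrite /a /b ge_min lexx le_max lexx.
- by rewrite /a /b ge_min lexx le_max lexx !orbT.
Qed.

Lemma lin_ode_zero (I : set R) m n (A : R -> 'M[R[i]]_m) (Y : R -> 'M[R[i]]_(m, n)) x0 :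
  is_interval I -> (forall x, I x -> exists D, is_cderive x A D) ->
  (forall x, I x -> is_cderive x Y (A x *m Y x)) ->
  I x0 -> Y x0 = 0 -> forall x, I x -> Y x = 0.
Proof.
move=> Ii Ad Yd; apply: (@ode_zero I m n Y (fun x => A x *m Y x) (nsq \o A)) => //.
  exact: locb_nsq.
by move=> x Ix; apply: nsqM.
Qed.

Lemma is_cderive0_cst (I : set R) m n (Y : R -> 'M[R[i]]_(m, n)) x0 :
  is_interval I -> (forall x, I x -> is_cderive x Y 0) ->
  I x0 -> forall x, I x -> Y x = Y x0.
Proof.
move=> Ii Yd Ix0 x Ix; apply/eqP; rewrite -subr_eq0; apply/eqP.
apply: (@lin_ode_zero I m n (fun=> 0) (fun x => Y x - Y x0) x0) => //.
- by move=> t It; exists 0; apply: is_cderive_cst.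
- move=> t It; rewrite mul0mx -[0]subr0.
  by apply: is_cderiveB; [exact: Yd|exact: is_cderive_cst].
- by rewrite subrr.
Qed.

End Gronwall.

(** * Primitives of continuous functions and existence for linear systems, by Picard iteration *)

Section Primitive.
Context {R : realType}.
Implicit Types (f g h : R -> R) (I : set R).

Lemma is_derive_continuous f (x D : R) : is_derive x 1 f D -> {for x, continuous f}.
Proof. by case=> /derivable1_diffP/differentiable_continuous. Qed.

Lemma derive0_eq (E : R -> R) (a b x y : R) :
  (forall x, a <= x <= b -> is_derive x 1 E 0) ->
  a <= x <= b -> a <= y <= b -> E x = E y.
Proof.
move=> Ed xab yab; apply/eqP; rewrite eq_le.
have H := @gronwall_abs R E (fun=> 0) 0 a b _ _ (lexx _) Ed.
have K t : a <= t <= b -> `|0 : R| <= 0 * E t by rewrite normr0 mul0r.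
have := H x y K xab yab; have := H y x K yab xab.
by rewrite !mul0r expR0 !mul1r => -> ->.
Qed.

Lemma open_below I x : open I -> I x -> exists2 a, I a & a < x.
Proof.
move=> oI Ix; have /nbhs_ballP[e /= e0 sub] : nbhs x I by exact: open_nbhs_nbhs.
exists (x - e / 2); last by lra.
by apply: sub; rewrite /ball /= opprB addrC subrK ger0_norm; lra.
Qed.

Lemma open_above I x : open I -> I x -> exists2 a, I a & x < a.
Proof.
move=> oI Ix; have /nbhs_ballP[e /= e0 sub] : nbhs x I by exact: open_nbhs_nbhs.
exists (x + e / 2); last by lra.
by apply: sub; rewrite /ball /= opprD addNKr normrN ger0_norm; lra.
Qed.

Lemma is_derive_integral I f (a y : R) : open I -> is_interval I ->
  {in I, continuous f} -> I a -> I y -> a < y ->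
  is_derive y 1 (fun t => \int[lebesgue_measure]_(s in `[a, t]) f s)%R (f y).
Proof.
move=> oI Ii fc Ia Iy ay; have [u Iu yu] := open_above oI Iy.
have fi : lebesgue_measure.-integrable `[a, u] (EFin \o f).
  apply: continuous_compact_integrable; first exact: segment_compact.
  apply: continuous_in_subspaceT => t; rewrite inE /= in_itv /= => atu.
  by apply: fc; rewrite inE; apply: Ii atu.
have [|d E] := @continuous_FTC1_closed R f a y u yu fi ay.
  by apply: fc; rewrite inE.
by apply: DeriveDef; [exact: d|rewrite -derive1E].
Qed.

Lemma primitive I f x0 : open I -> is_interval I -> {in I, continuous f} -> I x0 ->
  exists2 G, G x0 = 0 & forall x, I x -> is_derive x 1 G (f x).
Proof.
move=> oI Ii fc Ix0.
(* The integral from [a] is differentiated only to the right of [a], so the lower limit is chosen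
   for each [x], below both [x] and [x0]. *)
have /choice[al alP] : forall x, exists a, I x -> [/\ I a, a < x & a < x0].
  move=> x; have [Ix|nIx] := pselect (I x); last by exists 0.
  have : I (Num.min x x0) by case: ltP.
  by move=> /(open_below oI)[a Ia]; rewrite lt_min => /andP[ax ax0]; exists a.
pose P a y := (\int[lebesgue_measure]_(s in `[a, y]) f s)%R.
have Pd a y : I a -> I y -> a < y -> is_derive y 1 (P a) (f y).
  exact: is_derive_integral.
exists (fun x => P (al x) x - P (al x) x0) => [|x Ix]; first by rewrite subrr.
have [Iax axx axx0] := alP x Ix.
have Gx : is_derive x 1 (fun t => P (al x) t - P (al x) x0) (f x).
  have -> : (fun t => P (al x) t - P (al x) x0) = P (al x) - cst (P (al x) x0) by [].
  by have := Pd _ _ Iax Ix axx => ?; apply: is_derive_eq; rewrite subr0.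
(* At a nearby [t] the candidate uses [al t] instead of [al x]. The values agree because the two
   integrals differ by a constant between [t] and [x0]. *)
apply: is_derive_near Gx; near=> t.
have It : I t by near: t; apply: open_nbhs_nbhs.
have xt : al x < t by near: t; exact: lt_nbhsr.
have [Iat att atx0] := alP t It.
pose a := Num.min t x0; pose b := Num.max t x0.
have Ib : I b by rewrite /b; case: ltP.
have Da s : a <= s <= b -> is_derive s 1 (P (al x) - P (al t)) 0.
  move=> /andP[sa sb].
  have xs : al x < s by apply: lt_le_trans sa; rewrite lt_min xt.
  have ts : al t < s by apply: lt_le_trans sa; rewrite lt_min att.
  have Is : I s by apply: (Ii _ _ Iax Ib); rewrite (ltW xs).
  have := Pd _ _ Iax Is xs => ?; have := Pd _ _ Iat Is ts => ?.
  by apply: is_derive_eq; rewrite subrr.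
have := derive0_eq Da (x := t) (y := x0).
rewrite /a /b !ge_min !le_max !lexx !orbT /= => /(_ isT isT).
rewrite /= -[(P (al x) - P (al t)) t]/(P (al x) t - P (al t) t).
by rewrite -[(P (al x) - P (al t)) x0]/(P (al x) x0 - P (al t) x0); lra.
Unshelve. all: by end_near. Qed.

Lemma ler_deriv f g (df dg : R -> R) (a b : R) : a <= b ->
  (forall x, a <= x <= b -> is_derive x 1 f (df x)) ->
  (forall x, a <= x <= b -> is_derive x 1 g (dg x)) ->
  (forall x, a <= x <= b -> df x <= dg x) -> f b - f a <= g b - g a.
Proof.
move=> ab fd gd fg.
have := @gronwall R (f - g) (fun x => df x - dg x) 0 a b ab.
rewrite mul0r expR0 mul1r.
rewrite -[(f - g) b]/(f b - g b) -[(f - g) a]/(f a - g a) => H.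
suff : f b - g b <= f a - g a by lra.
apply: H => x xab; last by rewrite mul0r subr_le0 fg.
by have := fd _ xab => ?; have := gd _ xab => ?; apply: is_derive_eq.
Qed.

Lemma norm_deriv_le f g (df dg : R -> R) (a b : R) : a <= b ->
  (forall x, a <= x <= b -> is_derive x 1 f (df x)) ->
  (forall x, a <= x <= b -> is_derive x 1 g (dg x)) ->
  (forall x, a <= x <= b -> `|df x| <= dg x) -> `|f b - f a| <= g b - g a.
Proof.
move=> ab fd gd fg; rewrite ler_norml; apply/andP; split.
  have := @ler_deriv (fun x => - f x) g (fun x => - df x) dg a b ab.
  have nfd x : a <= x <= b -> is_derive x 1 (fun x => - f x) (- df x).
    by move=> /fd xd; exact: is_deriveN.
  move=> /(_ nfd gd) H; suff : - f b - - f a <= g b - g a by lra.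
  by apply: H => x xab; apply: le_trans (fg _ xab); rewrite -normrN ler_norm.
apply: (@ler_deriv f g df dg) => // x xab.
by apply: le_trans (fg _ xab); rewrite ler_norm.
Qed.

(** The bound on [dh] is the derivative of [C * expR (L * |x - x0|)] in the direction away from
    [x0]. This is the integration step of a contraction in an exponentially weighted norm. *)
Lemma norm_le_exp h (dh : R -> R) (L C a b x0 x : R) :
  (forall x, a <= x <= b -> is_derive x 1 h (dh x)) ->
  (forall x, a <= x <= b -> `|dh x| <= L * (C * expR (L * `|x - x0|))) ->
  a <= x0 <= b -> a <= x <= b -> h x0 = 0 -> 0 <= C ->
  `|h x| <= C * expR (L * `|x - x0|).
Proof.
move=> hd dhL /andP[ax0 x0b] /andP[ax xb] h0 C0.
(* The sign [s] of [x - x0] replaces the absolute value on each side of [x0]. *)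
have ed (c s t : R) : is_derive t 1 (fun u => c * expR (s * L * (u - x0)))
    (s * L * (c * expR (s * L * (t - x0)))).
  have -> : (fun u => c * expR (s * L * (u - x0))) =
     c *: (expR \o (fun u => (s * L) * (u - x0))) by [].
  have ? : is_derive t 1 (fun u => (s * L) * (u - x0)) (s * L).
    have -> : (fun u => (s * L) * (u - x0)) = (s * L) *: (id - cst x0) by [].
    by apply: is_derive_eq; rewrite subr0 /GRing.scale /= mulr1.
  by apply: is_derive_eq; rewrite /GRing.scale /=; ring.
have [xx0|/ltW x0x] := leP x x0.
  have tab t : x <= t <= x0 -> a <= t <= b.
    by move=> /andP[xt tx]; rewrite (le_trans ax xt) (le_trans tx x0b).
  have := norm_deriv_le xx0 (fun t tx => hd t (tab t tx)) (fun t _ => ed (- C) (-1) t).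
  rewrite h0 sub0r normrN subrr mulr0 expR0 mulr1 => H.
  rewrite (@ler0_norm _ (x - x0)) ?subr_le0//.
  have -> : L * - (x - x0) = -1 * L * (x - x0) by ring.
  apply: le_trans (H _) _ => [t txx|]; last by rewrite mulNr; lra.
  apply: le_trans (dhL t (tab t txx)) _; case/andP: txx => _ tx.
  rewrite (@ler0_norm _ (t - x0)) ?subr_le0// (_ : L * - (t - x0) = -1 * L * (t - x0)); last ring.
  by rewrite le_eqVlt; apply/orP; left; apply/eqP; ring.
have tab t : x0 <= t <= x -> a <= t <= b.
  by move=> /andP[xt tx]; rewrite (le_trans ax0 xt) (le_trans tx xb).
have := norm_deriv_le x0x (fun t tx => hd t (tab t tx)) (fun t _ => ed C 1 t).
rewrite h0 subr0 subrr mulr0 expR0 mulr1 mul1r => H.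
rewrite (@ger0_norm _ (x - x0)) ?subr_ge0//.
apply: le_trans (H _) _ => [t txx|]; last by lra.
apply: le_trans (dhL t (tab t txx)) _; case/andP: txx => tx _.
by rewrite (@ger0_norm _ (t - x0)) ?subr_ge0 ?mul1r.
Qed.

Lemma half_pow_small (C e : R) : 0 < e -> exists k, C * 2^-1 ^+ k <= e.
Proof.
move=> e0; exists (Num.bound `|C / e|).
rewrite exprVn ler_pdivrMr ?exprn_gt0// mulrC -ler_pdivrMr//.
apply: le_trans (ler_norm _) _; apply: le_trans (ltW (archi_boundP (normr_ge0 _))) _.
by rewrite -natrX ler_nat ltnW// ltn_expl.
Qed.

Lemma expR_ge1 (x : R) : 0 <= x -> 1 <= expR x.
Proof. by move=> x0; rewrite -expR0 ler_expR. Qed.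

Lemma eq0_half_pow (C x : R) : (forall k, `|x| <= C * 2^-1 ^+ k) -> x = 0.
Proof.
move=> xC; apply/eqP; rewrite -normr_eq0 eq_le normr_ge0 andbT leNgt.
apply/negP => x0; have [k] := @half_pow_small C (`|x| / 2) ltac:(lra).
by have := xC k; lra.
Qed.

Lemma half_pow_cvg (s : nat -> R) (c : R) :
  (forall k, `|s k.+1 - s k| <= c * 2^-1 ^+ k) ->
  exists l, forall k, `|l - s k| <= 2 * c * 2^-1 ^+ k.
Proof.
move=> sc; have pow_gt0 k : 0 < 2^-1 ^+ k :> R by rewrite exprn_gt0// invr_gt0.
have sm k m : `|s (k + m)%N - s k| <= 2 * c * (2^-1 ^+ k - 2^-1 ^+ (k + m)).
  elim: m => [|m IH]; first by rewrite addn0 !subrr normr0 mulr0.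
  rewrite addnS -(subrKA (s (k + m)%N)); apply: le_trans (ler_normD _ _) _.
  by have := sc (k + m)%N; rewrite exprS; move: IH; lra.
have c0 : 0 <= c by have := le_trans (normr_ge0 _) (sc 0); rewrite expr0 mulr1.
(* Adding the tail of the geometric series makes the sequence nonincreasing and bounded below, so it
   converges. *)
pose t k := s k + 2 * c * 2^-1 ^+ k.
have tb k m : `|t (k + m)%N - s k| <= 2 * c * 2^-1 ^+ k.
  have := sm k m; rewrite /t !ler_norml => /andP[? ?].
  have := mulr_ge0 c0 (ltW (pow_gt0 (k + m)%N)).
  by move=> ?; apply/andP; split; lra.
have tc : cvgn t.
  apply: nonincreasing_is_cvgn.
    apply/nonincreasing_seqP => k; rewrite /t exprS.
    by have := sc k; rewrite ler_norml => /andP[]; lra.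
  exists (s 0 - 2 * c) => _ [k _ <-]; have := tb 0 k.
  by rewrite add0n expr0 mulr1 ler_norml => /andP[]; lra.
exists (limn t) => k; rewrite ler_norml; apply/andP; split.
  suff : s k - 2 * c * 2^-1 ^+ k <= limn t by lra.
  apply: limr_ge => //; exists k => // m /= km; have := tb k (m - k)%N.
  by rewrite subnKC// ler_norml => /andP[]; lra.
suff : limn t <= s k + 2 * c * 2^-1 ^+ k by lra.
apply: limr_le => //; exists k => // m /= km; have := tb k (m - k)%N.
by rewrite subnKC// ler_norml => /andP[]; lra.
Qed.

Section Picard.
Variables (I : set R) (T : finType) (A : T -> T -> R -> R) (xi : T -> R) (x0 : R).
Hypotheses (oI : open I) (Ii : is_interval I) (Ix0 : I x0).
Hypothesis Ac : forall i j, {in I, continuous (A i j)}.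

Let is_prim f G := G x0 = 0 /\ forall x, I x -> is_derive x 1 G (f x).
(** A choice of primitive as a total operator, so that the Picard step can be iterated; for
    continuous integrands the default value is never taken. *)
Let prim f : R -> R := xget (fun=> 0) (is_prim f).

Let primP f : {in I, continuous f} -> is_prim f (prim f).
Proof.
move=> fc; have [G G0 Gd] := primitive oI Ii fc Ix0.
by have := xgetI (fun=> 0) (conj G0 Gd : is_prim f G).
Qed.

Let rhs (u : T -> R -> R) i x := \sum_j A i j x * u j x.

Let rhs_cont u i : (forall j, {in I, continuous (u j)}) -> {in I, continuous (rhs u i)}.
Proof.
move=> uc x xI; have -> : rhs u i = \sum_j (A i j * u j).
  by apply/funext => t; rewrite fct_sumE.
by elim/big_ind: _ => [|f g fc gc|j _]; [exact: cvg_cst|exact: cvgD|];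
  apply: cvgM; [exact: Ac|exact: uc].
Qed.

Let step (u : T -> R -> R) i x := xi i + prim (rhs u i) x.

Let step_deriv u i x : (forall j, {in I, continuous (u j)}) -> I x ->
  is_derive x 1 (step u i) (rhs u i x).
Proof.
move=> uc Ix; have [_ /(_ _ Ix) pd] := primP (@rhs_cont u i uc).
have -> : step u i = cst (xi i) + prim (rhs u i) by [].
by apply: is_derive_eq; rewrite add0r.
Qed.

Let step_init u i : (forall j, {in I, continuous (u j)}) -> step u i x0 = xi i.
Proof. by move=> uc; rewrite /step; have [-> _] := primP (@rhs_cont u i uc); rewrite addr0. Qed.

Let step_cont u i : (forall j, {in I, continuous (u j)}) ->
  {in I, continuous (step u i)}.
Proof. by move=> uc x /set_mem Ix; have /is_derive_continuous := step_deriv i uc Ix. Qed.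

Let X k : T -> R -> R := iter k step (fun i _ => xi i).

Let X_cont k i : {in I, continuous (X k i)}.
Proof.
by elim: k i => [|k IH] i; [move=> x _; exact: cvg_cst|exact: step_cont].
Qed.

Let cont_bounded f a b : I a -> I b -> a <= b -> {in I, continuous f} ->
  exists2 K, 0 <= K & forall x, a <= x <= b -> `|f x| <= K.
Proof.
move=> Ia Ib ab fc; have [|c _ cm] := @EVT_max R (fun x => `|f x|) a b ab.
  apply: continuous_in_subspaceT => x; rewrite inE /= in_itv /= => xab.
  by apply: cvg_norm; apply: fc; rewrite inE; apply: Ii xab.
by exists `|f c| => // x xab; apply: cm; rewrite in_itv.
Qed.

Let fin_bounded (U : finType) (f : U -> R -> R) a b : I a -> I b -> a <= b ->
  (forall i, {in I, continuous (f i)}) ->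
  exists2 K, 0 <= K & forall i x, a <= x <= b -> `|f i x| <= K.
Proof.
move=> Ia Ib ab fc.
have /choice[K KP] : forall i, exists K, 0 <= K /\ forall x, a <= x <= b -> `|f i x| <= K.
  by move=> i; have [K ? ?] := cont_bounded Ia Ib ab (fc i); exists K.
exists (\sum_i K i) => [|i x xab]; first by apply: sumr_ge0 => i _; case: (KP i).
apply: le_trans (proj2 (KP i) x xab) _; rewrite (bigD1 i)//= lerDl.
by apply: sumr_ge0 => j _; case: (KP j).
Qed.

Let rhs_diff_le K (u v : T -> R -> R) i x e : 0 <= K ->
  (forall i j, `|A i j x| <= K) -> (forall j, `|u j x - v j x| <= e) ->
  `|rhs u i x - rhs v i x| <= #|T|%:R * K * e.
Proof.
move=> K0 AK uv; rewrite -sumrB; apply: le_trans (ler_norm_sum _ _ _) _.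
rewrite -mulrA mulr_natl -[leRHS]sumr_const; apply: ler_sum => j _.
by rewrite -mulrBr normrM ler_pM.
Qed.

(** The geometric rate is proved in a weighted norm, and the weight is then bounded on the segment.
    The [L] returned is the Lipschitz constant of [rhs] for the maximum norm, not the exponent of
    the weight. *)
Let X_geom a b : I a -> I b -> a <= x0 <= b -> exists L C, [/\ 0 <= C, 0 <= L,
  (forall k i x, a <= x <= b -> `|X k.+1 i x - X k i x| <= C * 2^-1 ^+ k) &
  (forall (u v : T -> R -> R) i x e, a <= x <= b ->
    (forall j, `|u j x - v j x| <= e) -> `|rhs u i x - rhs v i x| <= L * e)].
Proof.
move=> Ia Ib ax0b; have ab : a <= b by case/andP: ax0b => /le_trans; apply.
have [K K0 AK] := @fin_bounded (T * T)%type (fun p => A p.1 p.2) a b Ia Ib ab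
  (fun p => @Ac p.1 p.2).
have [c c0 Xc] := @fin_bounded T (fun i x => X 1 i x - X 0 i x) a b Ia Ib ab
  (fun i x xI => cvgB (@X_cont 1 i x xI) (@X_cont 0 i x xI)).
pose L0 : R := #|T|%:R * K; have L00 : 0 <= L0 by apply: mulr_ge0.
have AK' x : a <= x <= b -> forall i j, `|A i j x| <= K.
  by move=> xab i j; apply: (AK (i, j)).
(* Integrating the weight gains a factor [1 / L], so doubling the Lipschitz constant makes every
   iteration halve the difference, whatever the length of the segment. *)
pose L := 2 * L0.
have XL k i x : a <= x <= b ->
    `|X k.+1 i x - X k i x| <= c * 2^-1 ^+ k * expR (L * `|x - x0|).
  elim: k i x => [|k IH] i x xab.
    rewrite expr0 mulr1; apply: le_trans (Xc i x xab) _; rewrite ler_peMr//.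
    by rewrite expR_ge1// mulr_ge0// mulr_ge0.
  apply: (@norm_le_exp (fun x => X k.+2 i x - X k.+1 i x)
    (fun x => rhs (X k.+1) i x - rhs (X k) i x) L _ a b x0 x) => //.
  - move=> t tab; have It : I t by apply: (Ii Ia Ib).
    have := @step_deriv (X k.+1) i t (@X_cont k.+1) It => ?.
    have := @step_deriv (X k) i t (@X_cont k) It => ?.
    have -> : (fun x => X k.+2 i x - X k.+1 i x) = step (X k.+1) i - step (X k) i by [].
    exact: is_deriveB.
  - move=> t tab; apply: le_trans (rhs_diff_le i K0 (AK' t tab) (fun j => IH j t tab)) _.
    rewrite -/L0 /L exprS; set e := expR _; set h := 2^-1 ^+ k.
    by rewrite le_eqVlt; apply/orP; left; apply/eqP; field.
  - by rewrite -[X k.+2]/(step (X k.+1)) -[X k.+1 i]/(step (X k) i) !step_init ?subrr//;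
      exact: X_cont.
  - by rewrite mulr_ge0// exprn_ge0// invr_ge0.
exists L0, (c * expR (L * (b - a))); split => //.
- by rewrite mulr_ge0 ?expR_ge0.
- move=> k i x xab; apply: le_trans (XL k i x xab) _.
  rewrite mulrAC ler_wpM2r ?exprn_ge0 ?invr_ge0// ler_wpM2l// ler_expR.
  rewrite ler_wpM2l ?mulr_ge0//; case/andP: xab ax0b => ? ? /andP[? ?].
  by rewrite ler_norml; apply/andP; split; lra.
- by move=> u v i x e xab uv; apply: rhs_diff_le => //; exact: AK'.
Qed.

Lemma linear_ode_exists : exists u : T -> R -> R, (forall i, u i x0 = xi i) /\
  forall i x, I x -> is_derive x 1 (u i) (\sum_j A i j x * u j x).
Proof.
have hull x : I x -> exists a b, [/\ I a, I b, a <= x0 <= b & a < x < b].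
  move=> Ix; have Im : I (Num.min x x0) by case: ltP.
  have IM : I (Num.max x x0) by case: ltP.
  have [a Ia] := open_below oI Im; have [b Ib] := open_above oI IM.
  rewrite gt_max lt_min => /andP[? ?] /andP[? ?].
  by exists a, b; split=> //; apply/andP; split => //; apply: ltW.
have /choice[u uP] : forall i, exists u : R -> R, forall x, I x ->
    exists C, forall k, `|u x - X k i x| <= C * 2^-1 ^+ k.
  move=> i; suff /choice[u uP] : forall x, exists l, I x -> exists C, forall k,
    `|l - X k i x| <= C * 2^-1 ^+ k by exists u.
  move=> x.
  have [Ix|nIx] := pselect (I x); last by exists 0.
  have [a [b [Ia Ib ax0b /andP[ax xb]]]] := hull x Ix.
  have [L [C [_ _ XC _]]] := X_geom Ia Ib ax0b.
  have [|l lP] := @half_pow_cvg (fun k => X k i x) C.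
    by move=> k; apply: XC; rewrite !ltW.
  by exists l => _; exists (2 * C).
(* The constant in [uP] depends on the point. On a segment the rate becomes uniform, because the
   limit is unique. *)
have uX a b : I a -> I b -> a <= x0 <= b -> exists2 C, 0 <= C & forall k i x,
    a <= x <= b -> `|u i x - X k i x| <= C * 2^-1 ^+ k.
  move=> Ia Ib ax0b; have [L [C [C0 _ XC _]]] := X_geom Ia Ib ax0b.
  exists (2 * C) => [|k i x xab]; first by rewrite mulr_ge0.
  have [|l lP] := @half_pow_cvg (fun k => X k i x) C; first by move=> ?; apply: XC.
  have [C' C'P] := uP i x (Ii Ia Ib xab).
  suff -> : u i x = l by [].
  apply/eqP; rewrite -subr_eq0; apply/eqP.
  apply: (@eq0_half_pow (C' + 2 * C)) => n; rewrite -(subrKA (X n i x)).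
  apply: le_trans (ler_normD _ _) _; rewrite mulrDl lerD// distrC; exact: lP.
have u_cont i : {in I, continuous (u i)}.
  move=> x; rewrite inE => Ix; have [a [b [Ia Ib ax0b axb]]] := hull x Ix.
  have [C C0 uC] := uX a b Ia Ib ax0b.
  apply/cvgrPdist_le => e e0; have [k ke] := @half_pow_small C (e / 3) ltac:(lra).
  have /cvgrPdist_le Xk : {for x, continuous (X k i)} by apply: X_cont; rewrite inE.
  near=> t.
  have tX : `|X k i x - X k i t| <= e / 3 by near: t; apply: Xk; lra.
  have tab : a <= t <= b.
    near: t; apply: filterS (near_in_itvoo (_ : x \in `]a, b[)) => [t|]; last by rewrite in_itv.
    by rewrite in_itv /= => /andP[? ?]; rewrite !ltW.
  have xab : a <= x <= b by have /andP[? ?] := axb; rewrite !ltW.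
  have := uC k i t tab; have := uC k i x xab; move: tX; rewrite !ler_norml.
  by move=> /andP[? ?] /andP[? ?] /andP[? ?]; apply/andP; split; lra.
(* [step u - X k.+1] is a primitive of [rhs u - rhs (X k)], hence geometrically small; so [u] and
   [step u] are both limits of the iterates. *)
have stepu i x : I x -> step u i x = u i x.
  move=> Ix; have [a [b [Ia Ib ax0b axb]]] := hull x Ix.
  have xab : a <= x <= b by have /andP[? ?] := axb; rewrite !ltW.
  have [C C0 uC] := uX a b Ia Ib ax0b; have [L [_ [_ L0 _ rL]]] := X_geom Ia Ib ax0b.
  apply/eqP; rewrite -subr_eq0; apply/eqP.
  apply: (@eq0_half_pow (C * expR (L * `|x - x0|) + C)) => k.
  rewrite -(subrKA (X k.+1 i x)) [leRHS]mulrDl.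
  apply: le_trans (ler_normD _ _) _; rewrite lerD//; last first.
    rewrite distrC; apply: le_trans (uC k.+1 i x xab) _; rewrite ler_wpM2l//.
    by rewrite exprS ler_piMl ?exprn_ge0 ?invr_ge0// invf_le1 ?ler1n.
  rewrite mulrAC.
  apply: (@norm_le_exp (fun x => step u i x - X k.+1 i x)
    (fun x => rhs u i x - rhs (X k) i x) L _ a b x0 x) => //.
  - move=> t tab; have It : I t by apply: (Ii Ia Ib).
    have := @step_deriv u i t u_cont It => ?.
    have := @step_deriv (X k) i t (@X_cont k) It => ?.
    have -> : (fun x => step u i x - X k.+1 i x) = step u i - step (X k) i by [].
    exact: is_deriveB.
  - move=> t tab; apply: rL => // j; apply: le_trans (uC k j t tab) _.
    rewrite ler_peMr ?mulr_ge0 ?exprn_ge0 ?invr_ge0// expR_ge1//.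
    by rewrite mulr_ge0.
  - by rewrite -[X k.+1 i]/(step (X k) i) !step_init ?subrr//; exact: X_cont.
  - by rewrite mulr_ge0// exprn_ge0// invr_ge0.
exists u; split=> [i|i x Ix]; first by rewrite -stepu// step_init.
have du := step_deriv i u_cont Ix; exact: (is_derive_on oI Ix (stepu i) du).
Unshelve. all: by end_near. Qed.

End Picard.

End Primitive.

(** * Fundamental solutions and their holomorphic dependence on the spectral parameter *)

Section Fundamental.
Context {R : realType}.
Variables (I : set R) (x0 : R).
Hypotheses (oI : open I) (Ii : is_interval I) (Ix0 : I x0).

Local Notation Re := (@complex.Re R).
Local Notation Im := (@complex.Im R).

Lemma fundamental n (A : R -> 'M[R[i]]_n) :
  (forall x, I x -> exists D, is_cderive x A D) ->
  exists2 Phi : R -> 'M[R[i]]_n, Phi x0 = 1%:M &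
    forall x, I x -> is_cderive x Phi (A x *m Phi x).
Proof.
move=> Ad.
(* The real matrix of size [2 n] of multiplication by [A x]; the boolean [true] marks imaginary
   parts. *)
pose a (p q : 'I_n * bool) (x : R) : R := if p.2 == q.2 then Re (A x p.1 q.1)
  else if p.2 then Im (A x p.1 q.1) else - Im (A x p.1 q.1).
have ac p q : {in I, continuous (a p q)}.
  move=> x; rewrite inE => /Ad[D /is_cderiveP/(_ p.1 q.1)[]].
  move=> /is_derive_continuous rc /is_derive_continuous ic.
  rewrite /a; case: eqP => // _; case: p.2 => //.
  exact: cvgN ic.
have /choice[u uP] : forall j : 'I_n, exists u : 'I_n * bool -> R -> R,
    (forall p, u p x0 = if p.2 then 0 else (p.1 == j)%:R) /\
    forall p x, I x -> is_derive x 1 (u p) (\sum_q a p q x * u q x).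
  move=> j; exact: (@linear_ode_exists R I _ a (fun p => if p.2 then 0 else (p.1 == j)%:R)).
pose Phi x : 'M[R[i]]_n := \matrix_(i, j) (u j (i, false) x +i* u j (i, true) x)%C.
have sumE p (x : R) j : \sum_q a p q x * u j q x =
    \sum_k (a p (k, false) x * u j (k, false) x + a p (k, true) x * u j (k, true) x).
  rewrite [RHS](eq_bigr (fun k => \sum_b a p (k, b) x * u j (k, b) x)); last first.
    by move=> k _; rewrite big_bool /= addrC.
  by rewrite pair_bigA; apply: eq_bigr => -[k b].
exists Phi => [|x Ix].
  apply/matrixP => i j; rewrite !mxE; have [u0 _] := uP j; rewrite !u0 /=.
  by apply: complexP; rewrite /=; case: (i == j).
have E (h : R[i] -> R) i j (D : R[i]) : (forall a b, h (a + b) = h a + h b) ->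
    h 0 = 0 -> h (\sum_k A x i k * Phi x k j) = \sum_k h (A x i k * Phi x k j).
  by move=> hD h0; exact: (big_morph h hD h0).
apply/is_cderiveP => i j; have [_ ud] := uP j.
rewrite mxE; split; rewrite E//; do ?[exact: ReD|exact: ImD].
  have := ud (i, false) x Ix; rewrite sumE.
  rewrite (_ : Re \o _ = u j (i, false)); last by apply/funext => t; rewrite /= mxE.
  congr is_derive; apply: eq_bigr => k _; rewrite ReM /a /= !mxE /=; ring.
have := ud (i, true) x Ix; rewrite sumE.
rewrite (_ : Im \o _ = u j (i, true)); last by apply/funext => t; rewrite /= mxE.
congr is_derive; apply: eq_bigr => k _; rewrite ImM /a /= !mxE /=; ring.
Qed.

Lemma derivable_of_quadratic (f : R[i] -> R[i]) (w l : R[i]) (K : R) : 0 <= K ->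
  (forall h, sqc h <= 1 -> sqc (f (w + h) - f w - h * l) <= K * sqc h ^+ 2) ->
  derivable (f : (R[i] : numFieldType)^o -> (R[i] : numFieldType)^o) w 1.
Proof.
move=> K0 fK; apply/cvg_ex; exists l; apply/cvgrPdist_le => e e0.
pose s := Num.sqrt K; have s0 : 0 <= s by exact: sqrtr_ge0.
pose d : R[i] := Num.min 1 (e / (s + 1)%:C%C).
(* [s + 1] instead of [s] keeps the divisor positive when [K = 0]. *)
have sC : 0 < ((s + 1)%:C)%C :> R[i] by rewrite ltcR; lra.
near=> h.
have h0 : h != 0 by near: h; exact: nbhs_dnbhs_neq.
have h1 : `|h| <= 1 by near: h; apply: dnbhs0_le.
have he : `|h| <= e / ((s + 1)%:C)%C.
  by near: h; apply: dnbhs0_le; rewrite divr_gt0.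
have sh : sqc h <= 1.
  move: h1; rewrite sqc_normE -[1]/(1%:C%C) lecR -[1 in X in X -> _]sqrtr1.
  by rewrite ler_sqrt.
have := fK h sh; set V := f (w + h) - f w - h * l => VK.
have -> : l - h^-1 *: ((f \o shift w) (h *: 1) - f w) = - (h^-1 * V).
  rewrite /V /= [h *: 1]mulr1 [h + w]addrC /GRing.scale /=; field.
  exact: h0.
rewrite normrN normrM normfV ler_pdivrMl ?normr_gt0//.
have hh : `|h| ^+ 2 = ((sqc h)%:C)%C.
  by rewrite sqc_normE -rmorphXn /= sqr_sqrtr ?sqc_ge0.
have Vs : `|V| <= ((s + 1)%:C)%C * `|h| ^+ 2.
  rewrite hh -rmorphM /= sqc_normE lecR.
  rewrite -[leRHS]ger0_norm ?mulr_ge0 ?sqc_ge0//; last by lra.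
  rewrite -sqrtr_sqr ler_sqrt ?sqr_ge0//; apply: le_trans VK _.
  rewrite exprMn ler_wpM2r ?sqr_ge0//.
  by rewrite -[K]sqr_sqrtr// -/s; nra.
apply: le_trans Vs _; rewrite expr2 mulrCA ler_wpM2l//.
by rewrite mulrC -ler_pdivlMr.
Unshelve. all: by end_near. Qed.

(** The candidate derivative [Y] solves the variational equation [Y' = A Y + C Phi]. The remainder
    [V] of the first-order expansion then vanishes at [x0] and is forced only by [h^2 C Y], so
    Gronwall makes it quadratic in [h]. *)
Lemma fundamental_holomorphic n (C : 'M[R[i]]_n) (F : R -> 'M[R[i]]_n)
    (Phi : R[i] -> R -> 'M[R[i]]_n) :
  (forall x, I x -> exists D, is_cderive x F D) ->
  (forall w, Phi w x0 = 1%:M) ->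
  (forall w x, I x -> is_cderive x (Phi w) ((w *: C - F x) *m Phi w x)) ->
  forall x i j w, I x -> derivable
   ((fun w => Phi w x i j) : (R[i] : numFieldType)^o -> (R[i] : numFieldType)^o) w 1.
Proof.
move=> Fd Phi0 Phid x i j w Ix.
pose A v x := v *: C - F x.
have Ad v t : I t -> exists D, is_cderive t (A v) D.
  move=> /Fd[D FD]; exists (0 - D); apply: is_cderiveB => //.
  exact: is_cderive_cst.
(* The upper right block of the augmented system is the derivative of [Phi] in [w]. *)
pose B x : 'M[R[i]]_(n + n) := block_mx (A w x) C 0 (A w x).
have Bd t : I t -> exists D, is_cderive t B D.
  move=> /(Ad w)[D /is_cderiveP AD]; exists (block_mx D 0 0 D).
  apply/is_cderiveP => k l.
  have cc (a : R[i]) (f : R -> R[i]) : (forall s, f s = a) -> cder t f 0.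
    by move=> fa; rewrite (_ : f = fun=> a); [exact: cder_cst|exact/funext].
  have ca (k' l' : 'I_n) (f : R -> R[i]) : (forall s, f s = A w s k' l') ->
      cder t f (D k' l').
    move=> fa; rewrite (_ : f = fun s => A w s k' l'); [exact: AD|exact/funext].
  case: (split_ordP k) => k' ->; case: (split_ordP l) => l' ->.
  - by rewrite block_mxEul; apply: ca => s; rewrite /B block_mxEul.
  - by rewrite block_mxEur mxE; apply: (cc (C k' l')) => s; rewrite /B block_mxEur.
  - by rewrite block_mxEdl mxE; apply: (cc 0) => s; rewrite /B block_mxEdl mxE.
  - by rewrite block_mxEdr; apply: ca => s; rewrite /B block_mxEdr.
have [Psi Psi0 Psid] := fundamental Bd.
pose Y x := ursubmx (Psi x); pose Z x := drsubmx (Psi x).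
have dsub t : I t -> is_cderive t Y (A w t *m Y t + C *m Z t) /\
    is_cderive t Z (A w t *m Z t).
  move=> It; have := Psid t It; rewrite -[Psi t]submxK mulmx_block !mul0mx !add0r => Pd.
  split.
    have := @is_cderive_reindex _ _ _ _ _ t Psi _ (@ursubmx _ n n n n)
      (fun i j => (lshift n i, rshift n j)) _ Pd.
    by rewrite block_mxKur; apply=> M k l; rewrite !mxE.
  have := @is_cderive_reindex _ _ _ _ _ t Psi _ (@drsubmx _ n n n n)
    (fun i j => (rshift n i, rshift n j)) _ Pd.
  by rewrite block_mxKdr; apply=> M k l; rewrite !mxE.
have Y0 : Y x0 = 0 by rewrite /Y Psi0 scalar_mx_block block_mxKur.
have Z0 : Z x0 = 1%:M by rewrite /Z Psi0 scalar_mx_block block_mxKdr.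
have ZE t : I t -> Z t = Phi w t.
  move=> It; apply/eqP; rewrite -subr_eq0; apply/eqP.
  apply: (@lin_ode_zero _ I _ _ (A w) (fun t => Z t - Phi w t) x0) => //.
  - exact: Ad.
  - by move=> s Is; rewrite mulmxBr; apply: is_cderiveB; [case: (dsub s Is)|exact: Phid].
  - by rewrite Z0 Phi0 subrr.
pose a := Num.min x x0; pose b := Num.max x x0.
have Ia : I a by rewrite /a; case: ltP.
have Ib : I b by rewrite /b; case: ltP.
have It t : a <= t <= b -> I t by exact: Ii.
have [KF KF0 FK] := locb_nsq Ii Fd Ia Ib.
have [KY KY0 YK] := locb_nsq Ii (fun t It => ex_intro _ _ (proj1 (dsub t It))) Ia Ib.
(* A bound of [nsq (A (w + h) t)] uniform for [sqc h <= 1], as required for one constant in the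
   quadratic estimate. *)
pose K1 := 2 * (2 * (sqc w + 1) * nsq C + KF).
pose K2 := nsq C * KY.
have sw0 := sqc_ge0 w; have C0 := nsq_ge0 C.
have K10 : 0 <= K1 by rewrite mulr_ge0// addr_ge0// mulr_ge0// mulr_ge0//; lra.
have K20 : 0 <= K2 by apply: mulr_ge0.
apply: (@derivable_of_quadratic _ w (Y x i j)
  (expR ((2 * K1 + 1) * `|x - x0|) * (2 * K2))).
  by rewrite mulr_ge0 ?expR_ge0// mulr_ge0.
move=> h h1.
pose V t := Phi (w + h) t - Phi w t - h *: Y t.
pose dV t := A (w + h) t *m V t + h ^+ 2 *: (C *m Y t).
have Vd t : I t -> is_cderive t V (dV t).
  move=> tI; rewrite (_ : dV t = A (w + h) t *m Phi (w + h) t - A w t *m Phi w t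
      - h *: (A w t *m Y t + C *m Z t)).
    apply: is_cderiveB; first by apply: is_cderiveB; apply: Phid.
    by apply: is_cderiveZ; case: (dsub t tI).
  rewrite ZE// /dV /V.
  have AE v M : A v t *m M = v *: (C *m M) - F t *m M by rewrite mulmxBl -scalemxAl.
  rewrite !AE !mulmxBr -!scalemxAr; apply/matrixP => k l.
  move: (C *m Phi (w + h) t) (C *m Phi w t) (F t *m Phi (w + h) t) (F t *m Phi w t).
  by move=> M1 M2 M3 M4; rewrite !mxE; ring.
have VG := @nsq_gronwall _ _ _ V dV (2 * K1) (2 * (sqc h ^+ 2 * K2)) a b x x0.
have Vx : nsq (V x) <= expR ((2 * K1 + 1) * `|x - x0|) * (2 * (sqc h ^+ 2 * K2)).
  apply: le_trans (_ : nsq (V x) + 2 * (sqc h ^+ 2 * K2) <= _).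
    by rewrite lerDl mulr_ge0// mulr_ge0// sqr_ge0.
  have V0 : V x0 = 0 by rewrite /V !Phi0 subrr Y0 scaler0 subr0.
  rewrite V0 nsq0 add0r in VG; apply: VG.
  - by rewrite mulr_ge0.
  - by rewrite mulr_ge0// mulr_ge0// sqr_ge0.
  - by move=> t /It/Vd.
  - move=> t tab; apply: le_trans (nsqD _ _) _.
    rewrite mulrDr -[in leRHS]mulrA lerD// ler_wpM2l//.
      apply: le_trans (nsqM _ _) _; rewrite ler_wpM2r ?nsq_ge0//.
      apply: le_trans (nsqB _ _) _; rewrite ler_wpM2l// lerD//; last exact: FK.
      rewrite nsqZ ler_wpM2r//; apply: le_trans (sqcD _ _) _.
      by rewrite ler_wpM2l// lerD2l.
    rewrite nsqZ sqcX ler_wpM2l ?sqr_ge0//; apply: le_trans (nsqM _ _) _.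
    by rewrite ler_wpM2l//; exact: YK.
  - by rewrite /a /b ge_min lexx le_max lexx.
  - by rewrite /a /b ge_min lexx le_max lexx !orbT.
have -> : Phi (w + h) x i j - Phi w x i j - h * Y x i j = V x i j.
  by rewrite /V !mxE.
apply: le_trans (nsq_entry _ _ _) _; apply: le_trans Vx _.
by rewrite le_eqVlt; apply/orP; left; apply/eqP; ring.
Qed.

End Fundamental.

(** * The Sylvester equation [C X + X C = Y] *)

Section Sylvester.

Lemma horner_mx_intertwine (K : comNzRingType) n (A B X : 'M[K]_n.+1) (p : {poly K}) :
  A *m X = X *m B -> horner_mx A p *m X = X *m horner_mx B p.
Proof.
move=> AX; elim/poly_ind: p => [|p c IH]; first by rewrite !rmorph0 mul0mx mulmx0.
rewrite !rmorphD !rmorphM /= !horner_mx_X !horner_mx_C.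
by rewrite mulmxDl mulmxDr -!mulmxE -mulmxA AX mulmxA IH mulmxA scalar_mxC.
Qed.

Definition sylv_inj (K : fieldType) n (C : 'M[K]_n) :=
  forall X : 'M[K]_n, C *m X + X *m C = 0 -> X = 0.

(** The spectra of [C] and [- C] are disjoint. Stated as a Bezout identity because it is used both
    at matrices, for injectivity, and at scalars, for uniform bounds at infinity. *)
Lemma char_poly_bezout (K : closedFieldType) n (C : 'M[K]_n) :
  (forall a b, eigenvalue C a -> eigenvalue C b -> a + b != 0) ->
  exists u v, u * char_poly C + v * char_poly (- C) = 1.
Proof.
move=> Ce; suff /Bezout_eq1_coprimepP[[u v] uv] : coprimep (char_poly C) (char_poly (- C)).
  by exists u, v.
apply: Pdiv.ClosedField.root_coprimep => a; rewrite -eigenvalue_root_char => Ca.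
rewrite -rootE -eigenvalue_root_char; apply/negP => /eigenvalueP[v vC v0].
have /(Ce _ _ Ca) : eigenvalue C (- a).
  by apply/eigenvalueP; exists v => //; rewrite scaleNr -vC mulmxN opprK.
by rewrite subrr eqxx.
Qed.

(** A solution of the homogeneous equation intertwines [- C] and [C]. By the Bezout identity the
    characteristic polynomial of [- C] is invertible at [C], and moving it across [X] evaluates it
    at [- C], where it vanishes. *)
Lemma sylv_inj_eig (K : closedFieldType) n (C : 'M[K]_n.+1) :
  (forall a b, eigenvalue C a -> eigenvalue C b -> a + b != 0) -> sylv_inj C.
Proof.
move=> /char_poly_bezout[u [v uv]] X CX.
have XC : - C *m X = X *m C by rewrite mulNmx; apply/esym/eqP; rewrite -subr_eq0 opprK addrC CX.
have uvC : horner_mx C u *m horner_mx C (char_poly C) +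
    horner_mx C (char_poly (- C)) *m horner_mx C v = 1%:M.
  by rewrite -[1%:M](rmorph1 (horner_mx C)) -uv [v * _]mulrC rmorphD !rmorphM.
rewrite -[X]mulmx1 -uvC Cayley_Hamilton mulmx0 add0r mulmxA.
by rewrite -(horner_mx_intertwine _ XC) Cayley_Hamilton !mul0mx.
Qed.

(** The inverse is given as one constant matrix acting on vectorizations, so that norm bounds and
    differentiability pass to the solution. *)
Lemma sylvester_inv (K : fieldType) n (C : 'M[K]_n) : sylv_inj C ->
  exists S : 'M[K]_(n * n), 
    (forall X, vec_mx (mxvec (C *m X + X *m C) *m S) = X) /\
    (forall Y, let X := vec_mx (mxvec Y *m S) in C *m X + X *m C = Y).
Proof.
move=> Ci; pose L := lin_mulmx C + lin_mulmxr C.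
have LE X : mxvec X *m L = mxvec (C *m X + X *m C).
  by rewrite mulmxDr !mul_vec_lin /= linearD.
have Lu : L \in unitmx.
  rewrite -row_free_unit; apply: inj_row_free => v vL.
  rewrite -[v]vec_mxK; apply/eqP; rewrite mxvec_eq0; apply/eqP/Ci.
  by rewrite -[LHS]mxvecK -LE vec_mxK vL linear0.
exists (invmx L); split=> [X|Y /=]; first by rewrite -LE mulmxK// mxvecK.
by rewrite -[LHS]mxvecK -LE vec_mxK mulmxKV// mxvecK.
Qed.

End Sylvester.

Section Lie.
Context {K : comNzRingType} {n : nat}.
Implicit Types A B : 'M[K]_n.

Lemma lieBB A1 A2 B1 B2 :
  lie A1 B1 - lie A2 B2 = lie (A1 - A2) B1 + lie A2 (B1 - B2).
Proof.
rewrite /lie !mulmxBl !mulmxBr.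
by apply/matrixP => i j; rewrite !mxE; ring.
Qed.

Lemma trmx_lie A B : (lie A B)^T = - lie A^T B^T.
Proof. by rewrite /lie linearB /= !trmx_mul opprB. Qed.

Lemma map_lie (L : comNzRingType) (f : {rmorphism K -> L}) A B :
  map_mx f (lie A B) = lie (map_mx f A) (map_mx f B).
Proof. by rewrite /lie map_mxB !map_mxM. Qed.

End Lie.

(** * Real matrices inside complex ones, and uniqueness for the dressing system *)

Section Complexify.
Context {R : realType}.

Lemma complexifyM m n p (A : 'M[R]_(m, n)) (B : 'M[R]_(n, p)) :
  complexify (A *m B) = complexify A *m complexify B.
Proof. exact: map_mxM. Qed.

Lemma complexifyD m n (A B : 'M[R]_(m, n)) :
  complexify (A + B) = complexify A + complexify B.
Proof. exact: map_mxD. Qed.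

Lemma complexifyN m n (A : 'M[R]_(m, n)) : complexify (- A) = - complexify A.
Proof. exact: map_mxN. Qed.

Lemma complexify_lie n (A B : 'M[R]_n) :
  complexify (lie A B) = lie (complexify A) (complexify B).
Proof. exact: map_lie. Qed.

Lemma complexify_inj m n : injective (@complexify R m n).
Proof. by move=> A B /matrixP AB; apply/matrixP => i j; have := AB i j; rewrite !mxE => -[]. Qed.

Lemma dressing_velocity_complexify n (C F B X Y : 'M[R]_n) :
  dressing_velocity (complexify C) (complexify F) (complexify B)
    (complexify X) (complexify Y) <-> dressing_velocity C F B X Y.
Proof.
rewrite /dressing_velocity -!complexifyM -!complexifyD -!complexify_lie.
by split=> -[H1 H2]; split; [exact: complexify_inj H1|exact: complexify_inj H2|rewrite H1|rewrite H2].
Qed.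

Lemma sylv_inj_real n (J : 'M[R]_n) : sylv_inj (complexify J) -> sylv_inj J.
Proof.
move=> Ci X JX; apply: (@complexify_inj n n); rewrite [RHS]map_mx0; apply: Ci.
by rewrite -!complexifyM -complexifyD JX [LHS]map_mx0.
Qed.

Lemma is_cderive_real m n x (G : R -> 'M[R]_(m, n)) D :
  is_cderive x (fun t => complexify (G t)) D ->
  exists2 D', D = complexify D' & is_derive x 1 G D'.
Proof.
move=> GD; exists (map_mx (@complex.Re R) D).
  have [r _] := GD.
  apply: is_cderive_unique GD _; apply/is_cderive_complexify.
  rewrite (_ : G = fun t => map_mx (@complex.Re R) (complexify (G t)))//.
  by apply/funext => t; apply/matrixP => i j; rewrite !mxE.
have [r _] := GD.
rewrite (_ : G = fun t => map_mx (@complex.Re R) (complexify (G t)))//.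
by apply/funext => t; apply/matrixP => i j; rewrite !mxE.
Qed.

Lemma is_cderive_mxvec m n x (G : R -> 'M[R[i]]_(m, n)) D :
  is_cderive x G D -> is_cderive x (fun t => mxvec (G t)) (mxvec D).
Proof.
move=> /is_cderiveP GD; apply/is_cderiveP => i j; rewrite ord1.
case/mxvec_indexP: j => a b; rewrite mxvecE.
by under [X in cder _ X]eq_fun do rewrite mxvecE.
Qed.

Lemma is_cderive_vec_mx m n x (G : R -> 'rV[R[i]]_(m * n)) D :
  is_cderive x G D -> is_cderive x (fun t => vec_mx (G t)) (vec_mx D).
Proof.
by apply: (is_cderive_reindex (u := fun i j => (ord0, mxvec_index i j))) => A i j; rewrite mxE.
Qed.

Lemma nsq_row_mx m n1 n2 (A : 'M[R[i]]_(m, n1)) (B : 'M[R[i]]_(m, n2)) :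
  nsq (row_mx A B) = nsq A + nsq B.
Proof.
rewrite /nsq -big_split; apply: eq_bigr => i _; rewrite big_split_ord /=.
by congr (_ + _); apply: eq_bigr => j _; rewrite ?row_mxEl ?row_mxEr.
Qed.

Lemma nsq_vec_mx m n (A : 'rV[R[i]]_(m * n)) : nsq (vec_mx A) = nsq A.
Proof. by rewrite -nsq_mxvec vec_mxK. Qed.

Lemma nsq_lie n (A B : 'M[R[i]]_n) : nsq (lie A B) <= 4 * (nsq A * nsq B).
Proof.
apply: le_trans (nsqB _ _) _; have := nsqM A B; have := nsqM B A; lra.
Qed.

Lemma is_cderive_row_mx m n1 n2 x (G : R -> 'M[R[i]]_(m, n1))
    (H : R -> 'M[R[i]]_(m, n2)) dG dH : is_cderive x G dG -> is_cderive x H dH ->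
  is_cderive x (fun t => row_mx (G t) (H t)) (row_mx dG dH).
Proof.
move=> /is_cderiveP Gd /is_cderiveP Hd; apply/is_cderiveP => i j.
case: (split_ordP j) => k ->.
  by rewrite row_mxEl; under [X in cder _ X]eq_fun do rewrite row_mxEl.
by rewrite row_mxEr; under [X in cder _ X]eq_fun do rewrite row_mxEr.
Qed.

Lemma locbD (I : set R) f g : locb I f -> locb I g -> locb I (fun x => f x + g x).
Proof.
move=> fb gb a b Ia Ib; have [K ? fK] := fb a b Ia Ib; have [L ? gL] := gb a b Ia Ib.
by exists (K + L) => [|x xab]; [exact: addr_ge0|rewrite lerD ?fK ?gL].
Qed.

Lemma locbZ (I : set R) c f : 0 <= c -> locb I f -> locb I (fun x => c * f x).
Proof.
move=> c0 fb a b Ia Ib; have [K ? fK] := fb a b Ia Ib.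
by exists (c * K) => [|x xab]; [exact: mulr_ge0|rewrite ler_wpM2l ?fK].
Qed.

Lemma locb_cst (I : set R) c : 0 <= c -> locb I (fun=> c).
Proof. by move=> c0 a b _ _; exists c. Qed.

(** After solving for [F'], the right-hand side is quadratic in [(F, B)], so the difference of two
    solutions obeys a linear bound whose coefficient depends on the solutions. *)
Lemma dressing_unique (I : set R) n (C : 'M[R[i]]_n)
    (F1 B1 F2 B2 : R -> 'M[R[i]]_n) x0 : is_interval I -> sylv_inj C ->
  dressing_system I C F1 B1 -> dressing_system I C F2 B2 -> I x0 ->
  F1 x0 = F2 x0 -> B1 x0 = B2 x0 -> forall x, I x -> F1 x = F2 x /\ B1 x = B2 x.
Proof.
move=> Ii /sylvester_inv[S [SL _]] D1 D2 Ix0 F0 B0.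
pose s (F B : 'M[R[i]]_n) := vec_mx (mxvec (lie C (F *m F + B)) *m S).
have sd F B : dressing_system I C F B ->
    forall x, I x -> is_cderive x F (s (F x) (B x)) /\ is_cderive x B (lie (B x) (F x)).
  move=> FB x /FB[F' [B' [Fd Bd [E1 E2]]]]; rewrite -E2; split=> //.
  by rewrite /s -E1 SL.
pose Y x := row_mx (F1 x - F2 x) (B1 x - B2 x).
pose dY x := row_mx (s (F1 x) (B1 x) - s (F2 x) (B2 x)) (lie (B1 x) (F1 x) - lie (B2 x) (F2 x)).
have Yd x : I x -> is_cderive x Y (dY x).
  move=> Ix; have [? ?] := sd _ _ D1 x Ix; have [? ?] := sd _ _ D2 x Ix.
  by apply: is_cderive_row_mx; apply: is_cderiveB.
have nb F B : dressing_system I C F B -> locb I (nsq \o F) /\ locb I (nsq \o B).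
  by move=> FB; split; apply: locb_nsq => // x /FB[F' [B' [Fd Bd _]]]; [exists F'|exists B'].
have [F1b B1b] := nb _ _ D1; have [F2b B2b] := nb _ _ D2.
(* One factor 4 comes from [nsq_lie], the other from splitting [F1 dF + dF F2 + dB], the difference
   of [F^2 + B], by two uses of [nsqD]. *)
pose k := 16 * (nsq C * nsq S).
have k0 : 0 <= k by rewrite !mulr_ge0 ?nsq_ge0.
pose h x := k * (2 * (nsq (F1 x) + nsq (F2 x)) + 1) + 8 * (nsq (F1 x) + nsq (B2 x)).
have hb : locb I h.
  apply: locbD; apply: locbZ => //; last exact: locbD.
  by apply: locbD; [apply: locbZ => //; exact: locbD|exact: locb_cst].
have Yh x : I x -> nsq (dY x) <= h x * nsq (Y x).
  move=> Ix; rewrite /dY /Y !nsq_row_mx.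
  set dF := F1 x - F2 x; set dB := B1 x - B2 x.
  have f1 := nsq_ge0 (F1 x); have f2 := nsq_ge0 (F2 x); have b2 := nsq_ge0 (B2 x).
  have df := nsq_ge0 dF; have db := nsq_ge0 dB.
  have -> : s (F1 x) (B1 x) - s (F2 x) (B2 x) =
      vec_mx (mxvec (lie C (F1 x *m dF + dF *m F2 x + dB)) *m S).
    rewrite /s -linearB -mulmxBl -linearB /=; congr (vec_mx (mxvec _ *m _)).
    rewrite lieBB subrr {1}/lie mul0mx mulmx0 subrr add0r; congr lie.
    rewrite /dF /dB mulmxBr mulmxBl.
    by rewrite [X in _ = X + _]addrA subrK opprD addrACA.
  have H1 : nsq (vec_mx (mxvec (lie C (F1 x *m dF + dF *m F2 x + dB)) *m S)) <=
      k * (2 * (nsq (F1 x) + nsq (F2 x)) + 1) * (nsq dF + nsq dB).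
    rewrite nsq_vec_mx; apply: le_trans (nsqM _ _) _; rewrite nsq_mxvec.
    have := nsq_lie C (F1 x *m dF + dF *m F2 x + dB).
    have := nsqD (F1 x *m dF + dF *m F2 x) dB.
    have := nsqD (F1 x *m dF) (dF *m F2 x).
    have := nsqM (F1 x) dF; have := nsqM dF (F2 x).
    set N := F1 x *m dF + dF *m F2 x + dB => e1 e2 e3 e4 e5.
    pose Q := (2 * (nsq (F1 x) + nsq (F2 x)) + 1) * (nsq dF + nsq dB).
    have NQ : nsq N <= 4 * Q by rewrite /Q; nra.
    rewrite -mulrA -/Q (_ : k * Q = 4 * (nsq C * (4 * Q)) * nsq S); last first.
      by rewrite /k; ring.
    rewrite ler_wpM2r ?nsq_ge0//; apply: le_trans e5 _.
    by rewrite ler_wpM2l// ler_wpM2l ?nsq_ge0.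
  have H2 : nsq (lie (B1 x) (F1 x) - lie (B2 x) (F2 x)) <=
      8 * (nsq (F1 x) + nsq (B2 x)) * (nsq dF + nsq dB).
    rewrite lieBB; apply: le_trans (nsqD _ _) _.
    have aux (N1 N2 f b u v : R) : 0 <= f * u -> 0 <= b * v ->
        N1 <= 4 * (v * f) -> N2 <= 4 * (b * u) -> 2 * (N1 + N2) <= 8 * (f + b) * (u + v).
      by lra.
    exact: aux (mulr_ge0 f1 df) (mulr_ge0 b2 db) (nsq_lie dB (F1 x)) (nsq_lie (B2 x) dF).
  by rewrite /h mulrDl lerD.
have Y0 : Y x0 = 0 by rewrite /Y F0 B0 !subrr row_mx0.
move=> x Ix; have := ode_zero Ii hb Yd Yh Ix0 Y0 Ix.
rewrite /Y -row_mx0 => /eq_row_mx[/eqP + /eqP].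
by rewrite !subr_eq0 => /eqP-> /eqP->.
Qed.

End Complexify.

(** * The real reduction and the rigid body equations *)

Section Reduction.
Context {R : realType}.

Lemma skew_lie n (A B : 'M[R]_n) : sym_mx A -> sym_mx B -> skew_mx (lie A B).
Proof.
by move=> AS BS; rewrite /skew_mx trmx_lie AS BS.
Qed.

Lemma sym_lie n (A B : 'M[R]_n) : sym_mx A -> skew_mx B -> sym_mx (lie A B).
Proof.
move=> AS BS; rewrite /sym_mx /lie linearB /= !trmx_mul AS BS mulNmx mulmxN opprK.
by rewrite addrC.
Qed.

Lemma skew_sqr n (A : 'M[R]_n) : skew_mx A -> sym_mx (A *m A).
Proof. by move=> AS; rewrite /sym_mx trmx_mul AS mulNmx mulmxN opprK. Qed.

Lemma sym_add n (A B : 'M[R]_n) : sym_mx A -> sym_mx B -> sym_mx (A + B).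
Proof. by move=> AS BS; rewrite /sym_mx linearD /= AS BS. Qed.

Variables (n : nat) (J : 'M[R]_n).
Hypotheses (J_sym : sym_mx J) (J_inj : sylv_inj (complexify J)).
Local Notation C := (complexify J).

(** The commutator of the symmetric matrices [J] and [F0^2 + B0] is skew, so for the solution [X] of
    the Sylvester equation [X^T + X] solves the homogeneous equation and vanishes. *)
Lemma reduced_velocity (F0 B0 : 'M[R]_n) : skew_mx F0 -> sym_mx B0 ->
  exists X Y : 'M[R]_n, [/\ skew_mx X, sym_mx Y &
    forall Z W : 'M[R[i]]_n,
      dressing_velocity C (complexify F0) (complexify B0) Z W <->
      Z = complexify X /\ W = complexify Y].
Proof.
move=> FS BS; have [S [_ SL]] := sylvester_inv (sylv_inj_real J_inj).
pose N := lie J (F0 *m F0 + B0); pose X := vec_mx (mxvec N *m S).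
have XE : J *m X + X *m J = N by apply: SL.
exists X, (lie B0 F0); split; last 1 first.
- move=> Z W; have XYv : dressing_velocity C (complexify F0) (complexify B0)
      (complexify X) (complexify (lie B0 F0)).
    by apply/dressing_velocity_complexify.
  split=> [[ZE WE]|[-> ->]//]; have [XE' YE] := XYv; split; last by rewrite WE.
  apply/eqP; rewrite -subr_eq0; apply/eqP/J_inj.
  by rewrite mulmxBr mulmxBl addrACA -opprD ZE XE' subrr.
- have NS : skew_mx N by apply: skew_lie => //; apply: sym_add => //; exact: skew_sqr.
  apply/eqP; rewrite -subr_eq0 opprK; apply/eqP/(sylv_inj_real J_inj).
  suff : J *m (X^T + X) + (X^T + X) *m J = 0 by [].
  have -> : J *m (X^T + X) + (X^T + X) *m J = J *m X^T + X^T *m J + N.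
    by rewrite -XE mulmxDr mulmxDl addrACA.
  have -> : J *m X^T + X^T *m J = N^T by rewrite -XE linearD /= !trmx_mul J_sym addrC.
  by rewrite NS addNr.
- exact: sym_lie.
Qed.

Lemma reducedP (I : set R) (F B : R -> 'M[R]_n) :
  reduced_dressing_system I C F B <->
  forall x, I x -> [/\ skew_mx (F x), sym_mx (B x) &
    exists X Y, [/\ is_derive x 1 F X, is_derive x 1 B Y &
      dressing_velocity J (F x) (B x) X Y]].
Proof.
split=> [[FB FS] x Ix|FB].
  have [? ?] := FS x Ix; split=> //.
  have [X [Y [/is_cderive_real[X' -> FX] /is_cderive_real[Y' -> BY]]]] := FB x Ix.
  by move=> /dressing_velocity_complexify V; exists X', Y'.
split=> x Ix; have [? ? [X [Y [FX BY V]]]] := FB x Ix => //.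
exists (complexify X), (complexify Y); split; try exact/is_cderive_complexify.
exact/dressing_velocity_complexify.
Qed.

(** The terms [F J F] of [[M, F]] cancel, leaving [[J, F^2]]. *)
Lemma lie_rigid (F B : 'M[R]_n) :
  lie (J *m F + F *m J) F - lie B J = lie J (F *m F + B).
Proof.
rewrite /lie !(mulmxDl, mulmxDr, mulmxA).
by apply/eqP; rewrite -subr_eq0; apply/eqP/matrixP => i j; rewrite !mxE; ring.
Qed.

Lemma reduced_rigid (I : set R) (F B : R -> 'M[R]_n) :
  reduced_dressing_system I C F B <->
  rigid_body I J F B (fun t => J *m F t + F t *m J).
Proof.
apply: iff_trans (reducedP I F B) _; split=> FB x Ix.
  have [FS BS [X [Y [FX BY [XE YE]]]]] := FB x Ix; split=> //; last by rewrite -YE.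
  rewrite lie_rigid -XE; apply/is_cderive_complexify.
  under [X in is_cderive _ X]eq_fun do rewrite complexifyD !complexifyM.
  rewrite complexifyD !complexifyM.
  have Fc := (is_cderive_complexify x F X).2 FX.
  by apply: is_cderiveD; [exact: is_cderiveMl|exact: is_cderiveMr].
have [FS BS _ Md Bd] := FB x Ix; split=> //.
(* The rigid body equations give the differentiability of [M] only; [F] inherits it as the image of
   [M] under the constant inverse Sylvester map. *)
have [S [SF SL]] := sylvester_inv (sylv_inj_real J_inj).
set M := (fun t => _) in Md; set M' := (_ - _) in Md.
pose X := vec_mx (mxvec M' *m S); exists X, (lie (B x) (F x)); split=> //; last first.
  by split=> //; rewrite -lie_rigid SL.
apply/is_cderive_complexify.
have E (A : 'M[R]_n) : complexify (vec_mx (mxvec A *m S)) =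
    vec_mx (mxvec (complexify A) *m complexify S).
  by rewrite /complexify map_vec_mx map_mxM map_mxvec.
rewrite (_ : (fun t => _) = fun t => vec_mx (mxvec (complexify (M t)) *m complexify S)).
  rewrite E; apply: is_cderive_vec_mx; apply: is_cderiveMr; apply: is_cderive_mxvec.
  exact/is_cderive_complexify.
by apply/funext => t; rewrite -E SF.
Qed.

(** Complex conjugation and [(F, B) -> (- F^T, B^T)] are symmetries of the system for real symmetric
    [C]. Both fix the data at [x0], so by uniqueness they fix the solution. *)
Lemma reduced_invariant (I : set R) (F B : R -> 'M[R[i]]_n) x0 (F0 B0 : 'M[R]_n) :
  open I -> is_interval I ->
  dressing_system I C F B -> I x0 -> skew_mx F0 -> sym_mx B0 ->
  F x0 = complexify F0 -> B x0 = complexify B0 ->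
  exists Fr Br : R -> 'M[R]_n, reduced_dressing_system I C Fr Br /\
    forall x, I x -> F x = complexify (Fr x) /\ B x = complexify (Br x).
Proof.
move=> oI Ii FB Ix0 FS BS F0E B0E.
pose cj := map_mx (@conjc R) : 'M[R[i]]_n -> 'M[R[i]]_n.
have cjK (A : 'M[R]_n) : cj (complexify A) = complexify A.
  by apply/matrixP => i j; rewrite !mxE; apply: complexP; rewrite /= ?oppr0.
have FBc : dressing_system I C (fun x => cj (F x)) (fun x => cj (B x)).
  move=> x /FB[X [Y [FX BY [XE YE]]]]; exists (cj X), (cj Y).
  split; try exact: is_cderive_conj.
  have cjM (A A' : 'M[R[i]]_n) : cj (A *m A') = cj A *m cj A' by exact: map_mxM.
  have cjD (A A' : 'M[R[i]]_n) : cj (A + A') = cj A + cj A' by exact: map_mxD.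
  have cjL (A A' : 'M[R[i]]_n) : cj (lie A A') = lie (cj A) (cj A') by exact: map_lie.
  split; last (rewrite YE; exact: cjL).
  by rewrite -[C]cjK -!cjM -!cjD -cjL XE.
have FBt : dressing_system I C (fun x => - (F x)^T) (fun x => (B x)^T).
  move=> x /FB[X [Y [FX BY [XE YE]]]]; exists (- X^T), Y^T.
  have CT : C = C^T by rewrite [RHS]map_trmx J_sym.
  split; [by apply: is_cderiveN; exact: is_cderive_trmx|exact: is_cderive_trmx|].
  split.
    rewrite mulmxN mulNmx -opprD [in LHS]CT -!trmx_mul -linearD /= addrC XE.
    have lieT N : (lie C N)^T = - lie C N^T.
      by rewrite trmx_lie -CT.
    rewrite lieT opprK mulmxN mulNmx opprK; congr lie.
    rewrite -trmx_mul; exact: raddfD.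
  by rewrite YE /lie linearB /= !trmx_mul !(mulmxN, mulNmx) opprK addrC.
have cE x : I x -> F x = cj (F x) /\ B x = cj (B x).
  by apply: (dressing_unique Ii J_inj FB FBc Ix0); rewrite ?F0E ?B0E cjK.
have tE x : I x -> F x = - (F x)^T /\ B x = (B x)^T.
  apply: (dressing_unique Ii J_inj FB FBt Ix0).
    by rewrite F0E map_trmx FS -[RHS]complexifyN opprK.
  by rewrite B0E map_trmx BS.
pose re := map_mx (@complex.Re R) : 'M[R[i]]_n -> 'M[R]_n.
have reK (A : 'M[R[i]]_n) : A = cj A -> A = complexify (re A).
  move=> /matrixP AE; apply/matrixP => i j; have := AE i j; rewrite !mxE.
  case: (A i j) => a b [bE]; apply: complexP => //=; lra.
have reE x : I x -> F x = complexify (re (F x)) /\ B x = complexify (re (B x)).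
  by move=> /cE[? ?]; split; exact: reK.
exists (fun x => re (F x)), (fun x => re (B x)); split; last exact: reE.
split=> x Ix.
  have [X [Y [FX BY V]]] := FB x Ix; have [FE BE] := reE x Ix.
  exists X, Y; rewrite -FE -BE; split=> //.
    by apply: (is_cderive_on oI Ix _ FX) => t /reE[].
  by apply: (is_cderive_on oI Ix _ BY) => t /reE[].
have [FE BE] := reE x Ix; have [Ft Bt] := tE x Ix; split; apply: complexify_inj.
  by rewrite complexifyN /complexify -map_trmx -/(complexify _) -FE {2}Ft opprK.
by rewrite /complexify -map_trmx -/(complexify _) -BE {2}Bt.
Qed.

End Reduction.

Section HornerMx.

Lemma map_horner_mx_com (K L : comNzRingType) (f : {rmorphism K -> L}) m
    (A : 'M[K]_m.+1) (p : {poly K}) :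
  map_mx f (horner_mx A p) = horner_mx (map_mx f A) (map_poly f p).
Proof.
elim/poly_ind: p => [|p c IH]; first by rewrite !rmorph0 ?map_mx0.
rewrite !rmorphD !rmorphM /= IH map_polyX map_polyC.
by rewrite !horner_mx_X !horner_mx_C map_scalar_mx.
Qed.

Lemma trmx_horner_mx (K : comNzRingType) m (T : 'M[K]_m.+1) (h : {poly K}) :
  (horner_mx T h)^T = horner_mx T^T h.
Proof.
elim/poly_ind: h => [|h c IH]; first by rewrite !rmorph0 trmx0.
rewrite !rmorphD !rmorphM /= !horner_mx_X !horner_mx_C raddfD /= tr_scalar_mx.
by rewrite trmx_mul IH; congr (_ + _); exact: comm_mx_horner.
Qed.

End HornerMx.

(** * Semisimplicity from a definite form, and a separable annihilator *)

Section SkewAdjoint.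
Context {R : realFieldType}.

(** Definiteness is recorded as anisotropy, which is what deduces [Z = 0] from [Z^T S Z = 0]. *)
Definition posdef m (S : 'M[R]_m) :=
  S^T = S /\ forall v : 'cV[R]_m, v^T *m S *m v = 0 -> v = 0.

Lemma posdef_eq0 m (S Z : 'M[R]_m) : posdef S -> Z^T *m S *m Z = 0 -> Z = 0.
Proof.
move=> [_ Sp] ZSZ; apply/matrixP => i j; rewrite mxE.
have /Sp/matrixP/(_ i ord0) : (col j Z)^T *m S *m col j Z = 0.
  rewrite colE trmx_mul !mulmxA -(mulmxA _ Z^T) -(mulmxA _ (Z^T *m S)) ZSZ.
  by rewrite mulmx0 mul0mx.
by rewrite !mxE.
Qed.

(* A polynomial in a skew-adjoint operator is normal, so it vanishes if its
   square does. *)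
Lemma skew_adjoint_reduced m (S T : 'M[R]_m.+1) (h : {poly R}) :
  posdef S -> S *m T = - (T^T *m S) ->
  horner_mx T h *m horner_mx T h = 0 -> horner_mx T h = 0.
Proof.
move=> Sp ST; set X := horner_mx T h => XX.
(* The adjoint of [X] for the form [S], because the adjoint of [T] is [- T]. *)
pose X' := horner_mx (- T) h.
have XS : X^T *m S = S *m X'.
  rewrite trmx_horner_mx; apply: horner_mx_intertwine.
  by rewrite mulmxN ST opprK.
have XX' : X *m X' = X' *m X.
  apply: comm_mx_horner; apply: comm_mx_sym; apply: comm_mx_horner.
  by rewrite /comm_mx mulNmx mulmxN.
(* [Y] is self-adjoint with square zero, so [Y = 0] by definiteness; then [X] vanishes in the same
   way. *)
pose Y := X' *m X.
have SY : S *m Y = X^T *m S *m X by rewrite mulmxA -XS.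
have [St _] := Sp.
have YS : Y^T *m S = S *m Y.
  by rewrite -[S in LHS]St -trmx_mul SY !trmx_mul trmxK St mulmxA.
apply: (posdef_eq0 Sp); rewrite -SY (_ : Y = 0) ?mulmx0//.
apply: (posdef_eq0 Sp); rewrite YS -mulmxA (_ : Y *m Y = 0) ?mulmx0//.
by rewrite /Y -mulmxA (mulmxA X) XX' -mulmxA XX !mulmx0.
Qed.

Lemma poly_eq0_gt (p : {poly R}) (b : R) : (forall z, b < z -> p.[z] = 0) -> p = 0.
Proof.
move=> pz; pose rs := [seq b + k.+1%:R | k <- iota 0 (size p)].
apply: (@roots_geq_poly_eq0 _ p rs).
- by apply/allP => _ /mapP[k _ ->]; rewrite rootE pz// ltrDl ltr0n.
- rewrite map_inj_uniq ?iota_uniq// => k l /addrI/eqP.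
  by rewrite eqr_nat eqSS => /eqP.
- by rewrite size_map size_iota.
Qed.

Lemma deriv_neq0 (K : idomainType) (u : {poly K}) : [pchar K] =i pred0 ->
  (1 < size u)%N -> u^`() != 0.
Proof.
move=> ch u1; apply/eqP => /polyP/(_ (size u).-2); rewrite coef_deriv coef0.
have -> : (size u).-2.+1 = (size u).-1 by case: (size u) u1 => [|[]].
move=> /eqP; rewrite -mulr_natr mulf_eq0 -lead_coefE lead_coef_eq0.
rewrite -size_poly_eq0; case: (size u) u1 => [|[|n]]//= _.
by rewrite ((pcharf0P K).1 ch).
Qed.

(** Descent from the characteristic polynomial. If a nonconstant square [u^2] divides an annihilator
    with quotient [h], then [h u] has a square that kills [T]; hence [h u] kills [T(z)] for [z > b],
    and then identically in [z]. *)
Lemma annihilator_separable m (T : 'M[{poly R}]_m.+1) (S : R -> 'M[R]_m.+1) (b : R) :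
  (forall z, b < z -> posdef (S z) /\
    let Tz := map_mx (horner_eval z) T in S z *m Tz = - (Tz^T *m S z)) ->
  exists q : {poly {poly R}}, horner_mx T q = 0 /\ separable_poly q.
Proof.
move=> ST.
suff H k (q : {poly {poly R}}) : (size q <= k)%N -> q != 0 -> horner_mx T q = 0 ->
    exists q : {poly {poly R}}, horner_mx T q = 0 /\ separable_poly q.
  apply: (H _ (char_poly T) (leqnn _)); last exact: Cayley_Hamilton.
  by rewrite monic_neq0 ?char_poly_monic.
elim: k q => [|k IH] q qk q0 Tq; first by move: q0; rewrite -size_poly_leq0 qk.
have [qs|qns] := boolP (separable_poly q); first by exists q.
(* The coefficients lie in the domain [{poly R}], so divisibility holds only up to a nonzero factor
   [c]. The annihilator need not be monic. *)
have [u u1 /Pdiv.Idomain.dvdpP[[c h] /= c0 cq]] :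
    exists2 u : {poly {poly R}}, size u != 1%N & u ^+ 2 %| q.
  apply: contrapT => nu; move/negP: qns; apply; apply/separable_polyP; split.
    apply/poly_square_freeP => u u1; apply/negP => uq; apply: nu; exists u => //.
  move=> u _; apply: deriv_neq0; apply/pcharf0P => n.
  by rewrite -polyC_natr polyC_eq0 pnatr_eq0.
have cq0 : c *: q != 0 by rewrite -size_poly_eq0 size_scale// size_poly_eq0.
have hu0 : (h != 0) && (u != 0).
  by move: cq0; rewrite cq expr2 !mulf_eq0 !negb_or => /and3P[-> ->].
have [h0 u0] := andP hu0.
apply: (IH (h * u)); last 1 first.
- apply/matrixP => i j; rewrite [RHS]mxE; apply: (@poly_eq0_gt _ b) => z bz.
  have [Sp SzT] := ST z bz.
  suff /matrixP/(_ i j) : map_mx (horner_eval z) (horner_mx T (h * u)) = 0.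
    by rewrite !mxE.
  rewrite map_horner_mx_com; apply: skew_adjoint_reduced Sp SzT _.
  rewrite -map_horner_mx_com -map_mxM mulmxE -rmorphM /=.
  have -> : h * u * (h * u) = h * (c *: q) by rewrite cq; ring.
  have -> : horner_mx T (h * (c *: q)) = 0 by rewrite rmorphM /= horner_mxZ Tq scaler0 mulr0.
  exact: map_mx0.
- rewrite -ltnS; apply: leq_trans qk; rewrite -(size_scale q c0) cq expr2 mulrA.
  rewrite [X in (_ < X)%N]size_mul ?mulf_neq0//.
  have : (1 < size u)%N by rewrite ltn_neqAle eq_sym u1 size_poly_gt0.
  by case: (size u) => [|[|s]]// _; rewrite !addnS /= ltnS leq_addr.
- exact: mulf_neq0.
Qed.

End SkewAdjoint.

(** * Eigenvectors polynomial in [(z, w)] and Lagrange interpolation *)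

Section SpectralProjectors.
Variables (K : closedFieldType) (m : nat) (T : 'M[{poly K}]_m.+1).
Variables (q U V : {poly {poly K}}) (c : {poly K}).
Hypotheses (Tq : horner_mx T q = 0) (Uq : U * q + V * q^`() = c%:P) (c0 : c != 0).

Let Tz z := map_mx (horner_eval z) T.
Let qz z : {poly K} := map_poly (horner_eval z) q.

(* [(q (z, u) - q (z, w)) / (u - w)], as a polynomial in [u]. *)
Let quo z w : {poly K} := \sum_(i < size q) (q`_i).[z] *:
  \sum_(k < i) 'X^(i.-1 - k) * w%:P ^+ k.

(* Proportional to the projector onto the [w]-eigenspace of [T z] along the
   other eigenspaces, whenever [T z] is diagonalizable. *)
Definition eigenproj z w : 'M[K]_m.+1 := horner_mx (Tz z) (quo z w).

(** The entries of [eigenproj] as polynomials in [w] over polynomials in [z]: this form gives both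
    holomorphy in [(z, w)] and polynomial growth at infinity. *)
Definition eigenproj_poly (a b : 'I_m.+1) : {poly {poly K}} :=
  \sum_(i < size q) \sum_(k < i) (q`_i * (T ^+ (i.-1 - k)) a b)%:P * 'X^k.

Lemma eigenproj_polyE z w a b :
  eigenproj z w a b = (eigenproj_poly a b).[w%:P].[z].
Proof.
rewrite /eigenproj /eigenproj_poly /quo rmorph_sum /= summxE.
rewrite !horner_sum; apply: eq_bigr => i _; rewrite horner_mxZ rmorph_sum /= mxE summxE.
rewrite !horner_sum mulr_sumr; apply: eq_bigr => k _.
have -> : horner_mx (Tz z) ('X^(i.-1 - k) * w%:P ^+ k) =
    map_mx (horner_eval z) (T ^+ (i.-1 - k)) *m (w ^+ k)%:M.
  rewrite -polyC_exp rmorphM /= horner_mx_C; congr (_ *m _).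
  by rewrite rmorphXn /= horner_mx_X [RHS]rmorphXn.
rewrite mul_mx_scalar !mxE hornerM hornerC hornerXn -polyC_exp !hornerM hornerC.
by rewrite /horner_eval; ring.
Qed.

Lemma quoP z w : ('X - w%:P) * quo z w = qz z - (qz z).[w]%:P.
Proof.
have qzE : qz z = \sum_(i < size q) (q`_i).[z] *: 'X^i.
  rewrite /qz /map_poly poly_def; apply: eq_bigr => i _.
  by rewrite /horner_eval.
rewrite {2}qzE horner_sum rmorph_sum /= {1}qzE -sumrB /quo mulr_sumr.
apply: eq_bigr => i _; rewrite -scalerAr -subrXX scalerBr; congr (_ - _).
by rewrite hornerZ hornerXn polyCM mul_polyC rmorphXn.
Qed.

Lemma char_poly_eval z w : (char_poly T).[w%:P].[z] = (char_poly (Tz z)).[w].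
Proof.
rewrite /Tz -map_char_poly -[w in RHS](hornerC w z) -[_.[z]]/(horner_eval z _).
by rewrite horner_map.
Qed.

Let Tqz z : horner_mx (Tz z) (qz z) = 0.
Proof. by rewrite -map_horner_mx_com Tq map_mx0. Qed.

Let resolvent z w :
  (Tz z - w%:M) *m eigenproj z w = - (qz z).[w]%:M.
Proof.
have := congr1 (horner_mx (Tz z)) (quoP z w).
by rewrite rmorphM !rmorphB /= horner_mx_X !horner_mx_C Tqz sub0r.
Qed.

Let unit_sub z w : ((Tz z - w%:M) \in unitmx) = ((char_poly (Tz z)).[w] != 0).
Proof.
rewrite unitmxE unitfE -rootE -eigenvalue_root_char; congr negb.
apply/eqP/idP => [d0|/eigenvalueP[v vT v0]].
  have /negbT : (Tz z - w%:M) \in unitmx = false by rewrite unitmxE unitfE d0 eqxx.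
  rewrite -row_free_unit -kermx_eq0 => k0.
  by apply/eigenvalueP; have /rowV0Pn[v /sub_kermxP vk v0] := k0; exists v => //;
    move: vk; rewrite mulmxBr mul_mx_scalar => /eqP; rewrite subr_eq0 => /eqP.
apply/eqP; apply: contraNT v0 => du.
have /mulmxK vK : Tz z - w%:M \in unitmx by rewrite unitmxE unitfE.
by rewrite -[v]vK mulmxBr vT mul_mx_scalar subrr mul0mx.
Qed.

(** The identity [resolvent] gives this at roots of [q(z, -)]. An eigenvalue of [T(z)] is such a
    root, since otherwise the same identity would invert [T(z) - w]. This covers every [z],
    including those where [q(z, -)] degenerates. *)
Lemma eigenproj_eigen z w : (char_poly (Tz z)).[w] = 0 ->
  Tz z *m eigenproj z w = w *: eigenproj z w.
Proof.
move=> w0; apply/eqP; rewrite -mul_scalar_mx -subr_eq0 -mulmxBl resolvent.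
rewrite oppr_eq0; apply/contraT => qw0.
suff : (Tz z - w%:M) \in unitmx by rewrite unit_sub w0 eqxx.
have qw : (qz z).[w] != 0 by apply: contraNneq qw0 => ->; rewrite rmorph0.
have /mulmx1_unit[] // : (Tz z - w%:M) *m (- (qz z).[w]^-1 *: eigenproj z w) = 1%:M.
rewrite -scalemxAr resolvent scaleNr scalerN opprK scale_scalar_mx mulVf//.
Qed.

Lemma eigenproj_sum : exists bad : seq K, forall z, z \notin bad ->
  exists (s : seq K) (a : K -> K),
    (forall w, w \in s -> (char_poly (Tz z)).[w] = 0) /\
    \sum_(w <- s) a w *: eigenproj z w = 1%:M.
Proof.
have [bad cE] := closed_field_poly_normal c; exists bad => z zb.
have cz : c.[z] != 0.
  rewrite cE hornerZ mulf_neq0 ?lead_coef_eq0// horner_prod prodf_seq_neq0.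
  apply/allP => x xb /=; rewrite !hornerE subr_eq0.
  by apply: contraNneq zb => ->.
have Uqz : map_poly (horner_eval z) U * qz z + map_poly (horner_eval z) V * (qz z)^`() =
    c.[z]%:P.
  rewrite -[c.[z]%:P](map_polyC (horner_eval z)) -Uq rmorphD !rmorphM /=.
  by rewrite deriv_map.
have q0 : qz z != 0.
  apply: contra_neq cz => q0; move: Uqz; rewrite q0 deriv0 !mulr0 addr0.
  by move=> /esym/eqP; rewrite polyC_eq0 => /eqP.
have [rs qE] := closed_field_poly_normal (qz z).
have lc0 : lead_coef (qz z) != 0 by rewrite lead_coef_eq0.
have qsep : separable_poly (qz z).
  rewrite unlock; apply/Bezout_coprimepP.
  exists (map_poly (horner_eval z) U, map_poly (horner_eval z) V) => /=.
  by rewrite Uqz polyC_eqp1.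
have rs_uniq : uniq rs.
  by rewrite -separable_prod_XsubC; apply: dvdp_separable qsep; rewrite qE dvdpZr// dvdpp.
have rsP w : w \in rs -> (qz z).[w] = 0.
  move=> wrs; rewrite qE hornerZ horner_prod (big_rem w wrs) /=.
  by rewrite hornerXsubC subrr mul0r mulr0.
have dq w : w \in rs -> (quo z w).[w] = (qz z)^`().[w].
  move=> wrs; have := congr1 (fun p : {poly K} => p^`().[w]) (quoP z w).
  rewrite rsP// polyC0 subr0 derivM derivB derivX derivC subr0 mul1r hornerD hornerM.
  by rewrite hornerXsubC subrr mul0r addr0.
have dq0 w : w \in rs -> (qz z)^`().[w] != 0.
  move=> wrs; apply: contraNneq cz => dq0.
  have := congr1 (fun p : {poly K} => p.[w]) Uqz.
  by rewrite hornerD !hornerM dq0 rsP// !mulr0 addr0 hornerC => <-.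
have dqn w w' : w \in rs -> w' \in rs -> w' != w -> (quo z w).[w'] = 0.
  move=> wrs wrs' ww'; have := congr1 (fun p : {poly K} => p.[w']) (quoP z w).
  rewrite (rsP w)// polyC0 subr0 hornerM hornerXsubC rsP// => /eqP.
  by rewrite mulf_eq0 subr_eq0 (negPf ww') => /eqP.
have rs_size : size (qz z) = (size rs).+1.
  by rewrite qE size_scale// size_prod_XsubC.
(* Without roots [q(z, -)] would be a nonzero constant killing [T(z)]. *)
have rs0 : (0 < size rs)%N.
  rewrite lt0n; apply: contra_eqN rs_size => /eqP rs0; rewrite rs0.
  apply: contra_neqN q0 => /eqP/eqP/size_poly1P[a a0 qa].
  by have := Tqz z; rewrite qa horner_mx_C => /matrixP/(_ 0 0); rewrite !mxE eqxx => /eqP;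
    rewrite mulr1n (negPf a0).
(* Both sides have degree less than the number of roots and agree at every root. *)
have lagrange : \sum_(w <- rs) (qz z)^`().[w]^-1 *: quo z w = 1.
  apply/eqP; rewrite -subr_eq0; apply/eqP; apply: (@roots_geq_poly_eq0 _ _ rs) => //.
    apply/allP => w wrs; rewrite rootE hornerD hornerN hornerC horner_sum.
    rewrite (bigD1_seq w)//= hornerZ dq// mulVf ?dq0// big_seq_cond big1 ?addr0 ?subrr//.
    by move=> w' /andP[wrs' ww']; rewrite hornerZ dqn ?mulr0// eq_sym.
  apply: leq_trans (size_polyD _ _) _; rewrite size_polyN size_poly1 geq_max rs0 andbT.
  rewrite big_seq; elim/big_ind: _ => [|p1 p2 s1 s2|w wrs].
  - by rewrite size_poly0.
  - by apply: leq_trans (size_polyD _ _) _; rewrite geq_max s1 s2.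
  - apply: leq_trans (size_scale_leq _ _) _.
    have [->|quo0] := eqVneq (quo z w) 0; first by rewrite size_poly0.
    have := congr1 (fun p : {poly K} => size p) (quoP z w).
    by rewrite rsP// polyC0 subr0 rs_size mulrC size_Mmonic ?monicXsubC// size_XsubC addn2 => -[->].
(* The sum is restricted to eigenvalues: at any other root of [q(z, -)] the matrix [T(z) - w] is
   invertible and kills [eigenproj z w], which is therefore zero. *)
pose s := [seq w <- rs | (char_poly (Tz z)).[w] == 0].
exists s, (fun w => (qz z)^`().[w]^-1); split.
  by move=> w; rewrite mem_filter => /andP[/eqP].
transitivity (\sum_(w <- rs) (qz z)^`().[w]^-1 *: eigenproj z w); last first.
  rewrite -[RHS](rmorph1 (horner_mx (Tz z))) -lagrange.
  by rewrite rmorph_sum /=; apply: eq_bigr => w _; rewrite horner_mxZ.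
rewrite big_filter big_mkcond big_seq [RHS]big_seq; apply: eq_bigr => w wrs.
case: eqP => // /eqP cw.
have Tu : (Tz z - w%:M) \in unitmx by rewrite unit_sub.
have := resolvent z w; rewrite rsP// rmorph0 oppr0 => /(congr1 (mulmx (invmx (Tz z - w%:M)))).
by rewrite mulKmx// mulmx0 => ->; rewrite scaler0.
Qed.

End SpectralProjectors.

(* [set] identifies the matrix monomials up to conversion. *)
Ltac mx_ring :=
  repeat progress (rewrite ?(mulmxDl, mulmxDr, mulmxBl, mulmxBr, mulNmx, mulmxN, mulmxA);
    rewrite -?scalemxAl -?scalemxAr);
  repeat match goal with |- context [@mulmx ?K ?m ?n ?p ?A ?B] =>
    let X := fresh "X" in set X := (@mulmx _ _ _ _ A B); move: X => X end;
  apply/matrixP => ? ?; rewrite !mxE; ring.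

(** * The Lax equation and existence of the body frame *)

Section LaxPair.
Context {R : realType}.
Variables (n : nat) (J : 'M[R]_n) (I : set R) (F B : R -> 'M[R]_n).
Hypotheses (oI : open I) (Ii : is_interval I) (J_sym : sym_mx J).
Hypothesis FB : reduced_dressing_system I (complexify J) F B.
Local Notation C := (complexify J).
Local Notation cF x := (complexify (F x)).
Local Notation cB x := (complexify (B x)).

Definition lax (w : R[i]) (x : R) : 'M[R[i]]_n :=
  cB x + w *: (C *m cF x + cF x *m C) - w ^+ 2 *: (C *m C).

Lemma reduced_derive x : I x -> [/\ skew_mx (F x), sym_mx (B x),
  is_derive x 1 F (derive1 F x), is_derive x 1 B (lie (B x) (F x)) &
  J *m derive1 F x + derive1 F x *m J = lie J (F x *m F x + B x)].
Proof.
move=> Ix; have [FS BS [X [Y [FX BY [XE YE]]]]] := (reducedP J I F B).1 FB x Ix.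
have FE : derive1 F x = X by rewrite derive1E; apply: derive_val.
by rewrite FE -YE.
Qed.

Lemma coef_derive w x : I x ->
  is_cderive x (fun x => w *: C - cF x) (- complexify (derive1 F x)).
Proof.
move=> /reduced_derive[_ _ Fd _ _]; rewrite -sub0r; apply: is_cderiveB.
  exact: is_cderive_cst.
exact/is_cderive_complexify.
Qed.

(** In [- Y'' + U Y] the terms in [F'] cancel, and expanding [(w C - F)^2] leaves [lax w]. With [Z]
    arbitrary the lemma serves both the eigenfunctions and, at [w = 0], the body frame. *)
Lemma lax_schrodinger k (w : R[i]) (Y Z : R -> 'M[R[i]]_(n, k)) :
  (forall x, I x -> is_cderive x Y ((w *: C - cF x) *m Y x)) ->
  (forall x, I x -> Z x = lax w x *m Y x) ->
  schrodinger I (dressing_potential F B) Y Z.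
Proof.
move=> Yd ZE; pose A x := w *: C - cF x.
exists (fun x => A x *m Y x), (fun x => - complexify (derive1 F x) *m Y x + A x *m (A x *m Y x)).
move=> x Ix; split; first exact: Yd.
  by apply: is_cderiveM; [exact: coef_derive|exact: Yd].
rewrite ZE// /lax /dressing_potential /A !(complexifyD, complexifyN, complexifyM).
mx_ring.
Qed.

(** By powers of [w]: the constant term is [[B, F]], the linear one is [[C, F^2 + B]], which is
    [M'], and the terms in [w^2] and [w^3] cancel. *)
Lemma lax_derive w x : I x ->
  is_cderive x (lax w) (lie (w *: C - cF x) (lax w x)).
Proof.
move=> Ix; have [_ _ Fd Bd E] := reduced_derive Ix.
have Fc := (is_cderive_complexify x F _).2 Fd; have Bc := (is_cderive_complexify x B _).2 Bd.
have -> : lie (w *: C - cF x) (lax w x) = complexify (lie (B x) (F x)) +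
    w *: (C *m complexify (derive1 F x) + complexify (derive1 F x) *m C) - 0.
  rewrite -!complexifyM -complexifyD E !complexify_lie complexifyD complexifyM /lie /lax.
  mx_ring.
apply: is_cderiveB; last exact: is_cderive_cst.
apply: is_cderiveD => //; apply: is_cderiveZ; apply: is_cderiveD.
  exact: is_cderiveMl.
exact: is_cderiveMr.
Qed.

(** By the Lax equation the defect [lax w x *m Y x - z *: Y x] solves the same linear system as
    [Y]. *)
Lemma lax_eigen k (w z : R[i]) (Y : R -> 'M[R[i]]_(n, k)) x0 : I x0 ->
  (forall x, I x -> is_cderive x Y ((w *: C - cF x) *m Y x)) ->
  lax w x0 *m Y x0 = z *: Y x0 -> forall x, I x -> lax w x *m Y x = z *: Y x.
Proof.
move=> Ix0 Yd E x Ix; apply/eqP; rewrite -subr_eq0; apply/eqP.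
apply: (@lin_ode_zero R I _ _ (fun x => w *: C - cF x)
  (fun x => lax w x *m Y x - z *: Y x) x0 Ii _ _ Ix0) Ix.
- by move=> t /(coef_derive w) tD; exists (- complexify (derive1 F t)).
- move=> t It.
  have -> : (w *: C - cF t) *m (lax w t *m Y t - z *: Y t) =
      (lie (w *: C - cF t) (lax w t) *m Y t + lax w t *m ((w *: C - cF t) *m Y t))
       - z *: ((w *: C - cF t) *m Y t).
    rewrite /lie; move: (w *: C - cF t) (lax w t) => A L.
    by rewrite mulmxBr mulmxBl !mulmxA subrK -scalemxAr.
  apply: is_cderiveB; last by apply: is_cderiveZ; exact: Yd.
  by apply: is_cderiveM; [exact: lax_derive|exact: Yd].
- by rewrite E subrr.
Qed.

Lemma body_frame_derive Q t : body_frame I F Q -> I t ->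
  [/\ (Q t)^T *m Q t = 1%:M, Q t *m (Q t)^T = 1%:M, invmx (Q t) = (Q t)^T,
      is_derive t 1 Q (Q t *m F t) &
      is_derive t 1 (fun t => invmx (Q t)) (- F t *m invmx (Q t))].
Proof.
move=> FQ It; have Qi s : I s -> invmx (Q s) = (Q s)^T /\ Q s *m (Q s)^T = 1%:M.
  move=> /FQ[QQ _ _ _]; have [_ Qu] := mulmx1_unit QQ; have QQ' := mulmx1C QQ.
  by split=> //; rewrite -[LHS]mulmx1 -QQ' mulKmx.
have [QQ _ Qd QF] := FQ t It; have [QE QQ'] := Qi t It.
have Qd' : is_derive t 1 Q (Q t *m F t).
  apply: DeriveDef => //; rewrite -derive1E -QF mulKVmx//.
  by have [_ ->] := mulmx1_unit QQ.
split; [exact: QQ|exact: QQ'|exact: QE|exact: Qd'|].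
have [FS _ _ _ _] := reduced_derive It.
apply: (@is_derive_on R I _ t (fun t => (Q t)^T)) oI It _ _.
  by move=> s /Qi[->].
rewrite QE -FS -trmx_mul; apply/is_cderive_complexify; rewrite /complexify -map_trmx.
under [X in is_cderive _ X]eq_fun do rewrite -map_trmx.
by apply: is_cderive_trmx; apply/is_cderive_complexify.
Qed.

(** The frame is the transpose of the real part [P] of the fundamental solution at [w = 0]: [F] is
    real, so [P' = - F P], and skewness of [F] keeps [P^T P] constant. *)
Lemma body_frame_exists x0 : I x0 -> exists Q, body_frame I F Q.
Proof.
move=> Ix0.
have [Phi Phi0 Phid] := @fundamental R I x0 oI Ii Ix0 n (fun x => 0 *: C - cF x)
  (fun x Ix => ex_intro _ _ (coef_derive 0 Ix)).
pose P x := map_mx (@complex.Re R) (Phi x).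
have P0 : P x0 = 1%:M.
  rewrite /P Phi0; apply/matrixP => i j; rewrite !mxE.
  by case: (i == j).
have Pd x : I x -> is_derive x 1 P (- F x *m P x).
  move=> /Phid[+ _]; rewrite scale0r sub0r; congr is_derive.
  apply/matrixP => i j; rewrite !mxE (big_morph _ (@ReD R) (erefl : complex.Re (0 : R[i]) = 0)).
  by apply: eq_bigr => k _; rewrite ReM !mxE /= oppr0 mul0r subr0.
have Pc x Ix := (is_cderive_complexify x P _).2 (Pd x Ix).
have PP x : I x -> (P x)^T *m P x = 1%:M.
  move=> Ix; apply: complexify_inj.
  have cT (A : 'M[R]_n) : (complexify A)^T = complexify A^T.
    by rewrite /complexify map_trmx.
  have E t : complexify ((P t)^T *m P t) = (complexify (P t))^T *m complexify (P t).
    by rewrite complexifyM /complexify -map_trmx.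
  transitivity (complexify ((P x0)^T *m P x0)); last by rewrite P0 trmx1 mulmx1.
  apply: (@is_cderive0_cst R I _ _ (fun t => complexify ((P t)^T *m P t)) x0 Ii _ Ix0) Ix.
  move=> t It; under [X in is_cderive _ X]eq_fun do rewrite E.
  have [FS _ _ _ _] := reduced_derive It.
  have := is_cderiveM (is_cderive_trmx (Pc t It)) (Pc t It); congr is_cderive.
  have -> : (complexify (- F t *m P t))^T = (complexify (P t))^T *m cF t.
    by rewrite !cT trmx_mul linearN /= FS opprK complexifyM.
  by rewrite complexifyM complexifyN mulNmx mulmxN mulmxA subrr.
have detP x : I x -> \det (P x) = 1.
  move=> Ix; have det2 t : I t -> \det (P t) ^+ 2 = 1.
    by move=> It; rewrite expr2 -{1}det_tr -det_mulmx PP// det1.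
  have /orP[/eqP//|/eqP dN] : (\det (P x) == 1) || (\det (P x) == -1).
    by rewrite -eqf_sqr det2// expr1n.
  (* A continuous determinant passing from 1 to -1 would vanish in between, where its square is
     1. *)
  exfalso; pose a := Num.min x x0; pose b := Num.max x x0.
  have Iab t : t \in `[a, b] -> I t.
    rewrite in_itv /=; apply: Ii.
      by rewrite /a; case: ltP.
    by rewrite /b; case: ltP.
  have ab : a <= b by rewrite /a /b; case: (ltP x x0) => [/ltW|].
  have [| |c cab c0] := @IVT R (fun t => \det (P t)) a b 0 ab.
  - apply: continuous_in_subspaceT => t; rewrite inE => /Iab/Pd/is_derive_mxP Ptd.
    rewrite (_ : (fun t => \det (P t)) = \sum_(s : 'S_n)
       (cst ((-1) ^+ s) * \prod_i (fun t => P t i (s i)))); last first.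
      apply/funext => u; rewrite fct_sumE; apply: eq_bigr => s _.
      by rewrite -[RHS]/(cst _ u * _) fct_prodE.
    elim/big_ind: _ => [|f g fc gc|s _]; [exact: cvg_cst|exact: cvgD|].
    apply: cvgM; first exact: cvg_cst.
    elim/big_ind: _ => [|f g fc gc|i _]; [exact: cvg_cst|exact: cvgM|].
    exact: is_derive_continuous (Ptd i (s i)).
  - have d0 : \det (P x0) = 1 by rewrite P0 det1.
    have [[-> ->]|[-> ->]] : (\det (P a) = 1 /\ \det (P b) = -1) \/
        (\det (P a) = -1 /\ \det (P b) = 1).
    + by rewrite /a /b; case: (ltP x x0) => _; rewrite d0 dN; [right|left].
    + by rewrite ge_min le_max lerN10 ler01 ?orbT.
    + by rewrite ge_min le_max lerN10 ler01 ?orbT.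
  - by have := det2 c (Iab c cab); rewrite c0 expr0n /= => /eqP; rewrite eq_sym oner_eq0.
exists (fun x => (P x)^T) => t It.
have PPt := mulmx1C (PP t It); have [_ Pu] := mulmx1_unit (PP t It).
have [FS _ _ _ _] := reduced_derive It.
have Ptd : is_derive t 1 (fun x => (P x)^T) ((P t)^T *m F t).
  have -> : (P t)^T *m F t = (- F t *m P t)^T by rewrite trmx_mul linearN /= FS opprK.
  apply/is_cderive_complexify; rewrite /complexify -map_trmx.
  under [X in is_cderive _ X]eq_fun do rewrite -map_trmx.
  by apply: is_cderive_trmx; apply: Pc.
split; [by rewrite trmxK|by rewrite det_tr detP|by case: Ptd|].
rewrite derive1E; have -> := @derive_val _ _ _ _ _ _ _ Ptd.
by rewrite mulKmx// unitmx_tr.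
Qed.

End LaxPair.

Section Motion.
Context {R : realType}.
Variables (n : nat) (J : 'M[R]_n) (I : set R) (F B : R -> 'M[R]_n).
Hypotheses (oI : open I) (Ii : is_interval I).
Hypothesis FB : reduced_dressing_system I (complexify J) F B.

(** [phi] solves the auxiliary linear system at [w = 0], where [lax] reduces to [B]; hence
    [L phi = B phi = phi Lambda]. *)
Lemma body_frame_motion Q x0 : I x0 -> body_frame I F Q ->
  let phi := fun x => invmx (Q x) in
  exists Lambda : 'M[R]_n,
    [/\ sym_mx Lambda,
        forall x, I x ->
          [/\ B x = invmx (Q x) *m Lambda *m Q x,
              derivable phi x 1,
              F x = - derive1 phi x *m invmx (phi x)
            & B x = phi x *m Lambda *m invmx (phi x)],
        schrodinger I (dressing_potential F B) (fun x => complexify (phi x))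
          (fun x => complexify (phi x *m Lambda))
      & forall beta : 'rV[R]_n, Lambda = diag_mx beta ->
        forall j, schrodinger I (dressing_potential F B)
          (fun x => complexify (col j (phi x)))
          (fun x => complexify (beta ord0 j *: col j (phi x)))].
Proof.
move=> Ix0 FQ phi.
have bfd t It := body_frame_derive oI FB FQ It (t := t).
pose Lambda := Q x0 *m B x0 *m (Q x0)^T; exists Lambda.
have LE x : I x -> Q x *m B x *m (Q x)^T = Lambda.
  move=> Ix; apply: complexify_inj.
  apply: (@is_cderive0_cst R I _ _ (fun t => complexify (Q t *m B t *m (Q t)^T)) x0 Ii _ Ix0) Ix.
  move=> t It; have [_ _ _ Qd _] := bfd t It; have [FS _ _ Bd _] := reduced_derive FB It.
  have Qc := (is_cderive_complexify t Q _).2 Qd; have Bc := (is_cderive_complexify t B _).2 Bd.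
  have cT (A : 'M[R]_n) : complexify A^T = (complexify A)^T by rewrite /complexify map_trmx.
  under [X in is_cderive _ X]eq_fun do rewrite !complexifyM cT.
  have := is_cderiveM (is_cderiveM Qc Bc) (is_cderive_trmx Qc); congr is_cderive.
  rewrite -[(complexify (Q t *m F t))^T]cT trmx_mul FS complexify_lie !complexifyM complexifyN cT /lie.
  mx_ring.
have BE x : I x -> B x = invmx (Q x) *m Lambda *m Q x.
  move=> Ix; have [QQ _ -> _ _] := bfd x Ix.
  by rewrite -(LE x Ix) !mulmxA QQ mul1mx -mulmxA QQ mulmx1.
have phiE x : I x -> phi x *m Lambda = B x *m phi x.
  move=> Ix; rewrite (BE x Ix) /phi -[_ *m Q x *m _]mulmxA mulmxV ?mulmx1//.
  by have [QQ _ _ _ _] := bfd x Ix; have [_] := mulmx1_unit QQ.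
have phic x : I x -> is_cderive x (fun x => complexify (phi x))
    ((0 *: complexify J - complexify (F x)) *m complexify (phi x)).
  move=> Ix; have [_ _ _ _ pd] := bfd x Ix.
  rewrite scale0r sub0r -complexifyN -complexifyM.
  exact/is_cderive_complexify.
have lax0 x : lax J F B 0 x = complexify (B x).
  by rewrite /lax expr0n /= !scale0r subr0 addr0.
split.
- have [_ BS _ _ _] := reduced_derive FB Ix0.
  by rewrite /sym_mx /Lambda !trmx_mul trmxK BS mulmxA.
- move=> x Ix; have [QQ QQ' QE _ pd] := bfd x Ix.
  have Qu : Q x \in unitmx by have [_] := mulmx1_unit QQ.
  split; [exact: BE|by case: pd| |by rewrite {2}/phi invmxK; exact: BE].
  rewrite derive1E; have -> := @derive_val _ _ _ _ _ _ _ pd.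
  by rewrite (mulNmx (F x)) opprK /phi invmxK mulmxKV.
- apply: (lax_schrodinger FB phic) => x Ix.
  by rewrite lax0 phiE// complexifyM.
- move=> beta Lb j.
  apply: (@lax_schrodinger R n J I F B FB _ 0) => x Ix.
    rewrite (_ : (fun t => _) = fun t => complexify (phi t) *m complexify (delta_mx j 0)).
      rewrite colE complexifyM mulmxA; apply: is_cderiveMr; exact: phic.
    by apply/funext => t; rewrite colE complexifyM.
  rewrite lax0 -complexifyM; congr complexify.
  rewrite [in RHS]colE mulmxA -phiE// Lb -colE mul_mx_diag.
  by apply/matrixP => k l; rewrite !mxE mulrC.
Qed.

End Motion.

(** * The companion linearization and its definite form *)

Section Companion.
Context {R : realType}.
Variables (n : nat) (J F0 B0 : 'M[R]_n.+1).
Hypotheses (J_sym : sym_mx J) (F_skew : skew_mx F0) (B_sym : sym_mx B0).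
Hypothesis Ju : J \in unitmx.

Let Ji2 := invmx J *m invmx J.
Let M0 := J *m F0 + F0 *m J.

(* Linearization in [w] of the pencil [B0 + w M0 - w^2 J^2 - z], where [z] is
   the variable of the polynomial entries. *)
Definition companion : 'M[{poly R}]_(n.+1 + n.+1) :=
  (block_mx 0 1%:M (map_mx polyC (Ji2 *m B0) - 'X *: map_mx polyC Ji2)
    (map_mx polyC (Ji2 *m M0)) : 'M[_]_(n.+1 + n.+1)).

Definition ccompanion : 'M[{poly R[i]}]_(n.+1 + n.+1) :=
  map_mx (map_poly (real_complex R)) companion.

Lemma companion_eval z : map_mx (horner_eval z) companion =
  (block_mx 0 1%:M (Ji2 *m (B0 - z%:M)) (Ji2 *m M0) : 'M[_]_(n.+1 + n.+1)).
Proof.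
rewrite map_block_mx map_mx0 map_mx1; congr block_mx.
  rewrite mulmxBr mul_mx_scalar; apply/matrixP => i j.
  by rewrite !mxE /horner_eval !hornerE.
by apply/matrixP => i j; rewrite !mxE /horner_eval hornerC.
Qed.

Lemma ccompanion_eval z : map_mx (horner_eval z) ccompanion =
  (block_mx 0 1%:M (complexify Ji2 *m (complexify B0 - z%:M))
    (complexify Ji2 *m complexify M0) : 'M[_]_(n.+1 + n.+1)).
Proof.
rewrite /ccompanion !map_block_mx !map_mx0 !map_mx1.
congr block_mx.
  rewrite mulmxBr mul_mx_scalar -complexifyM; apply/matrixP => i j.
  move: (Ji2 *m B0) Ji2 => N1 N2; rewrite !mxE rmorphB rmorphM /= !map_polyC map_polyX.
  by rewrite /horner_eval !hornerE.
rewrite -complexifyM; move: (Ji2 *m M0) => N1; apply/matrixP => i j.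
by rewrite !mxE /= map_polyC /horner_eval hornerC.
Qed.

Let dot k (u v : 'cV[R]_k) : (u^T *m v) ord0 ord0 = ipr (complexify u) (complexify v).
Proof.
rewrite mxE /ipr; apply: eq_bigr => i _; rewrite big_ord1 !mxE /=.
by rewrite mulr0 addr0.
Qed.

Let ipr_nsq k (u : 'cV[R]_k) : ipr (complexify u) (complexify u) = nsq (complexify u).
Proof. by rewrite -[X in ipr _ X]scale1r iprZ mul1r. Qed.

(** The energy form of the gyroscopic system [J^2 y'' = M0 y' - (z - B0) y], whose phase-space
    matrix is [companion] at [z]. Conservation of energy is the skew-adjointness. *)
Let S z : 'M[R]_(n.+1 + n.+1) := (block_mx (z%:M - B0) 0 0 (J *m J) : 'M[_]_(n.+1 + n.+1)).

Let S_sym z : (S z)^T = S z.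
Proof.
by rewrite tr_block_mx !trmx0 linearB /= tr_scalar_mx B_sym trmx_mul J_sym.
Qed.

Lemma companion_posdef z : 1 + nsq (complexify B0) < z -> posdef (S z).
Proof.
move=> zb; split; first exact: S_sym.
move=> v; rewrite -[v]vsubmxK.
set a := usubmx _; set b := dsubmx _.
rewrite tr_col_mx mul_row_block mul_row_col.
rewrite !mulmx0 addr0 add0r => vSv.
(* This estimate is the source of the threshold [1 + nsq (complexify B0)] for [z]. *)
have aB : 2 * ipr (complexify a) (complexify (B0 *m a)) <=
    (1 + nsq (complexify B0)) * nsq (complexify a).
  apply: le_trans (ler_norm _) _; apply: le_trans (ipr_le _ _) _.
  by rewrite mulrDl mul1r lerD2l complexifyM nsqM.
have E : z * nsq (complexify a) - ipr (complexify a) (complexify (B0 *m a)) +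
    nsq (complexify (J *m b)) = 0.
  rewrite -!ipr_nsq -!dot trmx_mul J_sym.
  move: vSv; rewrite mulmxBr mulmxBl mul_mx_scalar -scalemxAl !mulmxA.
  move: (a^T *m a) (a^T *m B0 *m a) (b^T *m J *m J *m b) => N1 N2 N3.
  by move=> /matrixP/(_ ord0 ord0); rewrite !mxE.
have a0 := nsq_ge0 (complexify a); have b0 := nsq_ge0 (complexify (J *m b)).
have B0' := nsq_ge0 (complexify B0).
have na : nsq (complexify a) = 0 by nra.
have nb : nsq (complexify (J *m b)) = 0 by nra.
have c0 k (u : 'cV[R]_k) : nsq (complexify u) = 0 -> u = 0.
  by move=> /nsq_eq0 u0; apply: complexify_inj; rewrite u0 [RHS]map_mx0.
have -> : a = 0 by exact: c0.
have -> : b = 0 by rewrite -[b](mulKmx Ju) (c0 _ _ nb) mulmx0.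
exact: col_mx0.
Qed.

Lemma companion_skew_adjoint z : let Tz := map_mx (horner_eval z) companion in
  S z *m Tz = - (Tz^T *m S z).
Proof.
have M_skew : M0^T = - M0.
  by rewrite /M0 linearD /= !trmx_mul J_sym F_skew mulNmx mulmxN addrC opprD.
have JJ (X : 'M[R]_n.+1) : J *m J *m (Ji2 *m X) = X.
  by rewrite /Ji2 !mulmxA mulmxK// mulmxV// mul1mx.
have ST : S z *m map_mx (horner_eval z) companion =
    (block_mx 0 (z%:M - B0) (B0 - z%:M) M0 : 'M[_]_(n.+1 + n.+1)).
  rewrite companion_eval mulmx_block !mul0mx !mulmx0 mulmx1 !addr0 !add0r.
  by rewrite !JJ.
rewrite /= ST; have St : (S z)^T = S z.
  exact: S_sym.
rewrite -[X in _ *m X]St -trmx_mul ST tr_block_mx opp_block_mx trmx0 oppr0.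
rewrite M_skew opprK; congr block_mx;
  by rewrite [in RHS]raddfB /= tr_scalar_mx B_sym opprB.
Qed.

Lemma companion_annihilator : exists (q U V : {poly {poly R[i]}}) (c : {poly R[i]}),
  [/\ @horner_mx _ (n + n.+1) ccompanion q = 0, U * q + V * q^`() = c%:P & c != 0].
Proof.
(* [n + n.+1] reads the size [n.+1 + n.+1] as a successor, so that the ring of square matrices
   applies. *)
have [q [Tq]] := @annihilator_separable R (n + n.+1) companion S _
  (fun z zb => conj (companion_posdef zb) (companion_skew_adjoint z)).
rewrite unlock => /Bezout_coprimepP[[u v] /eqpP[[c1 c2] /andP[/= c10 c20] E]].
have E' : (c1 *: u) * q + (c1 *: v) * q^`() = c2%:P.
  by rewrite -!scalerAl -scalerDr E alg_polyC.
pose f : {rmorphism {poly R} -> {poly R[i]}} := map_poly (real_complex R).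
exists (map_poly f q), (map_poly f (c1 *: u)), (map_poly f (c1 *: v)), (f c2); split.
- have := @map_horner_mx_com _ _ f (n + n.+1) companion q; rewrite Tq map_mx0 => /esym.
  by apply: etrans.
- by rewrite deriv_map -!rmorphM -rmorphD E' /= map_polyC.
- by rewrite map_poly_eq0.
Qed.

End Companion.

(** * Holomorphic functions of one complex variable *)

Section Holomorphic.
Context {R : realType}.
Local Notation K := (R[i] : numFieldType).

Definition holo (f : R[i] -> R[i]) (t : R[i]) : Prop :=
  derivable (f : K^o -> K^o) t 1.

Lemma holo_cst a t : holo (fun=> a) t.
Proof. exact: derivable_cst. Qed.

Lemma holoD f g t : holo f t -> holo g t -> holo (fun s => f s + g s) t.
Proof. exact: derivableD. Qed.

Lemma holoM f g t : holo f t -> holo g t -> holo (fun s => f s * g s) t.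
Proof. exact: derivableM. Qed.

Lemma holo_sum (T : Type) (s : seq T) (f : T -> R[i] -> R[i]) t :
  (forall k, holo (f k) t) -> holo (fun u => \sum_(k <- s) f k u) t.
Proof.
move=> fh; elim: s => [|k s IH].
  have -> : (fun u => \sum_(k <- [::]) f k u) = fun=> 0.
    by apply/funext => u; rewrite big_nil.
  apply: holo_cst.
have -> : (fun u => \sum_(k <- k :: s) f k u) = fun u => f k u + \sum_(k <- s) f k u.
  by apply/funext => u; rewrite big_cons.
exact: (holoD (fh k) IH).
Qed.

Lemma holo_comp f g t : holo g t -> holo f (g t) -> holo (fun s => f (g s)) t.
Proof.
move=> /derivable1_diffP gd /derivable1_diffP fd; apply/derivable1_diffP.
exact: (differentiable_comp gd fd).
Qed.

Lemma holo_horner (c : {poly R[i]}) z t : holo z t -> holo (fun s => c.[z s]) t.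
Proof.
move=> zh; elim/poly_ind: c => [|c a IH].
  have -> : (fun s => (0 : {poly R[i]}).[z s]) = fun=> 0.
    by apply/funext => s; rewrite horner0.
  apply: holo_cst.
have -> : (fun s => (c * 'X + a%:P).[z s]) = fun s => c.[z s] * z s + a.
  by apply/funext => s; rewrite hornerMXaddC.
exact: (holoD (holoM IH zh) (@holo_cst a t)).
Qed.

Lemma holo_horner2 (P : {poly {poly R[i]}}) z w t : holo z t -> holo w t ->
  holo (fun s => (P.[(w s)%:P]).[z s]) t.
Proof.
move=> zh wh; elim/poly_ind: P => [|P c IH].
  have -> : (fun s => ((0 : {poly {poly R[i]}}).[(w s)%:P]).[z s]) = fun=> 0.
    by apply/funext => s; rewrite !horner0.
  apply: holo_cst.
have -> : (fun s => ((P * 'X + c%:P).[(w s)%:P]).[z s]) =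
    fun s => (P.[(w s)%:P]).[z s] * w s + c.[z s].
  by apply/funext => s; rewrite hornerMXaddC hornerD hornerM hornerC.
exact: (holoD (holoM IH wh) (@holo_horner c z t zh)).
Qed.

(** No pole at finite points: the order [m] is 0 along every germ. *)
Lemma holomorphic_meromorphic p f :
  (forall z w t, holo z t -> holo w t -> holo (fun s => f (z s) (w s)) t) ->
  meromorphic_on_curve p f.
Proof.
move=> fh z w zh wh _; exists 0%N, (fun t => f (z t) (w t)); split.
  apply: filterS2 zh wh => t tz tw; exact: (fh z w t tz tw).
by near=> t; rewrite expr0 mul1r.
Unshelve. all: by end_near. Qed.

End Holomorphic.

(** * Polynomial bounds and uniformly bounded inverses *)

Section Bounds.
Context {R : realType}.

Lemma sqc1 : sqc (1 : R[i]) = 1.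
Proof. by rewrite /sqc /= expr1n expr0n addr0. Qed.

Lemma sqcV (a : R[i]) : sqc a^-1 = (sqc a)^-1.
Proof.
have [->|a0] := eqVneq a 0; first by rewrite invr0 /sqc /= !expr0n /= addr0 invr0.
have sa0 : sqc a != 0 by rewrite sqc_eq0.
by apply: (mulIf sa0); rewrite -sqcM !mulVf// sqc1.
Qed.

Lemma poly_bounded (p : {poly R[i]}) (b : R) :
  exists2 K, 0 <= K & forall x, sqc x <= b -> sqc p.[x] <= K.
Proof.
elim/poly_ind: p => [|p c [K K0 pK]].
  by exists 0 => // x _; rewrite horner0 /sqc /= expr0n addr0.
exists (2 * (K * `|b| + sqc c)) => [|x xb].
  by rewrite mulr_ge0// addr_ge0 ?sqc_ge0// mulr_ge0.
rewrite hornerMXaddC; apply: le_trans (sqcD _ _) _.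
rewrite ler_wpM2l// lerD2r sqcM ler_pM ?sqc_ge0 ?pK//.
by apply: le_trans xb _; exact: ler_norm.
Qed.

Lemma poly_mx_bounded m n (A : 'M[{poly R[i]}]_(m, n)) (b : R) :
  exists2 K, 0 <= K & forall x, sqc x <= b -> nsq (map_mx (horner_eval x) A) <= K.
Proof.
have /choice[K KP] : forall p : 'I_m * 'I_n, exists K, 0 <= K /\
    forall x, sqc x <= b -> sqc (A p.1 p.2).[x] <= K.
  by move=> p; have [K ? ?] := poly_bounded (A p.1 p.2) b; exists K.
exists (\sum_i \sum_j K (i, j)) => [|x xb].
  by apply: sumr_ge0 => i _; apply: sumr_ge0 => j _; case: (KP (i, j)).
apply: ler_sum => i _; apply: ler_sum => j _; rewrite mxE.
exact: (KP (i, j)).2.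
Qed.

Lemma poly2_bounded (P : {poly {poly R[i]}}) : exists (N : nat) (K : R), forall z w,
  K <= sqc z -> sqc w <= sqc z -> sqc (P.[w%:P]).[z] <= sqc z ^+ N.
Proof.
(* For [Z >= 4] one extra power of [Z] absorbs the constants, so the final bound is a pure power. *)
have addN (x y Z : R) (N1 N2 : nat) : 4 <= Z -> x <= Z ^+ N1 -> y <= Z ^+ N2 ->
    2 * (x + y) <= Z ^+ (N1 + N2).+1.
  move=> Z4 xZ yZ; have Z1 : 1 <= Z by lra.
  have p1 : Z ^+ N1 <= Z ^+ (N1 + N2) by rewrite ler_weXn2l// leq_addr.
  have p2 : Z ^+ N2 <= Z ^+ (N1 + N2) by rewrite ler_weXn2l// leq_addl.
  have p0 : 0 <= Z ^+ (N1 + N2) by rewrite exprn_ge0//; lra.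
  by rewrite exprS; nra.
have cb (c : {poly R[i]}) : exists (N : nat) (K : R), forall z,
    K <= sqc z -> sqc c.[z] <= sqc z ^+ N.
  elim/poly_ind: c => [|c a [N [K cK]]].
    by exists 1, 0 => z _; rewrite horner0 expr1 {1}/sqc /= expr0n addr0 sqc_ge0.
  exists (N.+1 + 1).+1, (Num.max K (Num.max 4 (sqc a))) => z.
  rewrite !ge_max => /and3P[Kz z4 az]; rewrite hornerMXaddC.
  apply: le_trans (sqcD _ _) _; apply: addN; rewrite ?expr1//.
  by rewrite sqcM exprSr ler_wpM2r ?sqc_ge0 ?cK.
elim/poly_ind: P => [|P c [N [K PK]]].
  by exists 1, 0 => z w _ _; rewrite !horner0 expr1 {1}/sqc /= expr0n addr0 sqc_ge0.
have [N' [K' cK]] := cb c.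
exists (N.+1 + N').+1, (Num.max K (Num.max K' 4)) => z w.
rewrite !ge_max => /and3P[Kz Kz' z4] wz; rewrite hornerMXaddC hornerD hornerM hornerC.
apply: le_trans (sqcD _ _) _; apply: addN; rewrite ?cK//.
by rewrite sqcM exprSr ler_pM ?sqc_ge0 ?PK.
Qed.

(** At [- k] one of the two terms of the Bezout identity has modulus at least 1/2, so [C + k] or
    [C - k] has a characteristic determinant bounded away from 0; its adjugate is bounded. This
    decides the sign of [k']. *)
Lemma bezout_inverse n (C : 'M[R[i]]_n) (b : R) :
  (exists u v, u * char_poly C + v * char_poly (- C) = 1) ->
  exists2 rho : R, 0 <= rho & forall k, sqc k <= b ->
    exists k' (N : 'M[R[i]]_n), [/\ k' ^+ 2 = k ^+ 2, N *m (C + k'%:M) = 1%:M & nsq N <= rho].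
Proof.
move=> [u [v uv]].
have [Ku Ku0 uK] := poly_bounded u b; have [Kv Kv0 vK] := poly_bounded v b.
have [Kc Kc0 cK] := poly_mx_bounded (\adj (char_poly_mx C)) b.
have [Kd Kd0 dK] := poly_mx_bounded (\adj (char_poly_mx (- C))) b.
exists (4 * Ku * Kc + 4 * Kv * Kd) => [|k kb].
  by rewrite addr_ge0// !mulr_ge0.
have nkb : sqc (- k) <= b by rewrite sqcN.
have adjE (D : 'M[R[i]]_n) x : map_mx (horner_eval x) (\adj (char_poly_mx D)) *m (x%:M - D) =
    (char_poly D).[x]%:M.
  have := congr1 (map_mx (horner_eval x)) (mul_adj_mx (char_poly_mx D)).
  rewrite map_mxM map_scalar_mx => <-; congr (_ *m _).
  apply/matrixP => i j; rewrite !mxE /= /horner_eval.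
  by rewrite hornerD hornerN hornerMn hornerX hornerC.
have inv (D : 'M[R[i]]_n) x (Ku' Kc' : R) (u' : {poly R[i]}) : 0 <= Ku' -> 0 <= Kc' ->
    1 <= 4 * sqc (u'.[x] * (char_poly D).[x]) -> sqc u'.[x] <= Ku' ->
    nsq (map_mx (horner_eval x) (\adj (char_poly_mx D))) <= Kc' ->
    exists N, N *m (x%:M - D) = 1%:M /\ nsq N <= 4 * Ku' * Kc'.
  move=> Ku0' Kc0' up uK' cK'; have p0 : (char_poly D).[x] != 0.
    by apply: contraTneq up => ->; rewrite mulr0 /sqc /= expr0n addr0 mulr0 ler10.
  exists ((char_poly D).[x]^-1 *: map_mx (horner_eval x) (\adj (char_poly_mx D))); split.
    by rewrite -scalemxAl adjE scale_scalar_mx mulVf.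
  rewrite nsqZ ler_pM ?sqc_ge0 ?nsq_ge0// sqcV.
  have sp : 0 < sqc (char_poly D).[x] by rewrite lt_neqAle eq_sym sqc_eq0 p0 sqc_ge0.
  rewrite -[leLHS]mul1r ler_pdivrMr//; apply: le_trans up _; rewrite sqcM -mulrA.
  by rewrite ler_wpM2l// ler_wpM2r// ltW.
have : 1 <= 2 * (sqc (u.[- k] * (char_poly C).[- k]) + sqc (v.[- k] * (char_poly (- C)).[- k])).
  apply: le_trans (sqcD _ _); have := congr1 (horner^~ (- k)) uv.
  by rewrite hornerD !hornerM hornerC => ->; rewrite sqc1.
set p1 := sqc (u.[_] * _); set p2 := sqc (v.[_] * _) => p12.
have [p11|p11] := leP 1 (4 * p1).
  have [N [NC Nb]] := inv C (- k) Ku Kc u Ku0 Kc0 p11 (uK _ nkb) (cK _ nkb).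
  exists k, (- N); rewrite nsqN; split=> //.
    by rewrite -NC mulNmx -mulmxN opprD addrC [in RHS]raddfN.
  by apply: le_trans Nb _; rewrite lerDl !mulr_ge0.
have p22 : 1 <= 4 * p2 by lra.
have [N [NC Nb]] := inv (- C) (- k) Kv Kd v Kv0 Kd0 p22 (vK _ nkb) (dK _ nkb).
exists (- k), N; rewrite sqrrN; split=> //; first by rewrite -NC opprK addrC.
by apply: le_trans Nb _; rewrite lerDr !mulr_ge0.
Qed.

End Bounds.

(** * Comparison of the maximum norm with the Frobenius norm *)

Section MaxNorm.
Context {R : realType}.

Lemma mx_norm_ge_entry m n (v : 'M[R[i]]_(m, n)) i j : `|v i j| <= `|v|.
Proof.
rewrite -[`|v|]/(mx_norm v) mx_normE -[leLHS]nngE num_le.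
by apply: (@le_bigmax _ _ _ _ (fun p : 'I_m * 'I_n => `|v p.1 p.2|%:nng) (i, j)).
Qed.

Lemma mx_norm_le m n (v : 'M[R[i]]_(m, n)) (c : R[i]) : 0 <= c ->
  (forall i j, `|v i j| <= c) -> `|v| <= c.
Proof.
move=> c0 vc; rewrite -[`|v|]/(mx_norm v).
have [->//|/mx_norm_neq0[p ->]] := eqVneq (mx_norm v) 0.
exact: vc.
Qed.

Definition rnorm m n (v : 'M[R[i]]_(m, n)) : R := complex.Re `|v|.

Lemma rnormE m n (v : 'M[R[i]]_(m, n)) : `|v| = ((rnorm v)%:C)%C.
Proof.
by apply: complexP => /=; have /ger0_Im := normr_ge0 v.
Qed.

Lemma rnorm_ge0 m n (v : 'M[R[i]]_(m, n)) : 0 <= rnorm v.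
Proof. by have := normr_ge0 v; rewrite rnormE -[0 in X in X -> _]/((0%:C)%C) lecR. Qed.

Lemma rnorm_sqr_le m n (v : 'M[R[i]]_(m, n)) : rnorm v ^+ 2 <= nsq v.
Proof.
suff : rnorm v <= Num.sqrt (nsq v).
  move=> H; rewrite -[leRHS](sqr_sqrtr (nsq_ge0 v)).
  by rewrite ler_sqr ?nnegrE ?rnorm_ge0 ?sqrtr_ge0.
rewrite -lecR -rnormE; apply: mx_norm_le => [|i j]; first by rewrite lecR sqrtr_ge0.
by rewrite sqc_normE lecR ler_sqrt ?nsq_ge0 ?nsq_entry.
Qed.

Lemma nsq_le_rnorm m n (v : 'M[R[i]]_(m, n)) : nsq v <= (m * n)%:R * rnorm v ^+ 2.
Proof.
have vij i j : sqc (v i j) <= rnorm v ^+ 2.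
  have := mx_norm_ge_entry v i j; rewrite rnormE sqc_normE lecR => H.
  by rewrite -[leLHS](sqr_sqrtr (sqc_ge0 _)) ler_sqr ?nnegrE ?rnorm_ge0 ?sqrtr_ge0.
apply: le_trans (_ : \sum_(i < m) \sum_(j < n) rnorm v ^+ 2 <= _).
  by apply: ler_sum => i _; apply: ler_sum.
by rewrite !sumr_const !card_ord -mulrnA mulr_natl mulnC.
Qed.

End MaxNorm.

(** * Exponential behaviour of the eigenfunctions as [z] tends to infinity *)

Section Growth.
Context {R : realType}.
Variables (n : nat) (J : 'M[R]_n) (I : set R) (F B : R -> 'M[R]_n) (x0 : R).
Hypotheses (oI : open I) (Ii : is_interval I) (Ix0 : I x0).
Local Notation C := (complexify J).
Hypothesis FB : reduced_dressing_system I C F B.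
Hypothesis Ju : C \in unitmx.
Hypothesis Cb : exists u v : {poly R[i]}, u * char_poly C + v * char_poly (- C) = 1.
Local Notation cF x := (complexify (F x)).
Local Notation cB x := (complexify (B x)).

Lemma eigenfunction_growth a b : I a -> I b -> exists2 K : R, 1 <= K &
  forall z w (Y : R -> 'cV[R[i]]_n), K <= sqc z -> Y x0 != 0 ->
    (forall x, I x -> is_cderive x Y ((w *: C - cF x) *m Y x)) ->
    (forall x, I x -> lax J F B w x *m Y x = z *: Y x) ->
    sqc w <= sqc z /\ exists2 k : R[i], k ^+ 2 = - z &
      forall x, a <= x <= b ->
        let e := expR (2 * complex.Re k * (x - x0)) in
        nsq (Y x) <= K * (e * nsq (Y x0)) /\ e * nsq (Y x0) <= K * nsq (Y x).
Proof.
move=> Ia Ib.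
(* The segment is enlarged to contain the normalization point. *)
pose al := Num.min a x0; pose be := Num.max b x0.
have Ial : I al by rewrite /al; case: ltP.
have Ibe : I be by rewrite /be; case: ltP.
have hullx0 : al <= x0 <= be by rewrite /al /be ge_min le_max lexx !orbT.
have hull x : a <= x <= b -> al <= x <= be.
  by move=> /andP[ax xb]; rewrite /al /be ge_min le_max ax xb.
have It t : al <= t <= be -> I t by exact: Ii.
have Fc t (tI : I t) : exists D, is_cderive t (fun x => cF x) D.
  by have [_ _ Fd _ _] := reduced_derive FB tI; exists (complexify (derive1 F t)); apply/is_cderive_complexify.
have Bc t (tI : I t) : exists D, is_cderive t (fun x => cB x) D.
  by have [_ _ _ Bd _] := reduced_derive FB tI; exists (complexify (lie (B t) (F t))); apply/is_cderive_complexify.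
have [KF KF0 FK] := locb_nsq Ii Fc Ial Ibe; have [KB KB0 BK] := locb_nsq Ii Bc Ial Ibe.
pose M x := C *m cF x + cF x *m C.
have C0 := nsq_ge0 C; have CC0 := nsq_ge0 (C *m C).
pose b1 := 1 + KF + KB + 4 * nsq C * KF + nsq (C *m C).
have b1M t : al <= t <= be -> [/\ nsq (cF t) <= b1, nsq (cB t) <= b1 & nsq (M t) <= b1].
  move=> tab; have := FK t tab; have := BK t tab; rewrite /= => Bt Ft.
  have cf : nsq (cF t) * nsq C <= KF * nsq C by rewrite ler_wpM2r.
  have p0 := mulr_ge0 KF0 C0.
  split; [by rewrite /b1; lra|by rewrite /b1; lra|].
  apply: le_trans (nsqD _ _) _; have := nsqM C (cF t); have := nsqM (cF t) C.
  by rewrite /b1; lra.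
have b11 : 1 <= b1 by rewrite /b1; have := mulr_ge0 C0 KF0; lra.
have b1C : nsq (C *m C) <= b1 by rewrite /b1; have := mulr_ge0 C0 KF0; lra.
have [rho rho0 rhoP] := bezout_inverse (12 * b1) Cb.
pose nu := nsq (invmx (C *m C)); have nu0 : 0 <= nu by exact: nsq_ge0.
pose K2 := 2 * (4 * rho * b1 + b1); pose L := 1 + K2.
have K20 : 0 <= K2 by rewrite /K2; have := mulr_ge0 rho0 (le_trans ler01 b11); lra.
have L0 : 0 <= L by rewrite /L; lra.
have ab0 : al <= be by case/andP: hullx0 => /le_trans; apply.
pose K := 1 + 12 * b1 + 10 * nu * b1 + expR (L * (be - al)).
have eL := expR_gt0 (L * (be - al)); have nb := mulr_ge0 nu0 (le_trans ler01 b11).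
have K1 : 1 <= K by rewrite /K; lra.
exists K => // z w Y Kz Y0 Yd YE.
pose s := sqc w; pose Z := sqc z; have s0 : 0 <= s by exact: sqc_ge0.
have y0 : 0 < nsq (Y x0).
  by rewrite lt_neqAle nsq_ge0 andbT eq_sym; apply: contraNneq Y0 => /nsq_eq0/eqP.
have [F1 B1 M1] := b1M x0 hullx0.
have E x : I x -> z *: Y x = cB x *m Y x + w *: (M x *m Y x) - w ^+ 2 *: (C *m C *m Y x).
  by move=> Ix; rewrite -YE// /lax mulmxBl mulmxDl -!scalemxAl.
have nB t : al <= t <= be -> nsq (cB t *m Y t + w *: (M t *m Y t)) <= 2 * (b1 + s * b1) * nsq (Y t).
  move=> tab; have [Ft Bt Mt] := b1M t tab; have yt := nsq_ge0 (Y t).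
  apply: le_trans (nsqD _ _) _; rewrite nsqZ -/s.
  have HB : nsq (cB t *m Y t) <= b1 * nsq (Y t).
    by apply: le_trans (nsqM _ _) _; rewrite ler_wpM2r.
  have HM : nsq (M t *m Y t) <= b1 * nsq (Y t).
    by apply: le_trans (nsqM _ _) _; rewrite ler_wpM2r.
  by have := ler_wpM2l s0 HM; lra.
(* Norms in the pencil equation at [x0], divided by [nsq (Y x0) > 0]. With [Z > 12 b1] it forces
   [s > 1], after which the quadratic term dominates. *)
have Zs : Z <= 4 * b1 * (1 + s + s ^+ 2).
  rewrite -(ler_pM2r y0) /Z -nsqZ E//; apply: le_trans (nsqB _ _) _.
  rewrite nsqZ sqcX -/s; have := nB x0 hullx0.
  have : nsq (C *m C *m Y x0) <= b1 * nsq (Y x0).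
    by apply: le_trans (nsqM _ _) _; rewrite ler_wpM2r// ltW.
  have := sqr_ge0 s; move: (nsq (C *m C *m Y x0)) (nsq (_ + _)) (nsq (Y x0)) y0 => N1 N2 N3 y0.
  move=> s2 H1 H2; have H3 := ler_wpM2l s2 H1; have H4 : 0 <= s ^+ 2 * (b1 * N3).
    by rewrite mulr_ge0// mulr_ge0 ?ltW//; lra.
  by nra.
have Kz12 : 12 * b1 < Z by rewrite /Z; apply: lt_le_trans Kz; rewrite /K; lra.
have s1 : 1 < s.
  rewrite ltNge; apply/negP => s1; have : s ^+ 2 <= 1 by rewrite expr_le1.
  by move=> s2; have : 4 * b1 * (1 + s + s ^+ 2) <= 4 * b1 * 3; [rewrite ler_wpM2l//; lra|lra].
have w0 : w != 0 by rewrite -sqc_eq0 -/s gt_eqF// (lt_trans ltr01 s1).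
have Zs2 : Z <= 12 * b1 * s ^+ 2.
  apply: le_trans Zs _; have : s <= s ^+ 2 by rewrite expr2 ler_peMl// ltW.
  by move=> ss; rewrite [leRHS](_ : _ = 4 * b1 * (3 * s ^+ 2)); [rewrite ler_wpM2l//; lra|ring].
(* If [|w|] exceeded [|z|], inverting [C^2] in the pencil equation would give [s <= 10 nu b1],
   contradicting the choice of [K]. *)
split.
  rewrite -/s -/Z leNgt; apply/negP => Zlt.
  have CCu : C *m C \in unitmx by rewrite unitmx_mul Ju.
  have H : nsq (Y x0) <= nu * nsq (C *m C *m Y x0).
    by rewrite -{1}[Y x0](mulKmx CCu); apply: nsqM.
  have H2 : s ^+ 2 * nsq (C *m C *m Y x0) <= 2 * (2 * (b1 + s * b1) * nsq (Y x0) + Z * nsq (Y x0)).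
    rewrite /s -sqcX -nsqZ -/s.
    have -> : w ^+ 2 *: (C *m C *m Y x0) = (cB x0 *m Y x0 + w *: (M x0 *m Y x0)) - z *: Y x0.
      by rewrite E// opprB addrC subrK.
    by apply: le_trans (nsqB _ _) _; rewrite nsqZ -/Z ler_wpM2l// lerD2r nB.
  have H3 : s ^+ 2 <= nu * (10 * b1 * s).
    rewrite -(ler_pM2r y0).
    have := ler_wpM2l (sqr_ge0 s) H; rewrite mulrCA => H4; apply: le_trans H4 _.
    rewrite -[leRHS]mulrA ler_wpM2l//; apply: le_trans H2 _.
    have yb := mulr_ge0 (ltW y0) (le_trans ler01 b11).
    have := ler_wpM2r (ltW y0) (ltW Zlt); have := ler_wpM2r yb (ltW s1).
    have : s * nsq (Y x0) <= s * nsq (Y x0) * b1 by rewrite ler_peMr// mulr_ge0// ltW.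
    by rewrite ?mul1r; nra.
  have H4 : s <= 10 * nu * b1 by rewrite -(ler_pM2r (lt_trans ltr01 s1)) -expr2; apply: le_trans H3 _; nra.
  by move: Kz; rewrite -/Z /K; lra.
(* The ratio [k / w] stays bounded, so [bezout_inverse] applies with one bound for all large [z] and
   fixes the sign of [k]. *)
pose kap := sqrtC (- z) / w.
have kapw : (w * kap) ^+ 2 = - z by rewrite /kap mulrC divfK// sqrtCK.
have kapb : sqc kap <= 12 * b1.
  have : sqc kap ^+ 2 <= 12 * b1.
    rewrite -sqcX -(ler_pM2l (_ : 0 < s ^+ 2)) ?exprn_gt0//; last by lra.
    rewrite /s -[in leLHS]sqcX -sqcM -exprMn kapw sqcN -/Z -/s mulrC; exact: Zs2.
  have := sqc_ge0 kap; nra.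
have [kap' [N [kk NC Nr]]] := rhoP kap kapb.
exists (w * kap'); first by rewrite exprMn kk -exprMn.
set k := w * kap'; have k2 : k ^+ 2 = - z by rewrite /k exprMn kk -exprMn.
(* [(w C + k)(w C - k) Y = (B + w M) Y] is of order [|w|], and [w C + k = w (C + kap')] has an
   inverse of order [1 / |w|]. *)
have g1b t : al <= t <= be -> nsq ((w *: C - k%:M) *m Y t) <= 4 * rho * b1 * nsq (Y t).
  move=> tab; have tI := It t tab.
  have NE : w *: ((w *: C - k%:M) *m Y t) = N *m (cB t *m Y t + w *: (M t *m Y t)).
    have -> : cB t *m Y t + w *: (M t *m Y t) = (w *: C + k%:M) *m ((w *: C - k%:M) *m Y t).
      have -> : cB t *m Y t + w *: (M t *m Y t) = z *: Y t + w ^+ 2 *: (C *m C *m Y t).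
        by rewrite (E t tI) subrK.
      have kC : (w *: C + k%:M) *m (w *: C - k%:M) = w ^+ 2 *: (C *m C) + z%:M.
        rewrite mulmxDl !mulmxBr -!scalemxAl -!scalemxAr scalerA -expr2 mul_mx_scalar.
        rewrite mul_scalar_mx -scalar_mxM -expr2 k2 [(- z)%:M]raddfN opprK.
        by rewrite addrA subrK.
      by rewrite mulmxA kC mulmxDl -scalemxAl mul_scalar_mx addrC.
    have -> : w *: C + k%:M = w *: (C + kap'%:M) by rewrite scalerDr scale_scalar_mx.
    by rewrite -scalemxAl -scalemxAr (mulmxA N) NC mul1mx.
  have := congr1 nsq NE; rewrite nsqZ -/s => sE.
  rewrite -(ler_pM2l (lt_trans ltr01 s1)) sE; apply: le_trans (nsqM _ _) _.
  have yt := nsq_ge0 (Y t).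
  have : nsq N * nsq (cB t *m Y t + w *: (M t *m Y t)) <= rho * (2 * (b1 + s * b1) * nsq (Y t)).
    by rewrite ler_pM ?nsq_ge0 ?nB.
  move=> /le_trans; apply; rewrite [leRHS](_ : _ = rho * (2 * (2 * s * b1) * nsq (Y t))); last by ring.
  rewrite ler_wpM2l// ler_wpM2r// ler_wpM2l//.
  suff : b1 <= s * b1 by lra.
  by rewrite ler_peMl// ?(ltW s1)//; lra.
pose g t := (w *: C - k%:M) *m Y t - cF t *m Y t.
have gb t : al <= t <= be -> nsq (g t) <= K2 * nsq (Y t).
  move=> tab; have [Ft _ _] := b1M t tab; apply: le_trans (nsqB _ _) _.
  rewrite /K2 -mulrA ler_wpM2l// mulrDl lerD ?g1b//.
  by apply: le_trans (nsqM _ _) _; rewrite ler_wpM2r ?nsq_ge0.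
pose c := 2 * complex.Re k.
(* With the exponential removed, the logarithmic derivative is bounded by [L] independently of [z]
   and [w]. *)
pose m t := expR (- (c * (t - x0))) * nsq (Y t).
have md t : al <= t <= be -> is_derive t 1 m (expR (- (c * (t - x0))) * (2 * ipr (Y t) (g t))).
  move=> tab; have tI := It t tab.
  have YdE : (w *: C - cF t) *m Y t = k *: Y t + g t.
    by rewrite /g !mulmxBl mul_scalar_mx addrA [k *: _ + _]addrC subrK.
  have nd := is_derive_nsq (Yd t tI); rewrite YdE iprDr iprZ in nd.
  have ed : is_derive t 1 (fun u => - (c * (u - x0))) (- c).
    have -> : (fun u => - (c * (u - x0))) = - (c *: (id - cst x0)) by [].
    by apply: is_derive_eq; rewrite subr0 /GRing.scale /= mulr1.
  have -> : m = (expR \o (fun u => - (c * (u - x0)))) * (nsq \o Y) by [].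
  by apply: is_derive_eq; rewrite /GRing.scale /= /c; ring.
have mb t : al <= t <= be -> `|expR (- (c * (t - x0))) * (2 * ipr (Y t) (g t))| <= L * m t.
  move=> tab; rewrite normrM ger0_norm ?expR_ge0// /m mulrCA ler_wpM2l ?expR_ge0//.
  by apply: le_trans (ipr_le _ _) _; rewrite /L mulrDl mul1r lerD2l gb.
move=> x xab e; have xh := hull x xab.
have absx : `|x - x0| <= be - al.
  by case/andP: xh => ? ?; case/andP: hullx0 => ? ?; rewrite ler_norml; apply/andP; split; lra.
have eb : expR (L * `|x - x0|) <= K.
  apply: le_trans (_ : expR (L * (be - al)) <= _); first by rewrite ler_expR ler_wpM2l.
  by rewrite /K; lra.
have m0 : m x0 = nsq (Y x0) by rewrite /m subrr mulr0 oppr0 expR0 mul1r.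
have mx : nsq (Y x) = e * m x.
  by rewrite /m mulrA /e -expRD subrr expR0 mul1r.
have e0 := expR_ge0 (2 * complex.Re k * (x - x0)).
have nn t : 0 <= m t by rewrite /m mulr_ge0 ?expR_ge0 ?nsq_ge0.
rewrite mx -m0; split.
  rewrite [leRHS]mulrCA ler_wpM2l//; apply: le_trans (gronwall_abs L0 md mb xh hullx0) _.
  by rewrite ler_wpM2r.
rewrite [leRHS]mulrCA ler_wpM2l//; apply: le_trans (gronwall_abs L0 md mb hullx0 xh) _.
by rewrite distrC ler_wpM2r.
Qed.

End Growth.

Section Schrodinger.
Context {R : realType}.
Variables (n : nat) (I : set R) (U : R -> 'M[R]_n).

Lemma schrodingerD k (Y Z Y' Z' : R -> 'M[R[i]]_(n, k)) :
  schrodinger I U Y Z -> schrodinger I U Y' Z' ->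
  schrodinger I U (fun x => Y x + Y' x) (fun x => Z x + Z' x).
Proof.
move=> [Y1 [Y2 H]] [Y1' [Y2' H']].
exists (fun x => Y1 x + Y1' x), (fun x => Y2 x + Y2' x) => x Ix.
have [Yd Y1d ->] := H x Ix; have [Yd' Y1d' ->] := H' x Ix.
split; [exact: is_cderiveD|exact: is_cderiveD|].
by rewrite mulmxDr opprD addrACA.
Qed.

Lemma schrodingerZ k a (Y Z : R -> 'M[R[i]]_(n, k)) :
  schrodinger I U Y Z -> schrodinger I U (fun x => a *: Y x) (fun x => a *: Z x).
Proof.
move=> [Y1 [Y2 H]]; exists (fun x => a *: Y1 x), (fun x => a *: Y2 x) => x Ix.
have [Yd Y1d ->] := H x Ix; split; [exact: is_cderiveZ|exact: is_cderiveZ|].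
by rewrite scalerDr scalerN scalemxAr.
Qed.

Lemma schrodinger_sum k (T : eqType) (s : seq T) (Y Z : T -> R -> 'M[R[i]]_(n, k)) :
  (forall t, t \in s -> schrodinger I U (Y t) (Z t)) ->
  schrodinger I U (fun x => \sum_(t <- s) Y t x) (fun x => \sum_(t <- s) Z t x).
Proof.
elim: s => [|t s IH] H.
  exists (fun=> 0), (fun=> 0) => x _.
  have -> : (fun x => \sum_(t <- [::]) Y t x) = fun=> 0.
    by apply/funext => u; rewrite big_nil.
  by split; [exact: is_cderive_cst|exact: is_cderive_cst|rewrite /= !big_nil mulmx0 oppr0 addr0].
have -> : (fun x => \sum_(t <- t :: s) Y t x) = fun x => Y t x + \sum_(t <- s) Y t x.
  by apply/funext => u; rewrite big_cons.
have -> : (fun x => \sum_(t <- t :: s) Z t x) = fun x => Z t x + \sum_(t <- s) Z t x.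
  by apply/funext => u; rewrite big_cons.
apply: schrodingerD; first by apply: H; rewrite mem_head.
by apply: IH => u us; apply: H; rewrite in_cons us orbT.
Qed.

End Schrodinger.

(** * Uniqueness for [L y = z y] and the exponential singularity *)

Section FiniteGap.
Context {R : realType}.
Variables (n : nat) (J : 'M[R]_n.+1) (I : set R) (F B : R -> 'M[R]_n.+1) (x0 : R).
Hypotheses (oI : open I) (Ii : is_interval I) (Ix0 : I x0) (J_sym : sym_mx J).
Local Notation C := (complexify J).
Hypothesis FB : reduced_dressing_system I C F B.
Hypothesis Ju : J \in unitmx.
Hypothesis Cb : exists u v : {poly R[i]}, u * char_poly C + v * char_poly (- C) = 1.
Local Notation cF x := (complexify (F x)).
Local Notation cB x := (complexify (B x)).
Local Notation U := (dressing_potential F B).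

Let Cu : C \in unitmx. Proof. by rewrite /complexify map_unitmx. Qed.

(* With [V = Y' + F Y] the equation [L Y = z Y] becomes the first order system
   [Y' = V - F Y], [V' = (B - z) Y + F V], which does not involve [F']. *)
Lemma schrodinger_zero k z (Y : R -> 'M[R[i]]_(n.+1, k)) :
  schrodinger I U Y (fun x => z *: Y x) -> Y x0 = 0 -> is_cderive x0 Y 0 ->
  forall x, I x -> Y x = 0.
Proof.
move=> [Y1 [Y2 H]] Y0 Y0d x Ix.
pose V x := Y1 x + cF x *m Y x.
pose W x := row_mx (Y x) (V x).
pose dW x := row_mx (V x - cF x *m Y x) ((cB x - z%:M) *m Y x + cF x *m V x).
have Fd t (tI : I t) : is_cderive t (fun x => cF x) (complexify (derive1 F t)).
  by have [_ _ Fd _ _] := reduced_derive FB tI; apply/is_cderive_complexify.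
have Bd t (tI : I t) : is_cderive t (fun x => cB x) (complexify (lie (B t) (F t))).
  by have [_ _ _ Bd _] := reduced_derive FB tI; apply/is_cderive_complexify.
have Wd t : I t -> is_cderive t W (dW t).
  move=> tI; have [Yd Y1d E] := H t tI; apply: is_cderive_row_mx.
    by rewrite /V addrK.
  have -> : (cB t - z%:M) *m Y t + cF t *m V t =
      Y2 t + (complexify (derive1 F t) *m Y t + cF t *m Y1 t).
    have -> : Y2 t = complexify (U t) *m Y t - z *: Y t.
      by rewrite E opprD opprK addrCA subrr addr0.
    rewrite mulmxBl mul_scalar_mx /V /dressing_potential.
    rewrite !(complexifyD, complexifyN, complexifyM) mulmxDr !mulmxDl mulNmx mulmxA.
    move: (cB t *m Y t) (z *: Y t) (cF t *m Y1 t) (cF t *m cF t *m Y t)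
      (complexify (derive1 F t) *m Y t) => X1 X2 X3 X4 X5.
    by apply/matrixP => i j; rewrite !mxE; ring.
  by apply: is_cderiveD => //; apply: is_cderiveM => //; exact: Fd.
pose h x := (2 + 4 * nsq (z%:M : 'M[R[i]]_n.+1) * 2) + (4 * nsq (cF x) + 8 * nsq (cB x)).
have hb : locb I h.
  apply: locbD; first by apply: locb_cst; rewrite addr_ge0// !mulr_ge0 ?nsq_ge0.
  apply: locbD; apply: locbZ => //.
    by apply: (locb_nsq Ii) => t /Fd; exists (complexify (derive1 F t)).
  by apply: (locb_nsq Ii) => t /Bd; exists (complexify (lie (B t) (F t))).
have Wh t : I t -> nsq (dW t) <= h t * nsq (W t).
  move=> tI; rewrite /dW /W !nsq_row_mx.
  have := nsqB (V t) (cF t *m Y t); have := nsqM (cF t) (Y t).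
  have := nsqD ((cB t - z%:M) *m Y t) (cF t *m V t); have := nsqM (cF t) (V t).
  have := nsqM (cB t - z%:M) (Y t); have := ler_wpM2r (nsq_ge0 (Y t)) (nsqB (cB t) (z%:M)).
  have y0 := nsq_ge0 (Y t); have v0 := nsq_ge0 (V t).
  have b0 := nsq_ge0 (cB t); have f0 := nsq_ge0 (cF t).
  have z0 := nsq_ge0 (z%:M : 'M[R[i]]_n.+1).
  rewrite /h; move: (nsq (V t - _)) (nsq (_ *m Y t + _)) (nsq (cF t *m V t)) (nsq (cF t *m Y t))
    (nsq ((cB t - _) *m Y t)) (nsq (cB t - _)) (nsq (Y t)) (nsq (V t)) (nsq (cB t))
    (nsq (cF t)) (nsq z%:M) y0 v0 b0 f0 z0 => N1 N2 N3 N4 N5 N6 y v b f c y0 v0 b0 f0 c0.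
  have := mulr_ge0 b0 v0; have := mulr_ge0 c0 v0; have := mulr_ge0 f0 v0.
  have := mulr_ge0 b0 y0; have := mulr_ge0 c0 y0; have := mulr_ge0 f0 y0.
  lra.
have V0 : V x0 = 0.
  have [Yd _ _] := H x0 Ix0.
  by rewrite /V Y0 mulmx0 addr0 (is_cderive_unique Yd Y0d).
have := ode_zero Ii hb Wd Wh Ix0 _ Ix.
rewrite /W Y0 V0 row_mx0 => /(_ erefl).
by rewrite -row_mx0 => /eq_row_mx[].
Qed.

Lemma exponential_eigenfunction (p : {poly {poly R[i]}})
    (psi : R -> R[i] -> R[i] -> 'cV[R[i]]_n.+1) (E : 'I_n.+1 -> {poly {poly R[i]}}) :
  (forall z w, on_curve p z w -> forall x, I x ->
    is_cderive x (fun x => psi x z w) ((w *: C - cF x) *m psi x z w)) ->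
  (forall z w, on_curve p z w -> forall x, I x ->
    lax J F B w x *m psi x z w = z *: psi x z w) ->
  (forall z w i, psi x0 z w i ord0 = (E i).[w%:P].[z]) ->
  exponential_at_infinity I p psi.
Proof.
move=> psid psil psi0; exists x0 => // a b Ia Ib.
have [K1 K11 HK1] := eigenfunction_growth Ii Ix0 FB Cu Cb Ia Ib.
have /choice[N /choice[KE EK]] := fun i => poly2_bounded (E i).
(* The factor [n.+1] passes from the squared Frobenius norm to the maximum norm; the [KE i] are the
   thresholds of the polynomial bounds on the entries at [x0]. *)
pose K := 1 + K1 * n.+1%:R + \sum_i `|KE i|; pose NN := (\sum_i N i)%N.
have sK0 : 0 <= \sum_i `|KE i| by apply: sumr_ge0.
have n1 : 1 <= n.+1%:R :> R by rewrite ler1n.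
have K1n : K1 <= K1 * n.+1%:R by rewrite ler_peMr//; lra.
exists K, NN => z w zw Kz.
have K1' : 1 <= K by rewrite /K; lra.
have Zs : K <= Num.sqrt (sqc z) by rewrite -lecR -sqc_normE.
have KZ : K <= sqc z.
  rewrite -[leRHS](sqr_sqrtr (sqc_ge0 z)) expr2.
  by apply: le_trans (_ : K * K <= _); [rewrite ler_peMl//; lra|rewrite ler_pM//; lra].
(* Where the eigenvector vanishes at [x0], [psi] vanishes for all [x], and any square root of [- z]
   serves. *)
have [y0|y0] := eqVneq (psi x0 z w) 0.
  have y x : I x -> psi x z w = 0.
    apply: (@lin_ode_zero R I _ _ (fun x => w *: C - cF x) (fun x => psi x z w) x0) => //.
      by move=> t tI; exists (- complexify (derive1 F t)); exact: (coef_derive FB).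
    by move=> t tI; exact: psid.
  split; first by rewrite y0 normr0 exprn_ge0.
  exists (sqrtC (- z)); first exact: sqrtCK.
  move=> x xab /=; have xI : I x := Ii Ia Ib xab.
  by rewrite y0 y// normr0 !mulr0.
have [wz [k kz kE]] := HK1 z w (fun x => psi x z w) ltac:(rewrite /K in KZ; lra) y0
  (psid z w zw) (psil z w zw).
split.
  apply: mx_norm_le => [|i j]; first by rewrite exprn_ge0.
  rewrite ord1 !sqc_normE -rmorphXn lecR.
  rewrite -ler_sqr ?nnegrE ?exprn_ge0 ?sqrtr_ge0// sqr_sqrtr ?sqc_ge0//.
  rewrite exprAC sqr_sqrtr ?sqc_ge0// psi0.
  apply: le_trans (EK i z w _ wz) _.
    apply: le_trans (ler_norm _) _; apply: le_trans KZ; rewrite /K (bigD1 i)//=.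
    have : 0 <= \sum_(j | j != i) `|KE j| by apply: sumr_ge0.
    by lra.
  by rewrite ler_weXn2l ?(le_trans K1')// /NN (bigD1 i)//= leq_addr.
exists k => // x xab e.
have eE : expR (2 * complex.Re k * (x - x0)) = expR (complex.Re k * (x - x0)) ^+ 2.
  by rewrite expr2 -expRD; congr expR; ring.
have [] := kE x xab; rewrite /= eE => H1 H2.
have e0 := expR_gt0 (complex.Re k * (x - x0)).
rewrite /e !rnormE -!rmorphM !lecR.
move: (expR (complex.Re k * (x - x0))) e0 H1 H2 => e' e0 H1 H2.
have r0 := rnorm_ge0 (psi x0 z w); have r1 := rnorm_ge0 (psi x z w).
have s0 := rnorm_sqr_le (psi x0 z w); have s1 := rnorm_sqr_le (psi x z w).
have t0 := nsq_le_rnorm (psi x0 z w); have t1 := nsq_le_rnorm (psi x z w).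
rewrite muln1 in t0 t1.
have KK : K1 * n.+1%:R <= K ^+ 2.
  apply: le_trans (_ : K <= _); first by rewrite /K; lra.
  by rewrite expr2 ler_peMl//; lra.
have K10 : 0 <= K1 by lra.
have sq u v c : 0 <= c -> 0 <= v -> u <= K1 * (n.+1%:R * (c * v ^+ 2)) -> u <= K ^+ 2 * (c * v ^+ 2).
  move=> c0 v0 /le_trans; apply; rewrite [leLHS]mulrA ler_wpM2r//.
  by rewrite mulr_ge0// sqr_ge0.
split.
  rewrite -ler_sqr ?nnegrE ?mulr_ge0 ?(ltW e0)//; last by lra.
  rewrite !exprMn -mulrA; apply: sq; rewrite ?sqr_ge0//.
  apply: le_trans s1 _; apply: le_trans H1 _; rewrite ler_wpM2l//.
  by rewrite mulrCA ler_wpM2l ?sqr_ge0.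
rewrite -ler_sqr ?nnegrE ?mulr_ge0 ?(ltW e0)//; last by lra.
rewrite !exprMn -[rnorm (psi x z w) ^+ 2]mul1r; apply: sq => //.
rewrite mul1r; apply: le_trans (_ : e' ^+ 2 * nsq (psi x0 z w) <= _).
  by rewrite ler_wpM2l ?sqr_ge0.
by apply: le_trans H2 _; rewrite ler_wpM2l.
Qed.

End FiniteGap.

(** * The Baker-Akhiezer functions and the finite-gap property *)

Section FiniteGapTheorem.
Context {R : realType}.
Variables (n : nat) (J : 'M[R]_n.+1) (I : set R) (F B : R -> 'M[R]_n.+1).
Hypotheses (oI : open I) (Ii : is_interval I) (J_sym : sym_mx J).
Local Notation C := (complexify J).
Hypothesis FB : reduced_dressing_system I C F B.
Hypothesis Ju : J \in unitmx.
Hypothesis Cb : exists u v : {poly R[i]}, u * char_poly C + v * char_poly (- C) = 1.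
Local Notation cF x := (complexify (F x)).
Local Notation cB x := (complexify (B x)).
Local Notation U := (dressing_potential F B).

(** Every column [j] of [eigenproj] gives one function [psi j]: a single column may vanish on a
    component of the curve, and a multiple component needs several. *)
Lemma finite_gap_reduced x0 : I x0 -> finite_gap I U.
Proof.
move=> Ix0; have Cu : C \in unitmx by rewrite /complexify map_unitmx.
have [FS BS _ _ _] := reduced_derive FB Ix0.
have [q [qU [qV [c [Tq Uq c0]]]]] := companion_annihilator J_sym FS BS Ju.
pose T := ccompanion J (F x0) (B x0).
pose p := char_poly T; pose P z w : 'M[R[i]]_(n.+1 + n.+1) := @eigenproj _ (n + n.+1) T q z w.
have curveE z w : on_curve p z w <-> (char_poly (map_mx (horner_eval z) T)).[w] = 0.
  by rewrite /on_curve /p (@char_poly_eval _ (n + n.+1)).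
have /choice[Phi PhiP] : forall w, exists Phi : R -> 'M[R[i]]_n.+1, Phi x0 = 1%:M /\
    forall x, I x -> is_cderive x Phi ((w *: C - cF x) *m Phi x).
  move=> w; have [|Phi ? ?] := @fundamental R I x0 oI Ii Ix0 n.+1 (fun x => w *: C - cF x).
    by move=> x Ix; exists (- complexify (derive1 F x)); exact: (coef_derive FB).
  by exists Phi.
have eigP z w : on_curve p z w -> dsubmx (P z w) = w *: usubmx (P z w) /\
    lax J F B w x0 *m usubmx (P z w) = z *: usubmx (P z w).
  move=> /curveE zw.
  have TP : map_mx (horner_eval z) T *m P z w = w *: P z w.
    exact: (@eigenproj_eigen _ (n + n.+1) T q Tq z w zw).
  move: TP; rewrite /T ccompanion_eval; move: (P z w) => N.
  rewrite -[N]vsubmxK mul_block_col scale_col_mx mul0mx add0r mul1mx col_mxKu col_mxKd.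
  move=> /eq_col_mx[dE E]; split=> //; move: E; rewrite dE -mulmxA -mulmxA -mulmxDr.
  set N1 := usubmx N => /(congr1 (mulmx (C *m C))).
  have CJ (X : 'M[R[i]]_(n.+1, n.+1 + n.+1)) :
      C *m C *m (complexify (invmx J *m invmx J) *m X) = X.
    rewrite complexifyM /complexify !map_invmx -/(complexify J) !mulmxA mulmxK//.
    by rewrite mulmxV// mul1mx.
  rewrite CJ scalerA -expr2 mulmxBl mul_scalar_mx -!scalemxAr => E.
  rewrite complexifyD !complexifyM in E.
  rewrite /lax mulmxBl mulmxDl -!scalemxAl -E.
  move: (cB x0 *m N1) (w *: _) (z *: N1) => X1 X2 X3.
  by apply/matrixP => i j; rewrite !mxE; ring.
pose psi (j : 'I_(n.+1 + n.+1)) x z w := Phi w x *m col j (usubmx (P z w)).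
have psid j z w x : I x -> is_cderive x (fun x => psi j x z w) ((w *: C - cF x) *m psi j x z w).
  by move=> Ix; rewrite mulmxA; apply: is_cderiveMr; case: (PhiP w) => _; apply.
have psil j z w : on_curve p z w -> forall x, I x -> lax J F B w x *m psi j x z w = z *: psi j x z w.
  move=> zw; apply: (lax_eigen Ii FB Ix0) => [x|]; first exact: psid.
  have [_ LE] := eigP z w zw; have [P0 _] := PhiP w.
  by rewrite /psi P0 mul1mx colE mulmxA LE -scalemxAl.
have psiS j z w : on_curve p z w ->
    schrodinger I U (fun x => psi j x z w) (fun x => z *: psi j x z w).
  move=> zw; apply: (lax_schrodinger FB (psid j z w)) => x Ix.
  by rewrite psil.
pose E (j : 'I_(n.+1 + n.+1)) (i : 'I_n.+1) : {poly {poly R[i]}} :=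
  @eigenproj_poly _ (n + n.+1) T q (lshift n.+1 i) j.
have colE' j i z w : col j (usubmx (P z w)) i ord0 = (E j i).[w%:P].[z].
  by rewrite !mxE (@eigenproj_polyE _ (n + n.+1)).
exists p, (n.+1 + n.+1)%N, psi; split.
- exact: char_poly_monic.
- move=> j x i Ix; apply: holomorphic_meromorphic => z w t zh wh.
  have -> : (fun s => psi j x (z s) (w s) i ord0) =
      fun s => \sum_k Phi (w s) x i k * (E j k).[(w s)%:P].[z s].
    by apply/funext => s; rewrite mxE; apply: eq_bigr => k _; rewrite colE'.
  apply: holo_sum => k; apply: holoM; last exact: holo_horner2.
  apply: (@holo_comp R (fun v => Phi v x i k) w t wh).
  have Fd y : I y -> exists D, is_cderive y (fun x => cF x) D.
    move=> /(reduced_derive FB)[_ _ Fd _ _]; exists (complexify (derive1 F y)).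
    exact/is_cderive_complexify.
  exact: (@fundamental_holomorphic R I x0 oI Ii Ix0 n.+1 C (fun x => cF x) Phi Fd
    (fun v => (PhiP v).1) (fun v => (PhiP v).2) x i k (w t) Ix).
- by move=> j z w zw; exact: psiS.
- move=> j; apply: (exponential_eigenfunction Ii Ix0 FB Ju Cb (E := E j)).
  + by move=> z w _ x Ix; exact: psid.
  + exact: psil.
  + by move=> z w i; have [P0 _] := PhiP w; rewrite /psi P0 mul1mx colE'.
have [bad badP] := @eigenproj_sum _ (n + n.+1) T q qU qV c Tq Uq c0.
exists bad => z /badP[s [a [sc sum1]]] y yS.
have scP w : w \in s -> on_curve p z w by move=> /sc /curveE.
have [Y1 [Y2 yH]] := yS; have [yd _ _] := yH x0 Ix0.
(* The Cauchy data of [y] in companion coordinates. Resolving the identity by the [eigenproj z w]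
   decomposes [eta] into eigenvectors, and its entries become coefficients of the [psi j]. *)
pose eta : 'cV[R[i]]_(n.+1 + n.+1) := col_mx (y x0) (invmx C *m (Y1 x0 + cF x0 *m y x0)).
exists s, (fun w j => a w * eta j ord0); split=> // x Ix.
pose yt x := \sum_(w <- s) \sum_j (a w * eta j ord0) *: psi j x z w.
pose N w := usubmx (P z w) *m eta.
have sumN : \sum_(w <- s) a w *: N w = y x0 /\
    \sum_(w <- s) a w *: (dsubmx (P z w) *m eta) = invmx C *m (Y1 x0 + cF x0 *m y x0).
  have : \sum_(w <- s) a w *: (P z w *m eta) = eta.
    rewrite -[RHS]mul1mx -[X in _ = X *m _]sum1 mulmx_suml.
    by apply: eq_bigr => w _; rewrite -scalemxAl.
  rewrite (eq_bigr (fun w => col_mx (a w *: N w) (a w *: (dsubmx (P z w) *m eta)))).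
    have -> : \sum_(w <- s) col_mx (a w *: N w) (a w *: (dsubmx (P z w) *m eta)) =
        col_mx (\sum_(w <- s) a w *: N w) (\sum_(w <- s) a w *: (dsubmx (P z w) *m eta)).
      elim: (s) => [|w r IH]; first by rewrite !big_nil col_mx0.
      by rewrite !big_cons IH add_col_mx.
    by move=> /eq_col_mx.
  by move=> w _; rewrite -scale_col_mx -mul_col_mx vsubmxK.
have sumj w (G : 'M[R[i]]_n.+1) :
    \sum_j (a w * eta j ord0) *: (G *m col j (usubmx (P z w))) = a w *: (G *m N w).
  rewrite /N; move: (usubmx (P z w)) (eta) => M e.
  under eq_bigr do rewrite -scalerA scalemxAr.
  rewrite -scaler_sumr -mulmx_sumr; congr (_ *: (_ *m _)).
  apply/matrixP => i k; rewrite summxE mxE; apply: eq_bigr => j _.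
  by rewrite !mxE mulrC (ord1 k).
have ytd : is_cderive x0 yt (\sum_(w <- s) \sum_j (a w * eta j ord0) *:
    ((w *: C - cF x0) *m psi j x0 z w)).
  by apply: is_cderive_sum => w; apply: is_cderive_sum => j; apply: is_cderiveZ; exact: psid.
have ytS : schrodinger I U yt (fun x => z *: yt x).
  have -> : (fun x => z *: yt x) = fun x =>
      \sum_(w <- s) \sum_j (a w * eta j ord0) *: (z *: psi j x z w).
    apply/funext => t; rewrite scaler_sumr; apply: eq_bigr => w _; rewrite scaler_sumr.
    by apply: eq_bigr => j _; rewrite !scalerA mulrC.
  apply: schrodinger_sum => w ws; apply: schrodinger_sum => j _; apply: schrodingerZ.
  exact/psiS/scP.
have yt0 : yt x0 = y x0.
  rewrite /yt -(proj1 sumN); apply: eq_bigr => w _.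
  by have [P0 _] := PhiP w; rewrite /psi P0 sumj mul1mx.
have yt0' : \sum_(w <- s) \sum_j (a w * eta j ord0) *: ((w *: C - cF x0) *m psi j x0 z w) = Y1 x0.
  transitivity (\sum_(w <- s) a w *: ((w *: C - cF x0) *m N w)).
    by apply: eq_bigr => w _; have [P0 _] := PhiP w; rewrite /psi P0 -sumj;
      apply: eq_bigr => j _; rewrite mul1mx.
  transitivity (C *m (\sum_(w <- s) a w *: (dsubmx (P z w) *m eta)) -
      cF x0 *m (\sum_(w <- s) a w *: N w)).
    rewrite !mulmx_sumr -sumrB big_seq [RHS]big_seq; apply: eq_bigr => w ws.
    have [-> _] := eigP z w (scP w ws).
    rewrite mulmxBl scalerBr -!scalemxAr -!scalemxAl; congr (_ - _).
    by rewrite -scalemxAr.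
  by have [-> ->] := sumN; rewrite mulKVmx// addrK.
(* The difference solves the same equation with zero value and zero derivative at [x0]. *)
have DS : schrodinger I U (fun x => y x + (-1) *: yt x) (fun x => z *: (y x + (-1) *: yt x)).
  have -> : (fun x => z *: (y x + (-1) *: yt x)) = fun x => z *: y x + (-1) *: (z *: yt x).
    by apply/funext => t; rewrite scalerDr !scalerA mulrC.
  by apply: schrodingerD => //; apply: schrodingerZ.
have D0 : y x0 + (-1) *: yt x0 = 0 by rewrite yt0 scaleN1r subrr.
have Dd : is_cderive x0 (fun x => y x + (-1) *: yt x) 0.
  rewrite yt0' in ytd; have := is_cderiveD yd (is_cderiveZ (-1) ytd).
  by rewrite scaleN1r subrr.
have := schrodinger_zero Ii Ix0 FB DS D0 Dd Ix.
by rewrite scaleN1r => /eqP; rewrite subr_eq0 => /eqP.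
Qed.

End FiniteGapTheorem.

Theorem theorem2 (R : realType) (d : nat) (d_gt0 : (0 < d)%N)
    (C : 'M[R[i]]_d)
    (C_eig : forall a b : R[i], eigenvalue C a -> eigenvalue C b -> a + b != 0)
    (J : 'M[R]_d) (J_sym : sym_mx J) (CJ : C = complexify J)
    (I : set R) (I_open : open I) (I_itv : is_interval I) (I_neq0 : I !=set0) :
  [/\ (* the velocity field of the system is well defined on, and tangent to,
         the space of real skew-symmetric F and real symmetric B *)
      forall F0 B0 : 'M[R]_d, skew_mx F0 -> sym_mx B0 ->
        exists X Y : 'M[R]_d, [/\ skew_mx X, sym_mx Y &
          forall Z W : 'M[R[i]]_d,
            dressing_velocity C (complexify F0) (complexify B0) Z W <->
            Z = complexify X /\ W = complexify Y],
      (* a solution lying in that space at one point stays in it *)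
      forall (F B : R -> 'M[R[i]]_d), dressing_system I C F B ->
        forall (x0 : R) (F0 B0 : 'M[R]_d), I x0 ->
        skew_mx F0 -> sym_mx B0 ->
        F x0 = complexify F0 -> B x0 = complexify B0 ->
        exists Fr Br : R -> 'M[R]_d, reduced_dressing_system I C Fr Br /\
          forall x, I x -> F x = complexify (Fr x) /\ B x = complexify (Br x),
      (* the reduced system is the rigid body system *)
      forall F B : R -> 'M[R]_d,
        reduced_dressing_system I C F B <->
        rigid_body I J F B (fun t => J *m F t + F t *m J)
    & (* motion of the body frame *)
      forall F B : R -> 'M[R]_d, reduced_dressing_system I C F B ->
        let U := dressing_potential F B in
        [/\ finite_gap I U,
            exists Q : R -> 'M[R]_d, body_frame I F Q
          & forall Q : R -> 'M[R]_d, body_frame I F Q ->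
            let phi := fun x => invmx (Q x) in
            exists Lambda : 'M[R]_d,
            [/\ sym_mx Lambda,
                forall x, I x ->
                  [/\ B x = invmx (Q x) *m Lambda *m Q x,
                      derivable phi x 1,
                      F x = - derive1 phi x *m invmx (phi x)
                    & B x = phi x *m Lambda *m invmx (phi x)],
                schrodinger I U (fun x => complexify (phi x))
                  (fun x => complexify (phi x *m Lambda))
              & forall beta : 'rV[R]_d, Lambda = diag_mx beta ->
                forall j, schrodinger I U
                  (fun x => complexify (col j (phi x)))
                  (fun x => complexify (beta ord0 j *: col j (phi x)))]]].
Proof.
case: d d_gt0 C C_eig J J_sym CJ => // n _ C C_eig J J_sym CJ; subst C.
have J_inj := sylv_inj_eig C_eig.
(* The eigenvalue 0 would violate the condition on sums with both eigenvalues equal to it. *)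
have Ju : J \in unitmx.
  rewrite -row_free_unit -kermx_eq0; apply: contraT => /rowV0Pn[v /sub_kermxP vJ v0].
  have Jv : eigenvalue (complexify J) 0.
    apply/eigenvalueP; exists (complexify v).
      by rewrite -complexifyM vJ scale0r [LHS]map_mx0.
    by apply: contra_neq v0 => cv; apply: complexify_inj; rewrite cv [RHS]map_mx0.
  by have := C_eig _ _ Jv Jv; rewrite addr0 eqxx.
have [x0 Ix0] := I_neq0.
split.
- by move=> F0 B0; exact: reduced_velocity.
- by move=> F B FB x F0 B0 Ix; exact: (reduced_invariant J_sym J_inj I_open I_itv FB Ix).
- by move=> F B; exact: reduced_rigid.
- move=> F B FB U; split.
  + exact: (finite_gap_reduced I_open I_itv J_sym FB Ju (char_poly_bezout C_eig) Ix0).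
  + exact: (body_frame_exists I_open I_itv FB Ix0).
  + by move=> Q FQ; exact: (body_frame_motion I_open I_itv FB Ix0 FQ).
Qed.
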